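(* Let $\hat{P}_n=\mathbb{P}_n$ (the empirical bootstrap). Suppose that $\eta_0$ is uniformly bounded and $m$-times continuously differentiable with $\int[D^\alpha\eta_0(x)]^2dx<\infty$ for all multi-indices $|\alpha|=m$, and that $\eta_n$ and $\eta_n^*$ are kernel density estimators (based on the original and bootstrap data, respectively) with common symmetric $m$th order kernel function and common bandwidth $h$ such that $n^{-1/d}\prec h$. If $h\prec n^{-1/(4m)}$, then the bootstrap percentile intervals based on $\psi_{n,1}^*$ are asymptotically valid. If $h\prec n^{-1/(2m)}$, then the bootstrap percentile intervals based on $\psi_{n,2}^*$ and $\psi_{n,3}^*$ are asymptotically valid.
   Context: $X_1,\dots,X_n\in\mathcal{X}\subseteq\mathbb{R}^d$ are IID from $P_0\in\mathcal{M}$, the set of probability measures on $\mathcal{X}$ dominated by Lebesgue measure $\lambda$. $\eta_P:=dP/d\lambda$, $\eta_0:=\eta_{P_0}$ (viewed as a function on $\mathbb{R}^d$), $\psi(P):=\int\eta_P(x)^2dx$ (average density value), $\psi_0=\psi(P_0)$. $\mathbb{P}_n$ is the empirical distribution; $Pf:=\int f\,dP$. $T_1(\eta,P)=2P\eta-\int\eta^2$ (one-step), $T_2(\eta,P)=\int\eta^2$ (plug-in), $T_3(\eta,P)=P\eta$ (empirical mean plug-in); $\psi_{n,j}:=T_j(\eta_n,\mathbb{P}_n)$. Bootstrap: given the data, $X_1^*,\dots,X_n^*$ are IID from $\hat{P}_n$, with empirical distribution $\mathbb{P}_n^*$; $\psi_{n,j}^*:=T_j(\eta_n^*,\mathbb{P}_n^*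 )$. $P_W^*$ is conditional (outer) probability given the data. For $\alpha=(\alpha_1,\dots,\alpha_d)\in\mathbb{N}^d$ (nonnegative integers), $|\alpha|=\sum_i\alpha_i$, $x^\alpha=\prod_ix_i^{\alpha_i}$, and $D^\alpha$ is the corresponding partial derivative. A kernel density estimator with kernel $K:\mathbb{R}^d\to\mathbb{R}$ and deterministic bandwidth $h=h_n>0$ based on $x_1,\dots,x_n$ is $x\mapsto\frac1n\sum_ih^{-d}K((x-x_i)/h)$. Kernels satisfy $\int K=1$, $\int K^2<\infty$; $K$ is symmetric if $K(-x)=K(x)$; $K$ is of $m$th order if $\int z^\alpha K(z)dz=0$ for $1\le|\alpha|\le m-1$ and $\int|z^\alpha K(z)|dz<\infty$ for $|\alpha|=m$. For deterministic sequences, $r_n\prec s_n$ means $r_n/s_n=o(1)$. For levels $a,b\in(0,1)$, $a+b<1$, let $\xi_{n,p,j}^*:=\inf\{\xi:P_W^*(T_j(\eta_n^*,\mathbb{P}_n^* )-T_j(\eta_n,\hat{P}_n)\le\xi)\ge p\}$. The bootstrap percentile interval based on $\psi_{n,j}^*$ is $[\psi_{n,j}-\xi_{n,1-a,j}^*,\;\psi_{n,j}-\xi_{n,b,j}^*]$; it is asymptotically valid if the ($P_0^*$-)probability that it contains $\psi_0$ converges to $1-a-b$. *)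

(* Defs.v *)
From HB Require Import structures.
From mathcomp Require Import all_boot all_order all_algebra.
From mathcomp Require Import all_classical all_reals all_analysis.
Set Implicit Arguments.
Unset Strict Implicit.
Unset Printing Implicit Defensive.
Import Order.TTheory GRing.Theory Num.Theory.
Import numFieldNormedType.Exports.
Local Open Scope classical_set_scope.
Local Open Scope ring_scope.

Definition rV_display : measure_display. Proof. exact: default_measure_display. Qed.

Section measurable_rV.
Context (R : realType) (d : nat).

Let coord (i : 'I_d) (x : 'rV[R]_d) : measurableTypeR R := x ord0 i.

Let rV_set0 : g_sigma_preimage coord set0.
Proof. exact: sigma_algebra0. Qed.

Let rV_setC A : g_sigma_preimage coord A -> g_sigma_preimage coord (~` A).
Proof. exact: sigma_algebraC. Qed.

Let rV_bigcup (F : (set 'rV[R]_d)^nat) :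
  (forall i, g_sigma_preimage coord (F i)) ->
  g_sigma_preimage coord (\bigcup_i (F i)).
Proof. exact: sigma_algebra_bigcup. Qed.

(* The Borel sigma-algebra of R^d, as the product sigma-algebra. *)
HB.instance Definition _ := @isMeasurable.Build rV_display
  'rV[R]_d (g_sigma_preimage coord) rV_set0 rV_setC rV_bigcup.

Lemma measurable_rV_coord (i : 'I_d) :
  measurable_fun [set: 'rV[R]_d] (fun x : 'rV[R]_d => x ord0 i : measurableTypeR R).
Proof.
move=> _ Y mY; rewrite setTI; apply: sub_sigma_algebra => /=.
rewrite -bigcup_seq/=; exists i => /=; first by rewrite mem_index_enum.
by exists Y => //; rewrite setTI.
Qed.

Lemma measurable_fun_rV d1 (T1 : measurableType d1) (f : T1 -> 'rV[R]_d) :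
  (forall i, measurable_fun [set: T1] (fun x => f x ord0 i : measurableTypeR R)) ->
  measurable_fun [set: T1] f.
Proof.
move=> mf.
suff : g_sigma_preimage (fun i => coord i \o f) `<=` measurable.
  rewrite g_sigma_preimage_comp => prefS _ A mA; apply: prefS; by exists A.
apply: smallest_sub; first exact: sigma_algebra_measurable.
rewrite -bigcup_seq; apply: bigcup_sub => i _.
by move=> A [B mB <-]; exact: mf.
Qed.

End measurable_rV.

Section lebesgue_rV.
Context (R : realType).

Definition rV_cons (d : nat) (p : measurableTypeR R * 'rV[R]_d) : 'rV[R]_d.+1 :=
  \row_j (if unlift ord0 j is Some k then p.2 ord0 k else p.1).

Lemma measurable_rV_cons (d : nat) :
  measurable_fun [set: measurableTypeR R * 'rV[R]_d] (@rV_cons d).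
Proof.
apply: measurable_fun_rV => i; rewrite /rV_cons.
case: (unliftP ord0 i) => [j|] ->.
  rewrite (_ : (fun _ => _) = (fun x : 'rV[R]_d => x ord0 j) \o snd).
    exact: measurableT_comp (@measurable_rV_coord R d j) measurable_snd.
  by apply/funext => x /=; rewrite mxE liftK.
rewrite (_ : (fun _ => _) = fst); first exact: measurable_fst.
by apply/funext => x /=; rewrite mxE unlift_none.
Qed.

Section step.
Context (d : nat) (mu : {sigma_finite_measure set 'rV[R]_d -> \bar R}).

(* Lebesgue measure on R x R^d transported to R^(d+1). *)
Definition lebesgue_rV_step : set 'rV[R]_d.+1 -> \bar R :=
  pushforward (@lebesgue_measure R \x mu)%E (@rV_cons d).

Let mpre A : measurable A -> measurable (@rV_cons d @^-1` A).
Proof. by move=> mA; rewrite -[X in measurable X]setTI; exact: measurable_rV_cons. Qed.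

Let step0 : lebesgue_rV_step set0 = 0%E.
Proof. by rewrite /lebesgue_rV_step /pushforward preimage_set0 measure0. Qed.

Let step_ge0 A : (0 <= lebesgue_rV_step A)%E.
Proof. by rewrite /lebesgue_rV_step /pushforward; exact: measure_ge0. Qed.

Let step_sigma_additive : semi_sigma_additive lebesgue_rV_step.
Proof.
move=> F mF tF mUF; rewrite /lebesgue_rV_step /pushforward preimage_bigcup.
apply: measure_semi_sigma_additive.
- by move=> n; exact: mpre.
- apply/trivIsetP => /= i j _ _ ij; rewrite -preimage_setI.
  by move/trivIsetP : tF => /(_ _ _ _ _ ij) ->//; rewrite preimage_set0.
- by rewrite -preimage_bigcup; exact: mpre.
Qed.

HB.instance Definition _ := isMeasure.Build _ _ _ lebesgue_rV_step
  step0 step_ge0 step_sigma_additive.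

Let rV_uncons (x : 'rV[R]_d.+1) : measurableTypeR R * 'rV[R]_d :=
  (x ord0 ord0, \row_k x ord0 (lift ord0 k)).

Let rV_consK : cancel (@rV_cons d) rV_uncons.
Proof.
move=> [r x]; rewrite /rV_uncons /rV_cons mxE unlift_none; congr pair.
by apply/rowP => k; rewrite !mxE liftK.
Qed.

Let measurable_rV_uncons : measurable_fun setT rV_uncons.
Proof.
apply/measurable_fun_pairP; split => /=.
  exact: measurable_rV_coord.
apply: measurable_fun_rV => i.
rewrite (_ : (fun _ => _) = fun x : 'rV[R]_d.+1 => x ord0 (lift ord0 i)).
  exact: measurable_rV_coord.
by apply/funext => x /=; rewrite mxE.
Qed.

Let step_sigma_finite : sigma_finite setT lebesgue_rV_step.
Proof.
have /sigma_finiteP[F [TF ndF Foo]] := sigma_finiteT (@lebesgue_measure R).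
have /sigma_finiteP[G [TG ndG Goo]] := sigma_finiteT mu.
exists (fun n => rV_uncons @^-1` (F n `*` G n)).
  apply/esym; rewrite -subTset => x _.
  have : (\bigcup_n F n) (rV_uncons x).1 by rewrite -TF.
  have : (\bigcup_n G n) (rV_uncons x).2 by rewrite -TG.
  move=> [k _ Gk] [n _ Fn]; exists (maxn n k) => //; split.
  - by move: (rV_uncons x).1 Fn; exact/subsetPset/ndF/leq_maxl.
  - by move: (rV_uncons x).2 Gk; exact/subsetPset/ndG/leq_maxr.
move=> k; have [mF Fk] := Foo k; have [mG Gk] := Goo k.
have mFG : measurable (F k `*` G k) by exact: measurableX.
split; first by rewrite -[X in measurable X]setTI; exact: measurable_rV_uncons.
rewrite /lebesgue_rV_step /pushforward -comp_preimage.
rewrite (_ : rV_uncons \o _ = id); last by apply/funext => x /=; rewrite rV_consK.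
by rewrite preimage_id product_measure1E// lte_mul_pinfty// ge0_fin_numE.
Qed.

HB.instance Definition _ := Measure_isSigmaFinite.Build _ _ _ lebesgue_rV_step
  step_sigma_finite.

End step.

Fixpoint lebesgue_rV (d : nat) : {sigma_finite_measure set 'rV[R]_d -> \bar R} :=
  match d with
  | 0 => @dirac _ 'rV[R]_0 0 R
  | d'.+1 => lebesgue_rV_step (lebesgue_rV d')
  end.

End lebesgue_rV.

Lemma lebesgue_rV_box (R : realType) (d : nat)
    (A : 'I_d -> set (measurableTypeR R)) : (forall i, measurable (A i)) ->
  lebesgue_rV R d [set x | forall i, A i (x ord0 i)] =
  (\prod_(i < d) (@lebesgue_measure R (A i)))%E.
Proof.
elim: d A => [|d IH] A mA.
  by rewrite big_ord0 /= /dirac indicE mem_set// => -[].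
have mB : measurable [set x : 'rV[R]_d | forall i, A (lift ord0 i) (x ord0 i)].
  rewrite (_ : [set x | _] =
    \bigcap_(i in [set: 'I_d]) ((fun x : 'rV[R]_d => x ord0 i) @^-1` A (lift ord0 i))).
    apply: fin_bigcap_measurable => // i _.
    by rewrite -[X in measurable X]setTI; exact: measurable_rV_coord.
  by apply/seteqP; split => x /= h i; [move=> _; exact: h|exact: h].
rewrite big_ord_recl /= /lebesgue_rV_step /pushforward.
rewrite -(IH (fun i => A (lift ord0 i)))// -product_measure1E//.
congr product_measure1; apply/seteqP; split => -[r x] /=.
  move=> h; split; first by have := h ord0; rewrite /rV_cons mxE unlift_none.
  by move=> i; have := h (lift ord0 i); rewrite /rV_cons mxE liftK.
move=> [hr hx] i; rewrite /rV_cons mxE.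
by case: (unliftP ord0 i) => [j|] ->.
Qed.

Section smoothness.
Context (R : realType) (d : nat).
Implicit Types (f : 'rV[R]_d -> R) (a : 'I_d -> nat).

Definition partial (i : 'I_d) f : 'rV[R]_d -> R := fun x => 'D_(delta_mx ord0 i) f x.

Fixpoint Cn (m : nat) f : Prop :=
  match m with
  | 0 => continuous f
  | k.+1 => continuous f /\
      forall i, (forall x, derivable f x (delta_mx ord0 i)) /\ Cn k (partial i f)
  end.

Definition mlen a : nat := (\sum_(i < d) a i)%N.

Definition mpow (x : 'rV[R]_d) a : R := \prod_(i < d) x ord0 i ^+ a i.

(* D^a; the order of differentiation is immaterial on functions of class C^|a| *)
Definition mderive a f : 'rV[R]_d -> R :=
  foldr (fun i g => iter (a i) (partial i) g) f (enum 'I_d).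

End smoothness.

Section kernels.
Context (R : realType) (d : nat).
Implicit Types K : 'rV[R]_d -> R.
Local Notation lambda := (lebesgue_rV R d).

Definition is_kernel K : Prop :=
  [/\ lambda.-integrable setT (EFin \o K),
      (\int[lambda]_x (K x)%:E = 1)%E &
      (\int[lambda]_x (K x ^+ 2)%:E < +oo)%E].

Definition symmetric_kernel K : Prop := forall x, K (- x) = K x.

(* For a kernel of order m, the integrals required to vanish converge absolutely:
   |z^a| <= 1 + \sum_i |z_i|^m when |a| < m. *)
Definition kernel_order (m : nat) K : Prop :=
  (forall a : 'I_d -> nat, (1 <= mlen a <= m.-1)%N ->
     (\int[lambda]_z (mpow z a * K z)%:E = 0)%E) /\
  (forall a : 'I_d -> nat, mlen a = m ->
     (\int[lambda]_z `|mpow z a * K z|%:E < +oo)%E).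

Definition kde K (h : R) (n : nat) (x : n.-tuple 'rV[R]_d) : 'rV[R]_d -> R :=
  fun t => n%:R^-1 * \sum_(i < n) h ^- d * K (h^-1 *: (t - tnth x i)).

End kernels.

Section estimators.
Context (R : realType) (d : nat).
Local Notation rV := 'rV[R]_d.
Local Notation lambda := (lebesgue_rV R d).
Implicit Types (eta : rV -> R) (P : {measure set rV -> \bar R}).

(* The model M : laws concentrated on XX and dominated by Lebesgue measure. *)
Definition model (XX : set rV) (P : probability rV R) : Prop :=
  P XX = 1%E /\ P `<< lambda.

(* eta is a version of dP/dlambda *)
Definition is_density P eta : Prop :=
  [/\ measurable_fun setT eta, (forall x, 0 <= eta x) &
      forall A, measurable A -> P A = (\int[lambda]_(x in A) (eta x)%:E)%E].

Definition avg_density eta : R := \int[lambda]_x (eta x ^+ 2).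

Definition functional := (rV -> R) -> {measure set rV -> \bar R} -> R.

Definition one_step : functional := fun eta P =>
  2 * (\int[P]_x eta x) - \int[lambda]_x (eta x ^+ 2).
Definition plug_in : functional := fun eta P => \int[lambda]_x (eta x ^+ 2).
Definition mean_plug_in : functional := fun eta P => \int[P]_x eta x.

Definition empirical (n : nat) (x : n.-tuple rV) : {measure set rV -> \bar R} :=
  mscale (n%:R^-1)%:nng (msum (fun i => \d_(nth 0 x i)) n).

End estimators.

Section bootstrap.
Context (R : realType) (d : nat).
Local Notation rV := 'rV[R]_d.

(* n IID draws from the empirical distribution of x_1, ..., x_n are
   x_(s 1), ..., x_(s n) with s uniform on the n^n index maps. *)
Definition resample (n : nat) (x : n.-tuple rV) (s : n.-tuple 'I_n) : n.-tuple rV :=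
  [tuple tnth x (tnth s i) | i < n].

Definition boot_prob (n : nat) (x : n.-tuple rV) (E : set (n.-tuple rV)) : R :=
  #|[pred s : n.-tuple 'I_n | resample x s \in E]|%:R / #|{: n.-tuple 'I_n}|%:R.

Definition boot_quantile (T : functional R d) (K : rV -> R) (h : R) (n : nat)
    (x : n.-tuple rV) (p : R) : R :=
  inf [set xi : R |
    p <= boot_prob x
      [set y | T (kde K h y) (empirical y) - T (kde K h x) (empirical x) <= xi]].

Definition boot_interval (T : functional R d) (K : rV -> R) (h : R) (a b : R)
    (n : nat) (x : n.-tuple rV) : set R :=
  let psi_n := T (kde K h x) (empirical x) in
  `[psi_n - boot_quantile T K h x (1 - a), psi_n - boot_quantile T K h x b].

Definition sample (dO : measure_display) (Omega : measurableType dO)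
    (X : nat -> Omega -> rV) (n : nat) (w : Omega) : n.-tuple rV :=
  [tuple X i w | i < n].

(* mu_ext P is the outer probability associated with P. *)
Definition asymptotically_valid (dO : measure_display) (Omega : measurableType dO)
    (P : probability Omega R) (X : nat -> Omega -> rV)
    (T : functional R d) (K : rV -> R) (h : nat -> R) (psi0 : R) : Prop :=
  forall a b : R, 0 < a < 1 -> 0 < b < 1 -> a + b < 1 ->
    mu_ext P [set w | boot_interval T K (h n) a b (sample X n w) psi0]
      @[n --> \oo] --> (1 - a - b)%:E.

End bootstrap.

(* X i is the (i+1)-st observation. *)
Definition iid_sample (R : realType) (d : nat) (dO : measure_display)
    (Omega : measurableType dO) (P : probability Omega R)
    (X : nat -> {RV P >-> 'rV[R]_d}) (P0 : probability 'rV[R]_d R) : Prop :=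
  (forall i A, measurable A -> distribution P (X i) A = P0 A) /\
  (forall (s : seq nat) (A : nat -> set 'rV[R]_d), uniq s ->
     (forall i, measurable (A i)) ->
     P (\big[setI/setT]_(i <- s) (X i @^-1` A i)) =
     (\prod_(i <- s) P (X i @^-1` A i))%E).

Definition prec (R : realType) (r s : nat -> R) : Prop := r n / s n @[n --> \oo] --> 0.

(* Main.v *)
(** All three estimators are V-statistics n^-2 sum_(i, j) L(x_i, x_j): with
    K_h(u) = h^-d K(u / h), the kernel L is K_h(x - y) for the empirical mean
    plug-in, int K_h(t - x) K_h(t - y) dt for the plug-in, and twice the former
    minus the latter for the one-step estimator. The diagonal of L is constant
    and equal to O(h^-d), so it shifts the data statistic and its bootstrap
    version by the same amount and cancels in the percentile interval. After its
    removal, the Hoeffding decomposition leaves a linear part close to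
    2 n^-1/2 sum_i (eta0(X_i) - psi0), with degenerate remainder of variance
    O(1 / (n h^d)).

    A non-asymptotic Lindeberg argument compares the distribution function of
    the normalized V-statistic with that of a Rademacher sum of the same
    variance. It is applied once to the data and once, conditionally, to the
    bootstrap sample, whose error terms are empirical averages controlled by
    Markov's inequality. Since Rademacher sums have no large atoms, the
    bootstrap quantiles are squeezed between nearby quantiles of the reference
    law, which yields the coverage.

    It remains that sqrt n times the bias vanishes. With B = K_h * eta0 - eta0,
    the biases of the three estimators are int B eta0 (mean plug-in),
    2 int B eta0 + int B^2 (plug-in) and - int B^2 (one-step), and a Taylor
    expansion with integral remainder gives ||B||_2 = O(h^m). *)
From HB Require Import structures.
Require Import Defs.
From mathcomp Require Import all_boot all_order all_algebra.
From mathcomp Require Import all_classical all_reals all_analysis.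
From mathcomp Require Import measurable_realfun ring lra zify.
Set Implicit Arguments.
Unset Strict Implicit.
Unset Printing Implicit Defensive.
Import Order.TTheory GRing.Theory Num.Theory.
Import numFieldNormedType.Exports.
Local Open Scope classical_set_scope.
Local Open Scope ring_scope.

(** * Rademacher sums: smooth test functions and anticoncentration *)

Section smooth_step.
Context (R : realType).
Implicit Types x y : R.

Definition pos_part x : R := Num.max x 0.

(* The integrated uniform B-spline: a C^2 step from 0 to 1 on [0, 3], piecewise
   cubic, so that its Taylor bounds are elementary. *)
Definition step x : R :=
  (pos_part x ^+ 3 - 3 * pos_part (x - 1) ^+ 3 + 3 * pos_part (x - 2) ^+ 3
   - pos_part (x - 3) ^+ 3) / 6.
Definition step1 x : R :=
  (pos_part x ^+ 2 - 3 * pos_part (x - 1) ^+ 2 + 3 * pos_part (x - 2) ^+ 2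
   - pos_part (x - 3) ^+ 2) / 2.
Definition step2 x : R :=
  pos_part x - 3 * pos_part (x - 1) + 3 * pos_part (x - 2) - pos_part (x - 3).

Lemma pos_partP x : (x <= 0 /\ pos_part x = 0) \/ (0 <= x /\ pos_part x = x).
Proof.
rewrite /pos_part; case: (leP x 0) => h; [left|right]; split => //.
exact: ltW.
Qed.

Lemma pos_part_taylor x y :
  `|pos_part (x + y) ^+ 3 - pos_part x ^+ 3 - 3 * pos_part x ^+ 2 * y
    - 3 * pos_part x * y ^+ 2| <= `|y| ^+ 3.
Proof.
case: (pos_partP x) => -[hx ->]; case: (pos_partP (x + y)) => -[hxy ->].
- rewrite !expr0n /= !(mulr0, mul0r, subr0, addr0, normr0).
  by rewrite exprn_ge0.
- have y0 : 0 <= y by lra.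
  rewrite !expr0n /= !(mulr0, mul0r, subr0, addr0) (ger0_norm y0).
  rewrite ger0_norm ?exprn_ge0//.
  by apply: lerXn2r; rewrite ?nnegrE //; lra.
- have y0 : y <= 0 by lra.
  rewrite (ler0_norm y0).
  have -> : 0 ^+ 3 - x ^+ 3 - 3 * x ^+ 2 * y - 3 * x * y ^+ 2
          = (- (x + y)) ^+ 3 - (- y) ^+ 3 by ring.
  have h1 : (- (x + y)) ^+ 3 <= (- y) ^+ 3.
    by apply: lerXn2r; rewrite ?nnegrE; lra.
  have h2 : 0 <= (- (x + y)) ^+ 3 by apply: exprn_ge0; lra.
  rewrite ler_norml; apply/andP; split; lra.
- have -> : (x + y) ^+ 3 - x ^+ 3 - 3 * x ^+ 2 * y - 3 * x * y ^+ 2 = y ^+ 3.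
    by ring.
  by rewrite normrX.
Qed.

Lemma step_taylor x y :
  `|step (x + y) - step x - step1 x * y - step2 x * y ^+ 2 / 2|
    <= 4 / 3 * `|y| ^+ 3.
Proof.
have h0 := pos_part_taylor x y.
have h1 := pos_part_taylor (x - 1) y.
have h2 := pos_part_taylor (x - 2) y.
have h3 := pos_part_taylor (x - 3) y.
rewrite /step /step1 /step2.
rewrite (_ : x + y - 1 = x - 1 + y); last by ring.
rewrite (_ : x + y - 2 = x - 2 + y); last by ring.
rewrite (_ : x + y - 3 = x - 3 + y); last by ring.
move: h0 h1 h2 h3; rewrite !ler_norml => /andP[? ?] /andP[? ?] /andP[? ?] /andP[? ?].
apply/andP; split; lra.
Qed.

Lemma step2_le1 x : `|step2 x| <= 1.
Proof.
rewrite /step2.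
case: (pos_partP x) => -[? ->]; case: (pos_partP (x - 1)) => -[? ->];
case: (pos_partP (x - 2)) => -[? ->]; case: (pos_partP (x - 3)) => -[? ->];
rewrite ler_norml; apply/andP; split; lra.
Qed.

Lemma step_le0 x : x <= 0 -> step x = 0.
Proof.
move=> x0; rewrite /step /pos_part !max_r; try lra.
Qed.

Lemma step_ge3 x : 3 <= x -> step x = 1.
Proof.
move=> x3; rewrite /step.
rewrite /pos_part !max_l; lra.
Qed.

Lemma step_ge0 x : 0 <= step x.
Proof.
have [x0|x0] := leP x 0; first by rewrite step_le0.
have [x3|x3] := leP 3 x; first by rewrite step_ge3.
rewrite /step.
rewrite (_ : pos_part x = x); last by rewrite /pos_part max_l// ltW.
rewrite (_ : pos_part (x - 3) = 0); last by rewrite /pos_part max_r//; lra.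
case: (pos_partP (x - 1)) => -[h1 ->]; case: (pos_partP (x - 2)) => -[h2 ->].
- have := exprn_ge0 3 (ltW x0); rewrite expr0n /=; lra.
- lra.
- rewrite expr0n /=.
  have -> : (x ^+ 3 - 3 * (x - 1) ^+ 3 + 3 * 0 - 0) / 6 =
    ((x - 1) ^+ 2 * (2 - x) * 2 + (x - 1) ^+ 2 + 3 * (x - 1) + 1) / 6 :> R by field.
  have h3 : 0 <= (x - 1) ^+ 2 * (2 - x) * 2.
    by rewrite !mulr_ge0 ?sqr_ge0//; lra.
  have h4 := sqr_ge0 (x - 1).
  lra.
- rewrite expr0n /=.
  have -> : (x ^+ 3 - 3 * (x - 1) ^+ 3 + 3 * (x - 2) ^+ 3 - 0) / 6 =
    1 - (3 - x) ^+ 3 / 6 :> R by field.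
  have : (3 - x) ^+ 3 <= 1 by apply: exprn_ile1; lra.
  lra.
Qed.

Lemma step_sym x : step (3 - x) = 1 - step x.
Proof.
have p3 z : pos_part (- z) ^+ 3 = pos_part z ^+ 3 - z ^+ 3.
  rewrite /pos_part; have [z0|z0] := leP z 0.
    rewrite max_l; last by lra.
    by ring.
  rewrite max_r; last by lra.
  by ring.
rewrite /step.
have -> : 3 - x = - (x - 3) by ring.
have -> : - (x - 3) - 1 = - (x - 2) by ring.
have -> : - (x - 3) - 2 = - (x - 1) by ring.
have -> : - (x - 3) - 3 = - x by ring.
by rewrite !p3; field.
Qed.

Lemma step_le1 x : step x <= 1.
Proof. have := step_ge0 (3 - x); rewrite step_sym; lra. Qed.

Lemma measurable_step : measurable_fun [set: R] step.
Proof.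
have mp c : measurable_fun [set: R] (fun x => pos_part (x - c) ^+ 3).
  apply: measurable_funX.
  apply: (@measurable_maxr _ _ _ _ (fun x : R => x - c) (cst 0)) => //.
  exact: (@measurable_funB _ _ _ _ id (cst c)).
rewrite /step; apply: measurable_funM => //.
apply: measurable_funB; last exact: mp.
apply: measurable_funD; last by apply: measurable_funM => //; exact: mp.
apply: measurable_funB; last by apply: measurable_funM => //; exact: mp.
rewrite (_ : (fun x => _) = (fun x => pos_part (x - 0) ^+ 3)); first exact: mp.
by apply/funext => x; rewrite subr0.
Qed.

End smooth_step.

Section rademacher.
Context (R : realType).
Implicit Types (s x t : R) (f g : R -> R) (n : nat).

Fixpoint rad s n f x : R :=
  if n is k.+1 then (rad s k f (x + s) + rad s k f (x - s)) / 2 else f x.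

Lemma rad_le s n f g x : (forall y, f y <= g y) -> rad s n f x <= rad s n g x.
Proof.
move=> fg; elim: n x => [|n IH] x //=.
by rewrite ler_pM2r ?invr_gt0// lerD.
Qed.

Lemma radB s n f g x :
  rad s n (fun y => f y - g y) x = rad s n f x - rad s n g x.
Proof. by elim: n x => [|n IH] x //=; rewrite !IH; field. Qed.

Lemma rad_cst s n (c : R) x : rad s n (fun=> c) x = c.
Proof. by elim: n x => [|n IH] x //=; rewrite !IH; field. Qed.

Lemma radE s n f x : rad s n f x =
  2 ^- n * \sum_(k < n.+1) 'C(n, k)%:R * f (x + ((k.*2)%:R - n%:R) * s).
Proof.
elim: n x => [|n IH] x.
  by rewrite big_ord_recr big_ord0 /= bin0 expr0 invr1 !mul1r add0r subrr mul0r addr0.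
pose F k := f (x + (k.*2%:R - n.+1%:R) * s).
rewrite /= !IH -mulrDr.
have -> : \sum_(k < n.+1) 'C(n, k)%:R * f (x + s + (k.*2%:R - n%:R) * s) =
    \sum_(k < n.+1) 'C(n, k)%:R * F k.+1.
  apply: eq_bigr => k _; congr (_ * f _).
  rewrite doubleS -[k.*2.+2]addn2 !natrD -(natr1 n); ring.
have -> : \sum_(k < n.+1) 'C(n, k)%:R * f (x - s + (k.*2%:R - n%:R) * s) =
    \sum_(k < n.+1) 'C(n, k)%:R * F k.
  by apply: eq_bigr => k _; congr (_ * f _); rewrite -(natr1 n); ring.
have e : \sum_(k < n.+1) 'C(n, k)%:R * F k =
    F 0%N + \sum_(k < n.+1) 'C(n, k.+1)%:R * F k.+1.
  transitivity (\sum_(k < n.+2) 'C(n, k)%:R * F k).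
    by rewrite [RHS]big_ord_recr /= bin_small// mul0r addr0.
  by rewrite big_ord_recl /= bin0 mul1r.
rewrite e [in RHS]big_ord_recl /= bin0 mul1r -/(F 0%N).
under [in RHS]eq_bigr => k _ do rewrite /bump /= add1n binS natrD mulrDl.
rewrite big_split /= exprS invfM -/(F _) addrCA.
rewrite (_ : \sum_(i < n.+1) 'C(n, i)%:R * f (x + (i.+1.*2%:R - n.+1%:R) * s) =
  \sum_(k < n.+1) 'C(n, k)%:R * F k.+1)//.
rewrite (_ : \sum_(i < n.+1) 'C(n, i.+1)%:R * f (x + (i.+1.*2%:R - n.+1%:R) * s) =
  \sum_(k < n.+1) 'C(n, k.+1)%:R * F k.+1)//.
by rewrite [X in F 0%N + X]addrC; ring.
Qed.

Lemma bin_central_mono m j : ('C(m.*2, m + j) <= 'C(m.*2, m))%N.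
Proof.
elim: j => [|j IH]; first by rewrite addn0.
apply: leq_trans IH.
rewrite addnS.
have := mul_bin_left (m.*2) (m + j).
rewrite (_ : (m.*2 - (m + j) = m - j)%N); last by lia.
move=> h.
rewrite -(leq_pmul2l (_ : 0 < (m + j).+1)%N)// h.
by rewrite leq_mul2r; apply/orP; right; lia.
Qed.

Lemma bin_double_le m k : ('C(m.*2, k) <= 'C(m.*2, m))%N.
Proof.
have [mk|km] := leqP m k.
  by rewrite -(subnKC mk) bin_central_mono.
rewrite -bin_sub; last by lia.
rewrite (_ : (m.*2 - k = m + (m - k))%N); last by lia.
exact: bin_central_mono.
Qed.

Lemma bin_central_bound m : ('C(m.*2, m) ^ 2 * m.*2.+1 <= 16 ^ m)%N.
Proof.
elim: m => [|m IH]; first by [].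
have e1 : (m.+1 * 'C(m.+1.*2, m.+1) = 2 * (m.*2.+1) * 'C(m.*2, m))%N.
  rewrite doubleS.
  have h1 := mul_bin_diag m.*2.+2 m.
  have h2 := mul_bin_down m.*2.+1 m.
  rewrite (_ : (m.*2.+1 - m = m.+1)%N) /= in h2; last by lia.
  rewrite /= in h1.
  nia.
have e2 : (m.+1 ^ 2 * ('C(m.+1.*2, m.+1) ^ 2 * m.+1.*2.+1) =
           4 * m.*2.+1 * m.*2.+3 * ('C(m.*2, m) ^ 2 * m.*2.+1))%N.
  rewrite mulnA -expnMn e1 !expnMn doubleS; nia.
rewrite -(leq_pmul2l (_ : 0 < m.+1 ^ 2)%N) ?expn_gt0// e2.
apply: (@leq_trans (4 * m.*2.+1 * m.*2.+3 * 16 ^ m)%N).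
  by rewrite leq_mul2l IH orbT.
have -> : (16 ^ m.+1 = 16 * 16 ^ m)%N by rewrite expnS.
move: (16 ^ m)%N => q; rewrite -!mul2n; nia.
Qed.

Lemma bin_bound n k : (0 < n)%N ->
  2 ^- n * 'C(n, k)%:R <= (Num.sqrt n%:R)^-1 :> R.
Proof.
move=> n0; pose m := n./2.
have h1 : (n = m.*2 \/ n = m.*2.+1)%N.
  by have := odd_double_half n; rewrite -/m; case: odd; lia.
have h2 : ('C(n, k) * 2 ^ m.*2 <= 'C(m.*2, m) * 2 ^ n)%N.
  case: h1 => ->; first by rewrite leq_mul2r bin_double_le orbT.
  have -> : (2 ^ m.*2.+1 = 2 * 2 ^ m.*2)%N by rewrite expnS.
  have h : ('C(m.*2.+1, k) <= 2 * 'C(m.*2, m))%N.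
    case: k => [|k]; first by rewrite bin0; have := bin_double_le m 0; rewrite bin0; lia.
    rewrite binS; have := bin_double_le m k; have := bin_double_le m k.+1; lia.
  by move: (2 ^ m.*2)%N => q; nia.
have h3 : 'C(m.*2, m)%:R * Num.sqrt n%:R <= 2 ^+ m.*2 :> R.
  rewrite -(ler_pXn2r (_ : 0 < 2)%N)// ?nnegrE ?mulr_ge0 ?sqrtr_ge0 ?exprn_ge0//.
  rewrite exprMn sqr_sqrtr// -!natrX -natrM ler_nat.
  rewrite -expnM (_ : (m.*2 * 2 = 4 * m)%N); last by lia.
  rewrite expnM (_ : 2 ^ 4 = 16)%N//.
  apply: leq_trans (bin_central_bound m).
  by rewrite leq_mul2l; apply/orP; right; case: h1 => ->; lia.
have sn0 : 0 < Num.sqrt n%:R :> R by rewrite sqrtr_gt0 ltr0n.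
rewrite ler_pdivrMl ?exprn_gt0// ler_pdivlMr//.
rewrite -(ler_pM2l (_ : 0 < 2 ^+ m.*2 :> R)) ?exprn_gt0//.
have h4 : 'C(n, k)%:R * 2 ^+ m.*2 <= 'C(m.*2, m)%:R * 2 ^+ n :> R.
  by rewrite -!natrX -!natrM ler_nat.
rewrite mulrA [2 ^+ _ * _]mulrC.
apply: (le_trans (ler_wpM2r (ltW sn0) h4)).
rewrite mulrAC; exact: ler_wpM2r.
Qed.

Definition rad_cdf s n t : R := rad s n (fun x => (x <= t)%R%:R) 0.

Lemma rad_cdf_mono s n t t' : t <= t' -> rad_cdf s n t <= rad_cdf s n t'.
Proof.
move=> tt'; apply: rad_le => y.
by case: (leP y t) => h //=; rewrite ?(le_trans h tt')//; case: (y <= t')%R.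
Qed.

Lemma rad_cdf_window s n t : 0 < s -> (0 < n)%N ->
  rad_cdf s n (t + 2 * s) - rad_cdf s n t <= (Num.sqrt n%:R)^-1.
Proof.
move=> s0 n0; rewrite /rad_cdf -radB radE.
pose u (k : nat) : R := 0 + (k.*2%:R - n%:R) * s.
have ui (i j : nat) : (i < j)%N -> u i + 2 * s <= u j.
  move=> ij; rewrite /u !add0r -mul2n -(mul2n j) !natrM.
  have : i%:R + 1 <= j%:R :> R by rewrite natr1 ler_nat.
  nra.
pose g (k : nat) : R := (u k <= t + 2 * s)%R%:R - (u k <= t)%R%:R.
have g01 k : g k = 0 \/ [/\ g k = 1, t < u k & u k <= t + 2 * s].
  rewrite /g; have [h1|h1] := leP (u k) t.
    by left; rewrite (le_trans h1) ?subrr//; lra.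
  by case: leP => h2; [right; rewrite subr0|left; rewrite subrr].
rewrite (eq_bigr (fun k : 'I_n.+1 => 'C(n, k)%:R * g k))//.
have [[k gk]|ng] := pselect (exists k : 'I_n.+1, g k != 0).
  rewrite (bigD1 k)//= big1 ?addr0; last first.
    move=> i ik; case: (g01 i) => [->|[_ ti it]]; first by rewrite mulr0.
    exfalso; case: (g01 k) => [gk0|[_ tk kt]]; first by rewrite gk0 eqxx in gk.
    have /orP[h|h] : (i < k)%N || (k < i)%N by rewrite -neq_ltn.
      by have := ui _ _ h; lra.
    by have := ui _ _ h; lra.
  case: (g01 k) gk => [->|[-> _ _] _]; first by rewrite eqxx.
  by rewrite mulr1; exact: bin_bound.
rewrite big1 ?mulr0 ?invr_ge0 ?sqrtr_ge0// => i _.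
by case: (eqVneq (g i) 0) => [->|h]; [rewrite mulr0|case: ng; exists i].
Qed.

(* No atom of the symmetric binomial law exceeds 1 / sqrt n. *)
Lemma rad_cdf_modulus s n t u : 0 < s -> (0 < n)%N -> 0 <= u ->
  rad_cdf s n (t + u) - rad_cdf s n t <= (u / (2 * s) + 1) / Num.sqrt n%:R.
Proof.
move=> s0 n0 u0.
have H (j : nat) : rad_cdf s n (t + 2 * s * j%:R) - rad_cdf s n t <= j%:R / Num.sqrt n%:R.
  elim: j => [|j IH]; first by rewrite mulr0 addr0 subrr mul0r.
  have := rad_cdf_window (t + 2 * s * j%:R) s0 n0.
  rewrite -addrA -{2}(mulr1 (2 * s)) -mulrDr natr1 => h.
  have -> : j.+1%:R / Num.sqrt n%:R = (Num.sqrt n%:R)^-1 + j%:R / Num.sqrt n%:R :> R.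
    by rewrite -(natr1 j) mulrDl mul1r addrC.
  by apply: le_trans (lerD h IH); rewrite subrKA.
have v0 : 0 <= u / (2 * s) by apply: divr_ge0; lra.
pose j := (Num.trunc (u / (2 * s))).+1.
have j1 : u <= 2 * s * j%:R.
  rewrite mulrC -ler_pdivrMr; last by lra.
  by apply/ltW; rewrite /j; have /andP[] := truncn_itv v0.
have j2 : j%:R <= u / (2 * s) + 1.
  by rewrite /j -natr1 lerD2r; have /andP[] := truncn_itv v0.
apply: (@le_trans _ _ (rad_cdf s n (t + 2 * s * j%:R) - rad_cdf s n t)).
  by rewrite lerD2r; apply: rad_cdf_mono; rewrite lerD2l.
by apply: (le_trans (H j)); rewrite ler_wpM2r ?invr_ge0 ?sqrtr_ge0.
Qed.

Lemma rad_cdf_hi s n t : 0 <= s -> s * n%:R <= t -> rad_cdf s n t = 1.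
Proof.
move=> s0; rewrite /rad_cdf -{1}[t]subr0.
have : 0 <= 0 :> R by []. move: {1 3 4}0 => x _.
elim: n x => [|n IH] x /=; first by rewrite mulr0 subr_ge0 => ->.
rewrite -natr1 mulrDr mulr1 => h.
by rewrite !IH; [field|lra|lra].
Qed.

Lemma rad_cdf_lo s n t : 0 <= s -> t < - (s * n%:R) -> rad_cdf s n t = 0.
Proof.
move=> s0; rewrite /rad_cdf -{1}[t]subr0.
have : 0 <= 0 :> R by []. move: {1 3 4}0 => x _.
elim: n x => [|n IH] x /=; first by rewrite mulr0 oppr0 subr_lt0 leNgt => ->.
rewrite -natr1 mulrDr mulr1 => h.
by rewrite !IH; [field|lra|lra].
Qed.

End rademacher.

(** * Square-integrable functions and finite IID families *)

Section L2.
Context d (T : measurableType d) (R : realType).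
Implicit Types (mu : {measure set T -> \bar R}) (f g : T -> R).
Local Notation mI mu f := (mu.-integrable [set: T] (EFin \o f)).

Definition sqint mu f := measurable_fun [set: T] f /\ mI mu (fun x => f x ^+ 2).

Lemma integrableR_le mu f g : measurable_fun [set: T] f ->
  (forall x, `|f x| <= g x) -> mI mu g -> mI mu f.
Proof.
move=> mf fg ig; apply: (le_integrable _ _ _ ig) => //.
  exact/measurable_EFinP.
move=> x _ /=; rewrite lee_fin; apply: (le_trans (fg x)).
exact: ler_norm.
Qed.

Lemma integrableRD mu f g : mI mu f -> mI mu g -> mI mu (fun x => f x + g x).
Proof. by move=> hf hg; exact: (integrableD measurableT hf hg). Qed.

Lemma integrableRB mu f g : mI mu f -> mI mu g -> mI mu (fun x => f x - g x).
Proof. by move=> hf hg; exact: (integrableB measurableT hf hg). Qed.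

Lemma integrableRZ mu (c : R) f : mI mu f -> mI mu (fun x => c * f x).
Proof. by move=> hf; exact: (integrableZl measurableT c hf). Qed.

Lemma integrableR0 mu : mI mu (fun=> 0).
Proof. exact: integrable0. Qed.

Lemma integrableR_sum mu (I : Type) (s : seq I) (p : pred I) (F : I -> T -> R) :
  (forall i, p i -> mI mu (F i)) -> mI mu (fun x => \sum_(i <- s | p i) F i x).
Proof.
move=> h; elim: s => [|i s IH].
  rewrite (_ : (fun x => _) = fun=> 0); first exact: integrableR0.
  by apply/funext => x; rewrite big_nil.
rewrite (_ : (fun x => _) =
  fun x => (if p i then F i x else 0) + \sum_(j <- s | p j) F j x); last first.
  by apply/funext => x; rewrite big_cons; case: (p i); rewrite ?add0r.
apply: integrableRD => //; case: (boolP (p i)) => pi; first exact: h.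
exact: integrableR0.
Qed.

Lemma Rintegral_sumr mu (I : Type) (s : seq I) (p : pred I) (F : I -> T -> R) :
  (forall i, p i -> mI mu (F i)) ->
  \int[mu]_x (\sum_(i <- s | p i) F i x) = \sum_(i <- s | p i) \int[mu]_x F i x.
Proof.
move=> h; elim: s => [|i s IH].
  rewrite big_nil; under eq_Rintegral do rewrite big_nil.
  by rewrite /Rintegral integral0.
rewrite big_cons; case: ifPn => pi.
  under eq_Rintegral do rewrite big_cons pi.
  by rewrite RintegralD ?IH//; [exact: h|exact: integrableR_sum].
by under eq_Rintegral do rewrite big_cons (negbTE pi).
Qed.

Lemma sqint_mul mu f g : sqint mu f -> sqint mu g -> mI mu (fun x => f x * g x).
Proof.
move=> [mf hf] [mg hg]; apply: integrableR_le (integrableRD hf hg).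
  exact: measurable_funM.
move=> x; rewrite ler_norml.
have := sqr_ge0 (f x + g x); have := sqr_ge0 (f x - g x).
have := sqr_ge0 (f x); have := sqr_ge0 (g x).
rewrite !expr2 => h1 h2 h3 h4; apply/andP; split; nra.
Qed.

Lemma sqintD mu f g : sqint mu f -> sqint mu g -> sqint mu (fun x => f x + g x).
Proof.
move=> [mf hf] [mg hg]; split; first exact: measurable_funD.
apply: (integrableR_le _ _ (integrableRZ 2 (integrableRD hf hg))).
  by apply: measurable_funX; exact: measurable_funD.
move=> x; rewrite ger0_norm ?sqr_ge0//.
have := sqr_ge0 (f x - g x); rewrite !expr2; nra.
Qed.

Lemma sqintZ mu (c : R) f : sqint mu f -> sqint mu (fun x => c * f x).
Proof.
move=> [mf hf]; split; first exact: measurable_funM.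
rewrite (_ : (fun x => _) = (fun x => c ^+ 2 * f x ^+ 2)); first exact: integrableRZ.
by apply/funext => x; rewrite exprMn.
Qed.

Lemma sqintB mu f g : sqint mu f -> sqint mu g -> sqint mu (fun x => f x - g x).
Proof.
move=> hf hg; rewrite (_ : (fun x => _) = fun x => f x + (-1) * g x).
  by apply: sqintD => //; exact: sqintZ.
by apply/funext => x; rewrite mulN1r.
Qed.

Lemma sqint_sum mu (I : Type) (s : seq I) (p : pred I) (F : I -> T -> R) :
  (forall i, p i -> sqint mu (F i)) -> sqint mu (fun x => \sum_(i <- s | p i) F i x).
Proof.
move=> h; elim: s => [|i s IH].
  rewrite (_ : (fun x => _) = fun=> 0); last by apply/funext => x; rewrite big_nil.
  split; first exact: measurable_cst.
  by rewrite expr0n; exact: integrableR0.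
rewrite (_ : (fun x => _) =
  fun x => (if p i then F i x else 0) + \sum_(j <- s | p j) F j x); last first.
  by apply/funext => x; rewrite big_cons; case: (p i); rewrite ?add0r.
apply: sqintD => //; case: (boolP (p i)) => pi; first exact: h.
split; first exact: measurable_cst.
by rewrite expr0n; exact: integrableR0.
Qed.

Lemma Rintegral_sqD mu f g : sqint mu f -> sqint mu g ->
  \int[mu]_x ((f x + g x) ^+ 2) <=
  2 * (\int[mu]_x (f x ^+ 2)) + 2 * (\int[mu]_x (g x ^+ 2)).
Proof.
move=> hf hg; have [_ hfg] := sqintD hf hg.
case: hf => mf hf; case: hg => mg hg.
rewrite -!RintegralZl// -RintegralD//; [|exact: integrableRZ|exact: integrableRZ].
apply: le_Rintegral => //.
  by apply: integrableRD; exact: integrableRZ.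
by move=> x _; have := sqr_ge0 (f x - g x); rewrite !expr2; nra.
Qed.

Lemma Rintegral_sq_ge0 mu f : 0 <= \int[mu]_x (f x ^+ 2).
Proof. by apply: Rintegral_ge0 => x _; exact: sqr_ge0. Qed.

Lemma Rintegral_sum_sq mu (I : finType) (F : I -> T -> R) :
  (forall i, sqint mu (F i)) ->
  \int[mu]_x ((\sum_i F i x) ^+ 2) = \sum_i \sum_j \int[mu]_x (F i x * F j x).
Proof.
move=> h.
transitivity (\int[mu]_x \sum_i \sum_j F i x * F j x).
  apply: eq_Rintegral => x _.
  by rewrite expr2 big_distrl /=; apply: eq_bigr => i _; rewrite big_distrr.
rewrite Rintegral_sumr; last first.
  by move=> i _; apply: integrableR_sum => j _; exact: sqint_mul.
apply: eq_bigr => i _; rewrite Rintegral_sumr// => j _; exact: sqint_mul.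
Qed.

Lemma Rintegral_sum_sq_le mu (I : finType) (F : I -> T -> R) :
  (forall i, sqint mu (F i)) ->
  \int[mu]_x ((\sum_i F i x) ^+ 2) <= #|I|%:R * \sum_i \int[mu]_x (F i x ^+ 2).
Proof.
move=> h; rewrite Rintegral_sum_sq//.
have b i j : \int[mu]_x (F i x * F j x) <=
   (\int[mu]_x (F i x ^+ 2) + \int[mu]_x (F j x ^+ 2)) / 2.
  have [_ hi] := h i; have [_ hj] := h j.
  rewrite mulrC -RintegralD// -RintegralZl//; last exact: integrableRD.
  apply: le_Rintegral => //; [exact: sqint_mul|exact/integrableRZ/integrableRD|].
  by move=> x _; have := sqr_ge0 (F i x - F j x); rewrite !expr2; nra.
apply: le_trans (ler_sum _ (fun i _ => ler_sum _ (fun j _ => b i j))) _.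
under eq_bigr => i _ do rewrite -mulr_suml big_split /= sumr_const.
rewrite -mulr_suml big_split /= sumr_const sumrMnl.
rewrite -mulr_natl; lra.
Qed.

Lemma cauchy_schwarz_R mu f g : sqint mu f -> sqint mu g ->
  (\int[mu]_x (f x * g x)) ^+ 2 <=
  (\int[mu]_x (f x ^+ 2)) * (\int[mu]_x (g x ^+ 2)).
Proof.
move=> hf hg.
set A := \int[mu]_x (f x ^+ 2); set B := \int[mu]_x (g x ^+ 2); set C := Rintegral _ _ _.
have A0 : 0 <= A by exact: Rintegral_sq_ge0.
have B0 : 0 <= B by exact: Rintegral_sq_ge0.
have q (a b : R) : 0 <= a ^+ 2 * A + 2 * a * b * C + b ^+ 2 * B.
  have <- : \int[mu]_x ((a * f x + b * g x) ^+ 2) = a ^+ 2 * A + 2 * a * b * C + b ^+ 2 * B.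
    rewrite /A /B /C -!RintegralZl//; [|exact: hg.2|exact: sqint_mul|exact: hf.2].
    rewrite -!RintegralD//.
    - by apply: eq_Rintegral => x _; ring.
    - by apply: integrableRD; apply: integrableRZ; [exact: hf.2|exact: sqint_mul].
    - by apply: integrableRZ; exact: hg.2.
    - by apply: integrableRZ; exact: hf.2.
    - by apply: integrableRZ; exact: sqint_mul.
  exact: Rintegral_sq_ge0.
have [A00|An0] := eqVneq A 0.
  have [->|C0] := eqVneq C 0; first by rewrite expr0n /= mulr_ge0.
  have := q (- (B + 1) / C) 1; rewrite A00 mulr0 add0r.
  have -> : 2 * (- (B + 1) / C) * 1 * C + 1 ^+ 2 * B = - B - 2 by field.
  lra.
have Ap : 0 < A by rewrite lt0r An0 A0.
have := q (- C / A) 1.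
have -> : (- C / A) ^+ 2 * A + 2 * (- C / A) * 1 * C + 1 ^+ 2 * B = B - C ^+ 2 / A by field.
by rewrite subr_ge0 ler_pdivrMr// mulrC.
Qed.

End L2.

Section L2_probability.
Context d (T : measurableType d) (R : realType) (P : probability T R).
Implicit Types (f g : T -> R).
Local Notation mI f := (P.-integrable [set: T] (EFin \o f)).

Lemma integrableR_cst (c : R) : mI (fun=> c).
Proof. exact: finite_measure_integrable_cst. Qed.

Lemma Rintegral_cstP (c : R) : \int[P]_x c = c.
Proof. by rewrite /Rintegral integral_cst// [X in (_ * X)%E](_ : _ = 1%E) ?mule1//; exact: probability_setT. Qed.

Lemma integrableR_bounded f (M : R) : measurable_fun [set: T] f ->
  (forall x, `|f x| <= M) -> mI f.
Proof. by move=> mf fM; exact: (integrableR_le mf fM (integrableR_cst M)). Qed.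

Lemma sqint_bounded f (M : R) : measurable_fun [set: T] f ->
  (forall x, `|f x| <= M) -> sqint P f.
Proof.
move=> mf fM; split => //; apply: (@integrableR_bounded _ (M ^+ 2)).
  exact: measurable_funX.
by move=> x; rewrite normrX lerXn2r// nnegrE// (le_trans _ (fM x)).
Qed.

Lemma sqint_cst (c : R) : sqint P (fun=> c).
Proof. exact: (@sqint_bounded _ `|c|). Qed.

Lemma sqint_integrable f : sqint P f -> mI f.
Proof.
move=> hf; have := sqint_mul (sqint_cst 1) hf.
by rewrite (_ : (fun x => _) = f)//; apply/funext => x; rewrite mul1r.
Qed.

Lemma Rintegral_sq_mean f : sqint P f -> (\int[P]_x f x) ^+ 2 <= \int[P]_x (f x ^+ 2).
Proof.
move=> hf; have := cauchy_schwarz_R (sqint_cst 1) hf.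
by under eq_Rintegral do rewrite mul1r; rewrite Rintegral_cstP expr1n mul1r.
Qed.

Lemma Rintegral_var f : sqint P f ->
  \int[P]_x ((f x - \int[P]_y f y) ^+ 2) = \int[P]_x (f x ^+ 2) - (\int[P]_x f x) ^+ 2.
Proof.
move=> hf; set m := \int[P]_y f y; have iff := sqint_integrable hf.
transitivity (\int[P]_x (f x ^+ 2 - (2 * m * f x - m ^+ 2))).
  by apply: eq_Rintegral => x _; ring.
rewrite RintegralB//; [|exact: hf.2|by apply: integrableRB; [exact: integrableRZ|exact: integrableR_cst]].
rewrite RintegralB//; [|exact: integrableRZ|exact: integrableR_cst].
by rewrite RintegralZl// Rintegral_cstP -/m; ring.
Qed.

Lemma markov_R f (c : R) : 0 < c -> (forall x, 0 <= f x) -> mI f ->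
  (P [set x | (c <= f x)%R] <= ((\int[P]_x f x) / c)%:E)%E.
Proof.
move=> c0 f0 hf.
have mf : measurable_fun [set: T] f by apply/measurable_EFinP; exact: measurable_int hf.
have mA : measurable [set x | c <= f x].
  rewrite -[X in measurable X]setTI; exact: (measurable_fun_ler (measurable_cst c) mf).
rewrite EFinM -[leLHS]mule1 (_ : 1%E = (c / c)%:E :> \bar R); last by rewrite divff ?gt_eqF.
rewrite EFinM muleA; apply: lee_wpmul2r; first by rewrite lee_fin invr_ge0 ltW.
rewrite /Rintegral fineK; last exact: integrable_fin_num.
rewrite muleC -integral_cst//= [leLHS]integral_mkcond.
apply: ge0_le_integral => //.
- by move=> x _; rewrite patchE; case: ifP => //; rewrite lee_fin ltW.
- by apply/(measurable_restrict _ mA measurableT); exact: measurable_cst.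
- exact/measurable_EFinP.
- move=> x _; rewrite patchE; case: ifPn => [|_]; last by rewrite lee_fin.
  by rewrite inE /= lee_fin.
Qed.

End L2_probability.

Section iid_family.
Context (d1 d2 : measure_display) (Omega : measurableType d1)
  (T : measurableType d2) (R : realType).
Variables (P : probability Omega R) (Q : probability T R).

Definition iid_fin n (X : 'I_n -> Omega -> T) : Prop :=
  (forall i, measurable_fun [set: Omega] (X i)) /\
  (forall A : 'I_n -> set T, (forall i, measurable (A i)) ->
    P (\bigcap_i (X i @^-1` A i)) = (\prod_i Q (A i))%E).

Variables (n : nat) (X : 'I_n -> Omega -> T) (Xiid : iid_fin X).

Let mX i A : measurable A -> measurable (X i @^-1` A).
Proof. by move=> mA; rewrite -[X in measurable X]setTI; exact: Xiid.1. Qed.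

Definition cyl (l : 'I_n) : set (set Omega) :=
  [set E | exists A : 'I_n -> set T,
     [/\ forall i, measurable (A i), A l = setT & E = \bigcap_i (X i @^-1` A i)]].

(* The sigma-algebra generated by the X i with i != l. *)
Local Notation rest l := (g_sigma_algebraType (cyl l)).

Lemma cyl_measurable l : cyl l `<=` measurable.
Proof.
move=> _ [A [mA _ ->]]; apply: fin_bigcap_measurable => // i _; exact: mX.
Qed.

Lemma rest_measurable l : <<s cyl l >> `<=` measurable.
Proof. by apply: smallest_sub; [exact: sigma_algebra_measurable|exact: cyl_measurable]. Qed.

Lemma cyl_setI l : setI_closed (cyl l).
Proof.
move=> _ _ [A [mA Al ->]] [B [mB Bl ->]]; exists (fun i => A i `&` B i); split.
- by move=> i; exact: measurableI.
- by rewrite Al Bl setTI.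
- by rewrite -bigcapI; apply: eq_bigcapr => i _; rewrite preimage_setI.
Qed.

Lemma cylT l : cyl l setT.
Proof. by exists (fun=> setT); split => //; rewrite bigcapT. Qed.

Lemma iid_law i A : measurable A -> P (X i @^-1` A) = Q A.
Proof.
move=> mA; have := Xiid.2 (fun j => if j == i then A else setT).
rewrite (bigD1 i)//= eqxx big1 ?mule1; last first.
  by move=> j /negbTE ->; rewrite probability_setT.
move=> <-; last by move=> j; case: ifP.
congr (P _); apply/seteqP; split=> [x Ax j _|x /(_ i I)] /=; last by rewrite eqxx.
by case: eqP => [->|].
Qed.

Lemma rest_indep l A B : <<s cyl l >> A -> measurable B ->
  P (A `&` (X l @^-1` B)) = (P A * Q B)%E.
Proof.
move=> gA mB; have mXB := mX l mB.
have QB0 : (0 <= fine (Q B))%R by rewrite fine_ge0.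
transitivity (mrestr P mXB A) => //.
transitivity (mscale (NngNum QB0) P A); last first.
  by rewrite /mscale /= fineK ?fin_num_measure// muleC.
apply: (g_sigma_algebra_measure_unique (cyl l) _ (fun=> setT)) => //.
- exact: cyl_measurable.
- by move=> _; exact: cylT.
- by apply/seteqP; split => // x _; exists 0%N.
- exact: cyl_setI.
- move=> _ [C [mC Cl ->]].
  change (P (\bigcap_i (X i @^-1` C i) `&` X l @^-1` B) =
    ((fine (Q B))%:E * P (\bigcap_i (X i @^-1` C i)))%E).
  rewrite fineK ?fin_num_measure// muleC.
  rewrite (Xiid.2 C)// (bigD1 l)//= Cl probability_setT mul1e.
  rewrite muleC.
  have := Xiid.2 (fun j => if j == l then B else C j).
  rewrite (bigD1 l)//= eqxx.
  rewrite (eq_bigr (fun i => Q (C i))); last by move=> i /negbTE ->.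
  move=> <-; last by move=> j; case: ifP.
  congr (P _); apply/seteqP; split => [x [h xB] j _ /=|x h].
    by case: eqP => [->//|_]; exact: h.
  split; last by have := h l I; rewrite /= eqxx.
  move=> j _ /=; have := h j I; rewrite /=; case: eqP => // -> _.
  by rewrite Cl.
- by move=> _; apply: le_lt_trans (ltry 1); apply: probability_le1; exact: measurableI.
Qed.

Lemma measurable_rest l i : i != l -> measurable_fun [set: rest l] (X i : rest l -> T).
Proof.
move=> il _ A mA; rewrite setTI; apply: sub_sigma_algebra.
exists (fun j => if j == i then A else setT); split.
- by move=> j; case: ifP.
- by rewrite eq_sym (negbTE il).
- apply/seteqP; split=> [x Ax j _ /=|x /(_ i I) /=]; last by rewrite eqxx.
  by case: eqP => [->|].
Qed.

Lemma measurable_rest_fst l i : i != l ->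
  measurable_fun [set: rest l * T] (fun z : rest l * T => X i z.1).
Proof.
move=> il _ A mA; rewrite setTI.
have := measurable_rest il measurableT mA; rewrite setTI => h.
by have := @measurable_fst _ _ (rest l) T measurableT _ h; rewrite setTI.
Qed.

Definition to_rest l : Omega -> rest l := id.

Lemma measurable_to_rest l : measurable_fun [set: Omega] (to_rest l).
Proof. by move=> _ A mA; rewrite setTI; exact: (@rest_measurable l A mA). Qed.

Lemma iid_tonelli l (f : rest l * T -> \bar R) : measurable_fun setT f ->
  (forall z, 0 <= f z)%E ->
  (\int[P]_w f (w, X l w) = \int[P]_w \int[Q]_y f (w, y))%E.
Proof.
move=> mf f0.
pose Id : {mfun Omega >-> rest l} := HB.pack (to_rest l)
  (isMeasurableFun.Build _ _ _ _ _ (@measurable_to_rest l)).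
have mpair : measurable_fun setT (fun w : Omega => (to_rest l w, X l w)).
  by apply: measurable_fun_pair; [exact: measurable_to_rest|exact: Xiid.1].
pose Pr : {mfun Omega >-> (rest l * T)%type} := HB.pack
  (fun w : Omega => (to_rest l w, X l w)) (isMeasurableFun.Build _ _ _ _ _ mpair).
transitivity (\int[distribution P Pr]_z f z)%E.
  by rewrite ge0_integral_distribution.
transitivity (\int[distribution P Id \x Q]_z f z)%E.
  apply: eq_measure_integral => A mA _; apply/esym.
  refine (@product_measure_unique _ _ _ _ _ (distribution P Id) Q (distribution P Pr) _ A mA).
  by move=> B C mB mC; exact: (rest_indep mB mC).
rewrite fubini_tonelli1//.
rewrite (@ge0_integral_distribution _ _ _ _ _ _ Id (fubini_F Q f))//.
- exact: measurable_fun_fubini_tonelli_F.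
- by move=> y; apply: integral_ge0 => z _; exact: f0.
Qed.

End iid_family.

(** * Hoeffding decomposition of V-statistics *)

(* No integrability is required, because Rintegral sends infinite integrals to 0. *)
Lemma measurable_Rintegral_param (d1 d2 : measure_display) (T1 : measurableType d1)
  (T2 : measurableType d2) (R : realType) (mu : {sigma_finite_measure set T2 -> \bar R})
  (F : T1 * T2 -> R) : measurable_fun setT F ->
  measurable_fun [set: T1] (fun x => \int[mu]_y F (x, y)).
Proof.
move=> mF.
have mEF : measurable_fun setT (EFin \o F) by exact/measurable_EFinP.
rewrite (_ : (fun x => _) =
  fine \o (fun x => fubini_F mu (EFin \o F)^\+ x - fubini_F mu (EFin \o F)^\- x)%E).
  apply: measurableT_comp => //; apply: emeasurable_funB;
    apply: measurable_fun_fubini_tonelli_F.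
  - exact: measurable_funepos.
  - by move=> z; exact: funepos_ge0.
  - exact: measurable_funeneg.
  - by move=> z; exact: funeneg_ge0.
apply/funext => x; rewrite /Rintegral /= integralE /fubini_F; congr (fine (_ - _)%E).
  apply: eq_integral => y _.
  exact: (congr1 (fun h => h y) (funepos_comp (EFin \o F) (fun y => (x, y)))).
apply: eq_integral => y _.
exact: (congr1 (fun h => h y) (funeneg_comp (EFin \o F) (fun y => (x, y)))).
Qed.

Lemma le_double_sum (R : realFieldType) (a b1 b2 v : R) :
  a <= 2 * b1 + 2 * b2 -> b1 <= v -> b2 <= v -> a <= 4 * v.
Proof. lra. Qed.

Lemma norm_le_of_sq (R : realFieldType) (x b : R) : x ^+ 2 <= b -> `|x| <= 1 + b.
Proof.
rewrite expr2 => h; have x0 := sqr_ge0 x; rewrite expr2 in x0.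
by rewrite ler_norml; apply/andP; split; nra.
Qed.

Section iid_moments.
Context (d1 d2 : measure_display) (Omega : measurableType d1)
  (T : measurableType d2) (R : realType).
Variables (P : probability Omega R) (Q : probability T R).
Variables (n : nat) (X : 'I_n -> Omega -> T) (Xiid : iid_fin P Q X).
Local Notation rest l := (g_sigma_algebraType (cyl X l)).

Lemma iid_ge0_integral i (f : T -> \bar R) : measurable_fun [set: T] f ->
  (forall x, 0 <= f x)%E -> (\int[P]_w f (X i w) = \int[Q]_x f x)%E.
Proof.
move=> mf f0.
have mf2 : measurable_fun [set: rest i * T] (fun z : rest i * T => f z.2).
  by apply: measurableT_comp => //; exact: measurable_snd.
have -> : (\int[P]_w f (X i w) = \int[P]_w \int[Q]_y f y)%E.
  exact: (iid_tonelli Xiid mf2 (fun z => f0 z.2)).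
rewrite integral_cst//= [X in (_ * X)%E](_ : _ = 1%E) ?mule1//.
exact: probability_setT.
Qed.

Lemma iid_integrable i (f : T -> R) : Q.-integrable [set: T] (EFin \o f) ->
  P.-integrable [set: Omega] (EFin \o (fun w => f (X i w))).
Proof.
move=> /integrableP[mf fi]; apply/integrableP; split.
  by apply: (measurableT_comp mf); exact: Xiid.1.
rewrite (_ : (\int[P]_x _ = \int[Q]_x `|(EFin \o f) x|)%E)//.
apply: (@iid_ge0_integral i (fun x => `|(EFin \o f) x|)%E) => //.
exact: measurableT_comp.
Qed.

Lemma iid_Rintegral i (f : T -> R) : Q.-integrable [set: T] (EFin \o f) ->
  \int[P]_w f (X i w) = \int[Q]_x f x.
Proof.
move=> fi; have mf := measurable_int _ fi.
pose Xi : {mfun Omega >-> T} := HB.pack (X i)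
  (isMeasurableFun.Build _ _ _ _ _ (Xiid.1 i)).
rewrite /Rintegral; congr fine.
rewrite -[LHS](@integral_distribution _ _ _ _ _ P Xi (EFin \o f))//; last first.
  exact: (iid_integrable i fi).
apply: eq_measure_integral => A mA _; exact: (iid_law Xiid).
Qed.

Lemma iid_sqint i (f : T -> R) : sqint Q f -> sqint P (fun w => f (X i w)).
Proof.
move=> [mf fi]; split; last exact: (iid_integrable i fi).
exact: (measurableT_comp mf (Xiid.1 i)).
Qed.

Lemma iid_centered l (F : rest l * T -> R) : measurable_fun setT F ->
  P.-integrable [set: Omega] (EFin \o (fun w => F (w, X l w))) ->
  (forall w, Q.-integrable [set: T] (EFin \o (fun y => F (w, y)))) ->
  (forall w, \int[Q]_y F (w, y) = 0) ->
  \int[P]_w F (w, X l w) = 0.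
Proof.
move=> mF iF iFw F0.
have mEF : measurable_fun setT (EFin \o F) by exact/measurable_EFinP.
have Hp := @iid_tonelli _ _ _ _ _ P Q n X Xiid l (EFin \o F)^\+%E
  (measurable_funepos mEF) (fun z => funepos_ge0 _ z).
have Hn := @iid_tonelli _ _ _ _ _ P Q n X Xiid l (EFin \o F)^\-%E
  (measurable_funeneg mEF) (fun z => funeneg_ge0 _ z).
rewrite /Rintegral integralE.
rewrite [X in (X - _)%E](_ : _ = \int[P]_w \int[Q]_y (EFin \o F)^\+ (w, y))%E; last first.
  rewrite -Hp; apply: eq_integral => w _.
  exact: (congr1 (fun h => h w)
    (funepos_comp (EFin \o F) (fun w => (to_rest X l w, X l w)))).
rewrite [X in (_ - X)%E](_ : _ = \int[P]_w \int[Q]_y (EFin \o F)^\- (w, y))%E; last first.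
  rewrite -Hn; apply: eq_integral => w _.
  exact: (congr1 (fun h => h w)
    (funeneg_comp (EFin \o F) (fun w => (to_rest X l w, X l w)))).
have E w : (\int[Q]_y (EFin \o F)^\+ (w, y) = \int[Q]_y (EFin \o F)^\- (w, y))%E.
  have h0 : (\int[Q]_y (F (w, y))%:E = 0)%E.
    rewrite -(fineK (integrable_fin_num _ (iFw w)))//; congr (_%:E); exact: F0.
  have hp := integrable_pos_fin_num measurableT (iFw w).
  have hn := integrable_neg_fin_num measurableT (iFw w).
  rewrite integralE in h0.
  transitivity (\int[Q]_y (EFin \o (fun y => F (w, y)))^\+ y)%E.
    apply: eq_integral => y _; apply/esym.
    exact: (congr1 (fun h => h y) (funepos_comp (EFin \o F) (fun y => (w, y)))).
  transitivity (\int[Q]_y (EFin \o (fun y => F (w, y)))^\- y)%E; last first.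
    apply: eq_integral => y _.
    exact: (congr1 (fun h => h y) (funeneg_comp (EFin \o F) (fun y => (w, y)))).
  by rewrite -[LHS](subeK _ hn) [X in (X + _)%E]h0 add0e.
have Ef : (\int[P]_w \int[Q]_y (EFin \o F)^\+ (w, y) = \int[P]_w \int[Q]_y (EFin \o F)^\- (w, y))%E.
  by apply: eq_integral => w _; exact: E.
rewrite -Ef.
have hfin : (\int[P]_w \int[Q]_y (EFin \o F)^\+ (w, y) \is a fin_num)%E.
  rewrite -Hp.
  rewrite (_ : (\int[P]_w _ = \int[P]_w (EFin \o (fun w => F (w, X l w)))^\+ w)%E); last first.
    apply: eq_integral => w _; apply/esym.
    exact: (congr1 (fun h => h w)
      (funepos_comp (EFin \o F) (fun w => (to_rest X l w, X l w)))).
  exact: (integrable_pos_fin_num measurableT iF).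
by rewrite subee.
Qed.

Lemma iid_fubini l (F : rest l * T -> R) (M : R) : measurable_fun setT F ->
  (forall z, 0 <= F z <= M) ->
  [/\ measurable_fun [set: Omega] (fun w : Omega => \int[Q]_y F (w, y)),
      forall w, 0 <= \int[Q]_y F (w, y) <= M &
      \int[P]_w F (w, X l w) = \int[P]_w \int[Q]_y F (w, y)].
Proof.
move=> mF F0M.
have mEF : measurable_fun setT (EFin \o F) by exact/measurable_EFinP.
have mF1 w : measurable_fun [set: T] (fun y => F (w, y)).
  exact: (measurableT_comp mF (measurable_pair1 w)).
have iw w : Q.-integrable [set: T] (EFin \o (fun y => F (w, y))).
  apply: (@integrableR_bounded _ _ _ _ _ M) => // y.
  by have /andP[h1 h2] := F0M (w, y); rewrite ger0_norm.
have b w : 0 <= \int[Q]_y F (w, y) <= M.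
  apply/andP; split; first by apply: Rintegral_ge0 => y _; have /andP[] := F0M (w, y).
  rewrite -[leRHS](Rintegral_cstP Q); apply: le_Rintegral => //.
    exact: integrableR_cst.
  by move=> y _; have /andP[] := F0M (w, y).
have mm : measurable_fun [set: rest l] (fun w : rest l => \int[Q]_y F (w, y)).
  apply: (@measurableT_comp _ _ _ _ _ _ fine _ (fubini_F Q (EFin \o F))) => //.
  apply: measurable_fun_fubini_tonelli_F => // z /=.
  by rewrite lee_fin; have /andP[] := F0M z.
split => //.
  exact: (measurableT_comp mm (measurable_to_rest Xiid (l:=l))).
rewrite /Rintegral; congr fine.
rewrite (@iid_tonelli _ _ _ _ _ P Q n X Xiid l (EFin \o F))//; last first.
  by move=> z /=; rewrite lee_fin; have /andP[] := F0M z.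
apply: eq_integral => w _; rewrite fineK//.
exact: (integrable_fin_num _ (iw w)).
Qed.

End iid_moments.

Section iid_pairs.
Context (d1 d2 : measure_display) (Omega : measurableType d1)
  (T : measurableType d2) (R : realType).
Variables (P : probability Omega R) (Q : probability T R).
Variables (n : nat) (X : 'I_n -> Omega -> T) (Xiid : iid_fin P Q X).

Lemma measurable_pair_fun i j (g : T * T -> R) : measurable_fun setT g ->
  measurable_fun [set: Omega] (fun w => g (X i w, X j w)).
Proof.
move=> mg; apply: measurableT_comp => //.
by apply: measurable_fun_pair; exact: Xiid.1.
Qed.

Lemma iid_pair_integral i j (g : T * T -> R) : i != j -> measurable_fun setT g ->
  (forall z, 0 <= g z) ->
  (\int[P]_w (g (X i w, X j w))%:E = \int[Q]_x \int[Q]_y (g (x, y))%:E)%E.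
Proof.
move=> ij mg g0.
have mEg : measurable_fun setT (EFin \o g) by exact/measurable_EFinP.
have mf : measurable_fun [set: g_sigma_algebraType (cyl X j) * T]
    (fun z => (g (X i z.1, z.2))%:E).
  apply/measurable_EFinP; apply: measurableT_comp => //.
  apply: measurable_fun_pair; last exact: measurable_snd.
  exact: measurable_rest_fst.
rewrite (iid_tonelli Xiid mf); last by move=> z; rewrite lee_fin.
apply: (iid_ge0_integral Xiid i (f := fun x => \int[Q]_y (g (x, y))%:E)%E).
  have g0' z : (0 <= (EFin \o g) z)%E by rewrite lee_fin.
  rewrite (_ : (fun x => _) = fubini_F Q (EFin \o g))//.
  exact: measurable_fun_fubini_tonelli_F.
by move=> x; apply: integral_ge0 => y _; rewrite lee_fin.
Qed.

End iid_pairs.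

Section hoeffding.
Context (d1 d2 : measure_display) (Omega : measurableType d1)
  (T : measurableType d2) (R : realType).
Variables (P : probability Omega R) (Q : probability T R).
Variables (n : nat) (X : 'I_n -> Omega -> T) (Xiid : iid_fin P Q X).
Variables (L : T -> T -> R) (c B M : R) (e : T -> R).
Hypotheses (mL : measurable_fun setT (fun z : T * T => L z.1 z.2))
  (Lsym : forall x y, L x y = L y x) (Ldiag : forall x, L x x = c)
  (L2 : forall x, sqint Q (L x)) (LB : forall x, \int[Q]_y (L x y ^+ 2) <= B)
  (me : measurable_fun [set: T] e) (eM : forall x, `|e x| <= M).

Definition kproj x := \int[Q]_y L x y.
Definition kmean := \int[Q]_x kproj x.
Definition ksq := \int[Q]_x \int[Q]_y (L x y ^+ 2).
Local Notation r := kproj.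
Local Notation theta := kmean.
Local Notation v := ksq.

Definition kdeg x y := L x y - r x - r y + theta.
Local Notation k := kdeg.

Lemma measurable_kproj : measurable_fun [set: T] r.
Proof. exact: (measurable_Rintegral_param Q mL). Qed.

Let B0 : 0 <= B.
Proof. by apply: le_trans (LB point); exact: Rintegral_sq_ge0. Qed.

Let rsq x : r x ^+ 2 <= \int[Q]_y (L x y ^+ 2).
Proof. exact: Rintegral_sq_mean. Qed.

Let rB x : `|r x| <= 1 + B.
Proof.
by apply: norm_le_of_sq; exact: le_trans (rsq x) (LB x).
Qed.

Lemma kproj_sqint : sqint Q r. Proof. exact: (sqint_bounded Q measurable_kproj rB). Qed.
Let e2 : sqint Q e. Proof. exact: (sqint_bounded Q me eM). Qed.

Let msqL : measurable_fun [set: T] (fun x => \int[Q]_y (L x y ^+ 2)).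
Proof.
apply: (measurable_Rintegral_param Q (F := fun z => L z.1 z.2 ^+ 2)).
exact: measurable_funX.
Qed.

Let isqL : Q.-integrable [set: T] (EFin \o (fun x => \int[Q]_y (L x y ^+ 2))).
Proof.
apply: (integrableR_bounded Q (M := B)) => // x.
by rewrite ger0_norm ?Rintegral_sq_ge0.
Qed.

Lemma kproj_sq_le : \int[Q]_x (r x ^+ 2) <= v.
Proof. by apply: le_Rintegral => //; exact: kproj_sqint.2. Qed.

Lemma kmean_sq_le : theta ^+ 2 <= v.
Proof. by apply: le_trans kproj_sq_le; exact: Rintegral_sq_mean kproj_sqint. Qed.

Lemma pair_sqint i j : i != j ->
  sqint P (fun w => L (X i w) (X j w)) /\
  \int[P]_w (L (X i w) (X j w) ^+ 2) = v.
Proof.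
move=> ij.
have m2 : measurable_fun setT (fun z : T * T => L z.1 z.2 ^+ 2) by exact: measurable_funX.
have h : (\int[P]_w (L (X i w) (X j w) ^+ 2)%:E = \int[Q]_x (\int[Q]_y (L x y ^+ 2))%:E)%E.
  rewrite (iid_pair_integral Xiid ij m2); last by move=> z; exact: sqr_ge0.
  apply: eq_integral => x _; rewrite /Rintegral fineK//.
  exact: (integrable_fin_num _ (L2 x).2).
split; last by rewrite /Rintegral h.
have mLp : measurable_fun [set: Omega] (fun w => L (X i w) (X j w)).
  exact: (measurable_pair_fun Xiid i j mL).
split => //; apply/integrableP; split.
  by apply/measurable_EFinP; exact: measurable_funX.
rewrite (eq_integral (fun w => (L (X i w) (X j w) ^+ 2)%:E)); last first.
  by move=> w _ /=; rewrite ger0_norm ?sqr_ge0.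
by rewrite h ltey_eq (integrable_fin_num _ isqL).
Qed.

Lemma kdeg_sym x y : k x y = k y x.
Proof. by rewrite /kdeg (Lsym x y); ring. Qed.

Lemma measurable_kdeg : measurable_fun setT (fun z : T * T => k z.1 z.2).
Proof.
apply: measurable_funD; last exact: measurable_cst.
apply: measurable_funB; first apply: measurable_funB => //.
  by apply: (measurableT_comp measurable_kproj); exact: measurable_fst.
by apply: (measurableT_comp measurable_kproj); exact: measurable_snd.
Qed.

Lemma measurable_kdeg2 d (S : measurableType d) (f g : S -> T) :
  measurable_fun [set: S] f -> measurable_fun [set: S] g ->
  measurable_fun [set: S] (fun s => k (f s) (g s)).
Proof.
move=> mf mg; apply: (@measurableT_comp _ _ _ _ _ _ (fun z : T * T => k z.1 z.2) _ (fun s => (f s, g s))).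
  exact: measurable_kdeg.
exact: measurable_fun_pair.
Qed.

Lemma kdeg_centered x : Q.-integrable [set: T] (EFin \o k x) /\ \int[Q]_y k x y = 0.
Proof.
have iL := sqint_integrable (L2 x); have ir := sqint_integrable kproj_sqint.
have ic (a : R) := integrableR_cst Q a.
split; first by apply: integrableRD => //; apply: integrableRB => //; exact: integrableRB.
rewrite RintegralD//; last by apply: integrableRB => //; exact: integrableRB.
rewrite RintegralB//; last exact: integrableRB.
by rewrite RintegralB// !Rintegral_cstP -/(r x) -/theta; ring.
Qed.

Lemma kdeg_pair i j : i != j ->
  sqint P (fun w => k (X i w) (X j w)) /\
  \int[P]_w (k (X i w) (X j w) ^+ 2) <= 16 * v.
Proof.
move=> ij; have [h1 h2] := pair_sqint ij.
have hi := iid_sqint Xiid i kproj_sqint; have hj := iid_sqint Xiid j kproj_sqint.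
have ht := sqint_cst P theta.
have hA := sqintB h1 hi; have hB := sqintB ht hj.
have E : (fun w => k (X i w) (X j w)) =
  (fun w => (L (X i w) (X j w) - r (X i w)) + (theta - r (X j w))).
  by apply/funext => w; rewrite /kdeg; ring.
split; first by rewrite E; exact: sqintD.
have -> : \int[P]_w (k (X i w) (X j w) ^+ 2) =
   \int[P]_w (((L (X i w) (X j w) - r (X i w)) + (theta - r (X j w))) ^+ 2).
  by apply: eq_Rintegral => w _; rewrite (congr1 (fun f => f w) E).
apply: le_trans (Rintegral_sqD hA hB) _.
have bA : \int[P]_w ((L (X i w) (X j w) - r (X i w)) ^+ 2) <= 4 * v.
  have := Rintegral_sqD h1 (sqintZ (-1) hi).
  under eq_Rintegral do rewrite mulN1r.
  rewrite h2 (_ : \int[P]_x ((-1 * r (X i x)) ^+ 2) = \int[Q]_x (r x ^+ 2)).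
    by move/le_double_sum; apply => //; exact: kproj_sq_le.
  rewrite -(iid_Rintegral Xiid i kproj_sqint.2); apply: eq_Rintegral => w _; ring.
have bB : \int[P]_w ((theta - r (X j w)) ^+ 2) <= 4 * v.
  have := Rintegral_sqD ht (sqintZ (-1) hj).
  under eq_Rintegral do rewrite mulN1r.
  rewrite Rintegral_cstP (_ : \int[P]_x ((-1 * r (X j x)) ^+ 2) = \int[Q]_x (r x ^+ 2)).
    by move/le_double_sum; apply; [exact: kmean_sq_le|exact: kproj_sq_le].
  rewrite -(iid_Rintegral Xiid j kproj_sqint.2); apply: eq_Rintegral => w _; ring.
by rewrite (_ : 16 * v = 4 * (4 * v)); [exact: (le_double_sum (lexx _) bA bB)|ring].
Qed.

Lemma kdeg_ortho i j p q : i != j -> p != q -> p != j -> q != j ->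
  \int[P]_w (k (X i w) (X j w) * k (X p w) (X q w)) = 0.
Proof.
move=> ij pq pj qj.
apply: (iid_centered Xiid (l := j)
  (F := fun z => k (X i z.1) z.2 * k (X p z.1) (X q z.1))).
- apply: measurable_funM.
    by apply: measurable_kdeg2; [exact: measurable_rest_fst|exact: measurable_snd].
  by apply: measurable_kdeg2; exact: measurable_rest_fst.
- by apply: sqint_mul; [exact: (kdeg_pair ij).1|exact: (kdeg_pair pq).1].
- move=> w; rewrite (_ : (fun y => _) = (fun y => k (X p w) (X q w) * k (X i w) y)).
    by apply: integrableRZ; exact: (kdeg_centered (X i w)).1.
  by apply/funext => y; rewrite mulrC.
- move=> w.
  transitivity (\int[Q]_y (k (X p w) (X q w) * k (X i w) y)).
    by apply: eq_Rintegral => y _; rewrite mulrC.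
  have [h1 h2] := kdeg_centered (X i w).
  by rewrite RintegralZl// h2 mulr0.
Qed.

Lemma centered_sum_sq (q : T -> R) : sqint Q q -> \int[Q]_x q x = 0 ->
  \int[P]_w ((\sum_i q (X i w)) ^+ 2) = n%:R * \int[Q]_x (q x ^+ 2).
Proof.
move=> hq q0; have hqX i := iid_sqint Xiid i hq.
rewrite Rintegral_sum_sq//.
have E i : \sum_j \int[P]_w (q (X i w) * q (X j w)) = \int[Q]_x (q x ^+ 2).
  rewrite (bigD1 i)//= big1 ?addr0.
    by rewrite -(iid_Rintegral Xiid i hq.2); apply: eq_Rintegral => w _; rewrite expr2.
  move=> j ji.
  apply: (iid_centered Xiid (l := j) (F := fun z => q (X i z.1) * q z.2)).
  - apply: measurable_funM.
      by apply: (measurableT_comp hq.1); apply: measurable_rest_fst; rewrite eq_sym.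
    by apply: (measurableT_comp hq.1); exact: measurable_snd.
  - exact: (sqint_mul (hqX i) (hqX j)).
  - by move=> w /=; apply: (integrableRZ (q (X i w))); exact: sqint_integrable.
  - by move=> w /=; rewrite RintegralZl ?q0 ?mulr0//; exact: sqint_integrable.
by rewrite (eq_bigr _ (fun i _ => E i)) sumr_const card_ord mulr_natl.
Qed.

Lemma kdeg_sum_sq :
  sqint P (fun w => \sum_(p : 'I_n * 'I_n)
     (if p.1 == p.2 then 0 else k (X p.1 w) (X p.2 w))) /\
  \int[P]_w ((\sum_(p : 'I_n * 'I_n)
     (if p.1 == p.2 then 0 else k (X p.1 w) (X p.2 w))) ^+ 2) <= 32 * n%:R ^+ 2 * v.
Proof.
pose Z (p : 'I_n * 'I_n) w := if p.1 == p.2 then 0 else k (X p.1 w) (X p.2 w).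
have hZ p : sqint P (Z p).
  rewrite /Z; case: eqVneq => [_|ne]; first exact: sqint_cst.
  exact: (kdeg_pair ne).1.
split; first exact: (@sqint_sum _ _ _ P _ _ _ Z).
rewrite (@Rintegral_sum_sq _ _ _ P _ Z)//.
have v0 : 0 <= v by apply: le_trans kmean_sq_le; exact: sqr_ge0.
have Zb p : \int[P]_w (Z p w ^+ 2) <= 16 * v.
  rewrite /Z; case: eqVneq => [_|ne]; last exact: (kdeg_pair ne).2.
  by rewrite expr0n /= Rintegral_cstP mulr_ge0.
have Z0 p : 0 <= \int[P]_w (Z p w ^+ 2) by exact: Rintegral_sq_ge0.
have Zc p q : \int[P]_w (Z p w * Z q w) <=
   (if q == p then \int[P]_w (Z p w ^+ 2) else 0) +
   (if q == (p.2, p.1) then \int[P]_w (Z p w ^+ 2) else 0).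
  have [->|qp] := eqVneq q p.
    rewrite (_ : \int[P]_w _ = \int[P]_w (Z p w ^+ 2)); last first.
      by apply: eq_Rintegral => w _; rewrite expr2.
    by case: ifP => _; rewrite ?addr0// lerDl.
  have [->|qp'] := eqVneq q (p.2, p.1).
    rewrite add0r le_eqVlt; apply/orP; left; apply/eqP.
    apply: eq_Rintegral => w _; rewrite /Z /= (eq_sym p.2) expr2.
    by case: eqP => // _; rewrite [in X in _ * X]kdeg_sym.
  rewrite addr0 le_eqVlt; apply/orP; left; apply/eqP.
  rewrite /Z; case: eqVneq => [_|p12].
    by under eq_Rintegral do rewrite mul0r; rewrite Rintegral_cstP.
  case: eqVneq => [_|q12].
    by under eq_Rintegral do rewrite mulr0; rewrite Rintegral_cstP.
  have [h1|/norP[h1 h2]] := boolP ((q.1 == p.2) || (q.2 == p.2)); last exact: kdeg_ortho.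
  have [h2|/norP[h2 h3]] := boolP ((q.1 == p.1) || (q.2 == p.1)); last first.
    transitivity (\int[P]_w (k (X p.2 w) (X p.1 w) * k (X q.1 w) (X q.2 w))).
      by apply: eq_Rintegral => w _; rewrite kdeg_sym.
    by apply: kdeg_ortho => //; rewrite eq_sym.
  exfalso; case: p q qp qp' p12 q12 h1 h2 => p1 p2 [q1 q2] /=.
  rewrite !xpair_eqE => n1 n2 n3 n4 /orP[/eqP f1|/eqP f1] /orP[/eqP f2|/eqP f2].
  - by rewrite -f1 -f2 eqxx in n3.
  - by rewrite f1 f2 !eqxx in n2.
  - by rewrite f1 f2 !eqxx in n1.
  - by rewrite -f1 -f2 eqxx in n3.
apply: (le_trans (ler_sum _ (fun p _ => ler_sum _ (fun q _ => Zc p q)))).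
under eq_bigr => p _ do rewrite big_split /= -!big_mkcond !big_pred1_eq.
apply: (@le_trans _ _ (\sum_(p : 'I_n * 'I_n) 32 * v)).
  by apply: ler_sum => p _; have := Zb p; lra.
by rewrite sumr_const card_prod card_ord -[leLHS]mulr_natl natrM; lra.
Qed.

End hoeffding.

Lemma hoeffding_identity (R : realFieldType) n (L : 'I_n -> 'I_n -> R)
  (r : 'I_n -> R) (c theta : R) : (forall i, L i i = c) ->
  \sum_(p : 'I_n * 'I_n) (if p.1 == p.2 then 0 else L p.1 p.2 - r p.1 - r p.2 + theta) =
  \sum_i \sum_j L i j - n%:R * c - 2 * (n%:R - 1) * \sum_i r i
  + n%:R * (n%:R - 1) * theta.
Proof.
move=> Ldiag.
rewrite -(pair_big xpredT xpredT
  (fun i j => if i == j then 0 else L i j - r i - r j + theta)) /=.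
have Ei i : \sum_j (if i == j then 0 else L i j - r i - r j + theta) =
   \sum_j L i j - n%:R * r i - \sum_j r j + n%:R * theta - (c - 2 * r i + theta).
  transitivity (\sum_j (L i j - r i - r j + theta) - (L i i - r i - r i + theta)).
    rewrite (bigD1 i)//= eqxx add0r [in RHS](bigD1 i)//= [RHS]addrAC subrr add0r.
    by apply: eq_bigr => j; rewrite eq_sym => /negbTE ->.
  rewrite big_split /= !sumrB !sumr_const card_ord !mulr_natl Ldiag.
  by congr (_ - _); ring.
rewrite (eq_bigr _ (fun i _ => Ei i)) sumrB big_split /= !sumrB.
rewrite -!mulr_sumr [X in _ - X]big_split /= sumrB -mulr_sumr !sumr_const card_ord.
rewrite -(mulr_natl theta) -(mulr_natl c) -(mulr_natl (\sum_j r j)); ring.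
Qed.

Section linearization.
Context (d1 d2 : measure_display) (Omega : measurableType d1)
  (T : measurableType d2) (R : realType).
Variables (P : probability Omega R) (Q : probability T R).
Variables (n : nat) (X : 'I_n -> Omega -> T) (Xiid : iid_fin P Q X).
Variables (L : T -> T -> R) (c B M : R) (e : T -> R).
Hypotheses (mL : measurable_fun setT (fun z : T * T => L z.1 z.2))
  (Lsym : forall x y, L x y = L y x) (Ldiag : forall x, L x x = c)
  (L2 : forall x, sqint Q (L x)) (LB : forall x, \int[Q]_y (L x y ^+ 2) <= B)
  (me : measurable_fun [set: T] e) (eM : forall x, `|e x| <= M).
Local Notation r := (kproj Q L).
Local Notation theta := (kmean Q L).
Local Notation k := (kdeg Q L).

Definition vstat w := n%:R ^- 2 * \sum_i \sum_j L (X i w) (X j w).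
Definition vnorm w :=
  Num.sqrt n%:R * (vstat w - c / n%:R - (1 - n%:R^-1) * theta).
Definition emean := \int[Q]_x e x.
Definition elin w := \sum_i (2 / Num.sqrt n%:R) * (e (X i w) - emean).
Definition kbias := \int[Q]_x ((r x - e x) ^+ 2).

Let q x := 2 * (1 - n%:R^-1) * (r x - theta) - 2 * (e x - emean).

Lemma vnorm_decomp w : (0 < n)%N ->
  vnorm w - elin w =
  Num.sqrt n%:R / n%:R ^+ 2 * (\sum_(p : 'I_n * 'I_n)
     (if p.1 == p.2 then 0 else k (X p.1 w) (X p.2 w))) +
  (Num.sqrt n%:R)^-1 * \sum_i q (X i w).
Proof.
move=> n0.
have N0 : n%:R != 0 :> R by rewrite pnatr_eq0 -lt0n.
have s0 : Num.sqrt n%:R != 0 :> R by rewrite gt_eqF// sqrtr_gt0 ltr0n.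
have ss : Num.sqrt n%:R * Num.sqrt n%:R = n%:R :> R by rewrite -expr2 sqr_sqrtr.
have Ek : \sum_(p : 'I_n * 'I_n) (if p.1 == p.2 then 0 else k (X p.1 w) (X p.2 w)) =
   \sum_i \sum_j L (X i w) (X j w) - n%:R * c
   - 2 * (n%:R - 1) * \sum_i r (X i w) + n%:R * (n%:R - 1) * theta.
  exact: (@hoeffding_identity _ n (fun i j => L (X i w) (X j w)) (fun i => r (X i w))).
have Eq : \sum_i q (X i w) = 2 * (1 - n%:R^-1) * (\sum_i r (X i w) - n%:R * theta)
    - 2 * (\sum_i e (X i w) - n%:R * emean).
  by rewrite sumrB -!mulr_sumr !sumrB !sumr_const card_ord !(mulr_natl _ n).
have El : elin w = (2 / Num.sqrt n%:R) * (\sum_i e (X i w) - n%:R * emean).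
  by rewrite /elin -mulr_sumr sumrB sumr_const card_ord (mulr_natl _ n).
rewrite Ek Eq El /vnorm /vstat.
set A := \sum_i \sum_j _; set C := \sum_i r _; set D := \sum_i e _.
move: A C D theta emean => A C D th em.
move: ss s0 N0; set s := Num.sqrt _; set N := n%:R => ss s0 N0.
have -> : N = s ^+ 2 by rewrite expr2.
by field.
Qed.

Lemma measurable_vstat : measurable_fun [set: Omega] vstat.
Proof.
apply: measurable_funM; first exact: measurable_cst.
apply: measurable_sum => i; apply: measurable_sum => j.
exact: (measurable_pair_fun Xiid i j mL).
Qed.

Lemma measurable_vnorm : measurable_fun [set: Omega] vnorm.
Proof.
apply: measurable_funM; first exact: measurable_cst.
by do 2!(apply: measurable_funB; last exact: measurable_cst); exact: measurable_vstat.
Qed.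

Lemma measurable_elin : measurable_fun [set: Omega] elin.
Proof.
apply: measurable_sum => i; apply: measurable_funM; first exact: measurable_cst.
apply: measurable_funB; last exact: measurable_cst.
exact: (measurableT_comp me (Xiid.1 i)).
Qed.

Lemma vnorm_elin_sq : (0 < n)%N ->
  sqint P (fun w => vnorm w - elin w) /\
  \int[P]_w ((vnorm w - elin w) ^+ 2) <=
    64 * ksq Q L / n%:R + 16 * kbias + 16 * M ^+ 2 / n%:R ^+ 2.
Proof.
move=> n0.
have N0 : n%:R != 0 :> R by rewrite pnatr_eq0 -lt0n.
have N1 : 1 <= n%:R :> R by rewrite ler1n.
have s0 : Num.sqrt n%:R != 0 :> R by rewrite gt_eqF// sqrtr_gt0 ltr0n.
have ss : Num.sqrt n%:R ^+ 2 = n%:R :> R by rewrite sqr_sqrtr.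
have hr := kproj_sqint mL L2 LB; have he := sqint_bounded Q me eM.
have hre := sqintB hr he.
have ir := sqint_integrable hr; have ie := sqint_integrable he.
have ire := sqint_integrable hre.
pose qa x := 2 * (1 - n%:R^-1) * ((r x - e x) - \int[Q]_y (r y - e y)).
pose qb x := - (2 / n%:R) * (e x - emean).
have Ere : \int[Q]_y (r y - e y) = theta - emean by rewrite RintegralB.
have qab : q = (fun x => qa x + qb x).
  by apply/funext => x; rewrite /q /qa /qb Ere; field.
have hqa : sqint Q qa by apply: sqintZ; apply: sqintB => //; exact: sqint_cst.
have hqb : sqint Q qb by apply: sqintZ; apply: sqintB => //; exact: sqint_cst.
have hq : sqint Q q by rewrite qab; exact: sqintD.
have q0 : \int[Q]_x q x = 0.
  rewrite /q RintegralB//; first last.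
  - by apply: integrableRZ; apply: integrableRB => //; exact: integrableR_cst.
  - by apply: integrableRZ; apply: integrableRB => //; exact: integrableR_cst.
  rewrite !RintegralZl//; first last.
  - by apply: integrableRB => //; exact: integrableR_cst.
  - by apply: integrableRB => //; exact: integrableR_cst.
  rewrite !RintegralB//; try exact: integrableR_cst.
  by rewrite !Rintegral_cstP -/theta -/emean !subrr !mulr0 subrr.
have q2 : \int[Q]_x (q x ^+ 2) <= 8 * kbias + 8 * M ^+ 2 / n%:R ^+ 2.
  rewrite qab; apply: le_trans (Rintegral_sqD hqa hqb) _.
  have ba : \int[Q]_x (qa x ^+ 2) <= 4 * kbias.
    rewrite /qa; under eq_Rintegral do rewrite exprMn.
    rewrite RintegralZl//; last first.
      by apply: (sqintB hre _).2; exact: sqint_cst.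
    rewrite Rintegral_var// -/kbias.
    apply: ler_pM; rewrite ?sqr_ge0//.
    - by rewrite subr_ge0; exact: Rintegral_sq_mean.
    - rewrite (_ : 4 = 2 ^+ 2); last by rewrite -natrX.
      rewrite lerXn2r// ?nnegrE//.
      + by rewrite mulr_ge0// subr_ge0 invf_le1// ltr0n.
      + by rewrite -[leRHS]mulr1 ler_wpM2l// gerBl invr_ge0.
    - by rewrite gerBl sqr_ge0.
  have bb : \int[Q]_x (qb x ^+ 2) <= 4 * M ^+ 2 / n%:R ^+ 2.
    rewrite /qb; under eq_Rintegral do rewrite exprMn.
    rewrite RintegralZl//; last first.
      by apply: (sqintB he _).2; exact: sqint_cst.
    rewrite Rintegral_var//.
    have -> : 4 * M ^+ 2 / n%:R ^+ 2 = (- (2 / n%:R)) ^+ 2 * M ^+ 2 by field.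
    apply: ler_wpM2l; first exact: sqr_ge0.
    rewrite lerBlDr -[leLHS]addr0; apply: lerD; last exact: sqr_ge0.
    rewrite -[leRHS](Rintegral_cstP Q); apply: le_Rintegral => //.
    - exact: he.2.
    - exact: integrableR_cst.
    - by move=> x _; rewrite -[leLHS]real_normK ?num_real// lerXn2r ?nnegrE// (le_trans _ (eM x)).
  have -> : 8 * kbias + 8 * M ^+ 2 / n%:R ^+ 2 = 2 * (4 * kbias) + 2 * (4 * M ^+ 2 / n%:R ^+ 2).
    by ring.
  by apply: lerD; rewrite ler_wpM2l.
have [hZ bZ] := kdeg_sum_sq Xiid mL Lsym L2 LB.
set Z := (fun w => \sum_(p : 'I_n * 'I_n) _) in hZ bZ.
have hQ : sqint P (fun w => \sum_i q (X i w)).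
  by apply: sqint_sum => i _; exact: (iid_sqint Xiid i hq).
have h1 := sqintZ (Num.sqrt n%:R / n%:R ^+ 2) hZ.
have h2 := sqintZ (Num.sqrt n%:R)^-1 hQ.
have E : (fun w => vnorm w - elin w) = (fun w =>
   Num.sqrt n%:R / n%:R ^+ 2 * Z w + (Num.sqrt n%:R)^-1 * \sum_i q (X i w)).
  by apply/funext => w; rewrite vnorm_decomp.
split; first by rewrite E; exact: sqintD.
have -> : \int[P]_w ((vnorm w - elin w) ^+ 2) = \int[P]_w
   ((Num.sqrt n%:R / n%:R ^+ 2 * Z w + (Num.sqrt n%:R)^-1 * \sum_i q (X i w)) ^+ 2).
  by apply: eq_Rintegral => w _; rewrite (congr1 (fun f => f w) E).
apply: le_trans (Rintegral_sqD h1 h2) _.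
have b1 : \int[P]_w ((Num.sqrt n%:R / n%:R ^+ 2 * Z w) ^+ 2) <= 32 * ksq Q L / n%:R.
  under eq_Rintegral do rewrite exprMn.
  rewrite RintegralZl//; last exact: hZ.2.
  have -> : 32 * ksq Q L / n%:R =
     (Num.sqrt n%:R / n%:R ^+ 2) ^+ 2 * (32 * n%:R ^+ 2 * ksq Q L).
    by rewrite expr_div_n ss; field.
  by apply: ler_wpM2l => //; exact: sqr_ge0.
have b2 : \int[P]_w (((Num.sqrt n%:R)^-1 * \sum_i q (X i w)) ^+ 2) =
    \int[Q]_x (q x ^+ 2).
  under eq_Rintegral do rewrite exprMn.
  rewrite RintegralZl//; last exact: hQ.2.
  by rewrite (centered_sum_sq Xiid hq q0) exprVn ss mulKf.
rewrite b2.
have -> : 64 * ksq Q L / n%:R + 16 * kbias + 16 * M ^+ 2 / n%:R ^+ 2 =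
  2 * (32 * ksq Q L / n%:R) + 2 * (8 * kbias + 8 * M ^+ 2 / n%:R ^+ 2) by ring.
by apply: lerD; rewrite ler_wpM2l.
Qed.

End linearization.

(** * Comparison of a V-statistic with a Rademacher sum *)

Section lindeberg.
Context (d1 d2 : measure_display) (Omega : measurableType d1)
  (T : measurableType d2) (R : realType).
Variables (P : probability Omega R) (Q : probability T R).

Definition taylor2 (b c : R) (f : R -> R) := exists f1 f2 : R -> R,
  (forall x, `|f2 x| <= b) /\
  forall x y, `|f (x + y) - f x - f1 x * y - f2 x * y ^+ 2 / 2| <= c * `|y| ^+ 3.

Lemma taylor2_rad (s : R) n (b c : R) f : taylor2 b c f -> taylor2 b c (rad s n f).
Proof.
elim: n => [//|n IH] /IH[f1 [f2 [hb hc]]].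
exists (fun x => (f1 (x + s) + f1 (x - s)) / 2), (fun x => (f2 (x + s) + f2 (x - s)) / 2).
split=> [x|x y] /=.
  have := hb (x + s); have := hb (x - s); rewrite !ler_norml => /andP[? ?] /andP[? ?].
  by apply/andP; split; lra.
have := hc (x + s) y; have := hc (x - s) y.
rewrite (_ : x - s + y = x + y - s); last by ring.
rewrite (_ : x + s + y = x + y + s); last by ring.
rewrite !ler_norml => /andP[? ?] /andP[? ?].
by apply/andP; split; lra.
Qed.

Lemma taylor2_step (t u : R) : 0 < u ->
  taylor2 (u ^- 2) (4 / 3 * u ^- 3) (fun x => step ((x - t) / u)).
Proof.
move=> u0; have u0' : u != 0 by rewrite gt_eqF.
exists (fun x => step1 ((x - t) / u) / u), (fun x => step2 ((x - t) / u) / u ^+ 2).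
split=> [x|x y].
  rewrite normrM normfV (ger0_norm (exprn_ge0 2 (ltW u0))) -[leRHS]mul1r.
  by rewrite ler_wpM2r ?invr_ge0 ?exprn_ge0 ?step2_le1// ltW.
have := step_taylor ((x - t) / u) (y / u).
rewrite (_ : (x - t) / u + y / u = (x + y - t) / u); last by field.
rewrite normrM normfV (ger0_norm (ltW u0)).
have -> : step1 ((x - t) / u) * (y / u) = step1 ((x - t) / u) / u * y by field.
have -> : step2 ((x - t) / u) * (y / u) ^+ 2 / 2 = step2 ((x - t) / u) / u ^+ 2 * y ^+ 2 / 2.
  by field.
by have -> : 4 / 3 * (`|y| / u) ^+ 3 = 4 / 3 * u ^- 3 * `|y| ^+ 3 by field.
Qed.

Lemma measurable_rad (s : R) n f : measurable_fun [set: R] f ->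
  measurable_fun [set: R] (rad s n f).
Proof.
move=> mf; elim: n => [//|n IH] /=.
apply: measurable_funM; last exact: measurable_cst.
apply: measurable_funD; apply: (measurableT_comp IH).
  by apply: measurable_funD => //; exact: measurable_cst.
by apply: measurable_funB => //; exact: measurable_cst.
Qed.

Lemma rad_ge0_le1 (s : R) n f : (forall x, 0 <= f x <= 1) ->
  forall x, 0 <= rad s n f x <= 1.
Proof.
move=> f01 x; apply/andP; split.
  by rewrite -(rad_cst s n 0 x); apply: rad_le => y; have /andP[] := f01 y.
by rewrite -(rad_cst s n 1 x); apply: rad_le => y; have /andP[] := f01 y.
Qed.

Lemma swap_one (a : T -> R) (A s b c : R) (f : R -> R) :
  measurable_fun [set: T] a -> (forall y, `|a y| <= A) -> \int[Q]_y a y = 0 ->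
  0 <= s -> 0 <= b -> 0 <= c -> taylor2 b c f -> measurable_fun [set: R] f ->
  (forall x, 0 <= f x <= 1) ->
  forall u, `|\int[Q]_y f (u + a y) - (f (u + s) + f (u - s)) / 2| <=
    b / 2 * `|\int[Q]_y (a y ^+ 2) - s ^+ 2| + c * (A ^+ 3 + s ^+ 3).
Proof.
move=> ma aA a0 s0 b0 c0 [f1 [f2 [hb hc]]] mf f01 u.
have a2 := sqint_bounded Q ma aA; have ia := sqint_integrable a2.
have A0 : 0 <= A by apply: le_trans (aA point).
set t2 := \int[Q]_y (a y ^+ 2).
have ifa : Q.-integrable [set: T] (EFin \o (fun y => f (u + a y))).
  apply: (@integrableR_bounded _ _ _ _ _ 1) => [|y].
    apply: (measurableT_comp mf); apply: measurable_funD => //; exact: measurable_cst.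
  by have /andP[h1 h2] := f01 (u + a y); rewrite ger0_norm.
have h1 : `|\int[Q]_y f (u + a y) - (f u + f2 u / 2 * t2)| <= c * A ^+ 3.
  have i1 := integrableRZ (f1 u) ia.
  have i2 := integrableRZ (f2 u / 2) a2.2.
  have i3 := integrableR_cst Q (f u).
  pose F y := f (u + a y) - (f u + f1 u * a y + f2 u / 2 * a y ^+ 2).
  have iF : Q.-integrable [set: T] (EFin \o F).
    by apply: integrableRB => //; apply: integrableRD => //; exact: integrableRD.
  have -> : \int[Q]_y f (u + a y) - (f u + f2 u / 2 * t2) = \int[Q]_y F y.
    rewrite RintegralB//; last by apply: integrableRD => //; exact: integrableRD.
    rewrite RintegralD//; last exact: integrableRD.
    by rewrite RintegralD// !RintegralZl//; [rewrite Rintegral_cstP a0 mulr0 addr0|exact: a2.2].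
  apply: (le_trans (le_normr_Rintegral measurableT iF)).
  rewrite -[leRHS](Rintegral_cstP Q); apply: le_Rintegral => //.
  - exact: (integrable_abse iF).
  - exact: integrableR_cst.
  - move=> y _; have := hc u (a y).
    have -> : f (u + a y) - f u - f1 u * a y - f2 u * a y ^+ 2 / 2 = F y.
      by rewrite /F; ring.
    move/le_trans; apply; apply: ler_wpM2l => //.
    by rewrite lerXn2r// nnegrE.
have h2 := hc u s; have h3 := hc u (- s).
rewrite normrN (ger0_norm s0) sqrrN in h3; rewrite (ger0_norm s0) in h2.
have h4 : `|(f (u + s) + f (u - s)) / 2 - (f u + f2 u / 2 * s ^+ 2)| <= c * s ^+ 3.
  move: h2 h3; rewrite !ler_norml => /andP[? ?] /andP[? ?].
  by apply/andP; split; lra.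
have -> : \int[Q]_y f (u + a y) - (f (u + s) + f (u - s)) / 2 =
  (\int[Q]_y f (u + a y) - (f u + f2 u / 2 * t2)) + f2 u / 2 * (t2 - s ^+ 2)
  - ((f (u + s) + f (u - s)) / 2 - (f u + f2 u / 2 * s ^+ 2)) by ring.
apply: le_trans (ler_normB _ _) _; apply: le_trans (lerD (ler_normD _ _) h4) _.
have h5 : `|f2 u / 2 * (t2 - s ^+ 2)| <= b / 2 * `|t2 - s ^+ 2|.
  rewrite normrM; apply: ler_wpM2r => //.
  by rewrite normrM (@ger0_norm _ 2^-1)// ler_wpM2r.
rewrite [leRHS](_ : _ = c * A ^+ 3 + b / 2 * `|t2 - s ^+ 2| + c * s ^+ 3); last by ring.
exact: lerD (lerD h1 h5) (lexx _).
Qed.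

Variables (n : nat) (X : 'I_n -> Omega -> T) (Xiid : iid_fin P Q X).
Variables (a : T -> R) (A s : R).
Hypotheses (ma : measurable_fun [set: T] a) (aA : forall y, `|a y| <= A)
  (a0 : \int[Q]_y a y = 0) (s0 : 0 <= s).

Let U (k : nat) w := \sum_(i < n) (if (i < k)%N then a (X i w) else 0).

(* Lindeberg's replacement with Rademacher instead of Gaussian summands: only
   the first two moments have to match, and the same reference law serves the
   data and the bootstrap. *)
Lemma lindeberg_swap (f : R -> R) (b c : R) : 0 <= b -> 0 <= c -> taylor2 b c f ->
  measurable_fun [set: R] f -> (forall x, 0 <= f x <= 1) ->
  `|\int[P]_w f (\sum_i a (X i w)) - rad s n f 0| <=
    n%:R * (b / 2 * `|\int[Q]_y (a y ^+ 2) - s ^+ 2| + c * (A ^+ 3 + s ^+ 3)).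
Proof.
move=> b0 c0 tf mf f01.
set eta := (X in _ <= _ * X).
have mU k : measurable_fun [set: Omega] (U k).
  apply: measurable_sum => i; case: (ltnP i k) => _; last exact: measurable_cst.
  exact: (measurableT_comp ma (Xiid.1 i)).
have ib (g : R -> R) (V : Omega -> R) : measurable_fun [set: R] g ->
    (forall x, 0 <= g x <= 1) -> measurable_fun [set: Omega] V ->
    P.-integrable [set: Omega] (EFin \o (fun w => g (V w))).
  move=> mg g01 mV; apply: (@integrableR_bounded _ _ _ _ _ 1) => [|w].
    exact: (measurableT_comp mg mV).
  by have /andP[h1 h2] := g01 (V w); rewrite ger0_norm.
pose D k := \int[P]_w rad s (n - k) f (U k w).
have stepk k : (k < n)%N -> `|D k.+1 - D k| <= eta.
  move=> kn; pose l := Ordinal kn.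
  pose g := rad s (n - k.+1) f.
  have mg : measurable_fun [set: R] g by exact: measurable_rad.
  have g01 : forall x, 0 <= g x <= 1 by exact: rad_ge0_le1.
  have tg : taylor2 b c g by exact: taylor2_rad.
  have UE w : U k.+1 w = U k w + a (X l w).
    rewrite /U (bigD1 l)//= ltnSn [in RHS](bigD1 l)//= ltnn add0r addrC; congr (_ + _).
    apply: eq_bigr => i; rewrite -(inj_eq val_inj) /= => il.
    by rewrite ltnS leq_eqVlt (negbTE il).
  have mUr : measurable_fun [set: g_sigma_algebraType (cyl X l) * T]
     (fun z => g (\sum_(i < n) (if (i < k)%N then a (X i z.1) else 0) + a z.2)).
    apply: (measurableT_comp mg); apply: measurable_funD; last first.
      by apply: (measurableT_comp ma); exact: measurable_snd.
    apply: measurable_sum => i; case: (ltnP i k) => ik; last exact: measurable_cst.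
    apply: (measurableT_comp ma); apply: measurable_rest_fst.
    by rewrite -(inj_eq val_inj) /= neq_ltn ik.
  have [m1 b1 E1] := iid_fubini Xiid mUr (fun z => g01 _).
  have ED1 : D k.+1 = \int[P]_w \int[Q]_y g (U k w + a y).
    by rewrite /D -E1; apply: eq_Rintegral => w _; rewrite UE.
  have ED0 : D k = \int[P]_w ((g (U k w + s) + g (U k w - s)) / 2).
    by apply: eq_Rintegral => w _; rewrite -(subnSK kn).
  have i1 : P.-integrable [set: Omega] (EFin \o (fun w => \int[Q]_y g (U k w + a y))).
    apply: (@integrableR_bounded _ _ _ _ _ 1) => [|w]; first exact: m1.
    by have /andP[h1 h2] := b1 w; rewrite ger0_norm.
  have i2 : P.-integrable [set: Omega] (EFin \o (fun w => (g (U k w + s) + g (U k w - s)) / 2)).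
    apply: (ib (fun u => (g (u + s) + g (u - s)) / 2)) => //.
      exact: (measurable_rad s 1 mg).
    exact: (rad_ge0_le1 s 1 g01).
  rewrite ED1 ED0 -RintegralB//.
  have i3 := integrableRB i1 i2.
  apply: le_trans (le_normr_Rintegral measurableT i3) _.
  rewrite -[leRHS](Rintegral_cstP P); apply: le_Rintegral => //.
  - exact: (integrable_abse i3).
  - exact: integrableR_cst.
  - by move=> w _; exact: (swap_one ma aA a0 s0 b0 c0 tg mg g01).
have tele k : (k <= n)%N -> `|D k - D 0%N| <= k%:R * eta.
  elim: k => [|k IH] kn; first by rewrite subrr normr0 mul0r.
  rewrite -[D k.+1](subrK (D k)) -addrA.
  apply: le_trans (ler_normD _ _) _.
  rewrite -(natr1 k) mulrDl mul1r [leRHS]addrC.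
  by apply: lerD; [exact: stepk|apply: IH; exact: ltnW].
have := tele n (leqnn n).
have -> : D n = \int[P]_w f (\sum_i a (X i w)).
  rewrite /D subnn; apply: eq_Rintegral => w _ /=; congr f; apply: eq_bigr => i _.
  by rewrite ltn_ord.
suff -> : D 0%N = rad s n f 0 by [].
rewrite /D subn0 -[RHS](Rintegral_cstP P); apply: eq_Rintegral => w _; congr rad.
by rewrite /U big1.
Qed.

End lindeberg.

Section measurable_level_sets.
Context (d : measure_display) (S : measurableType d) (R : realType).
Variables (V : S -> R) (mV : measurable_fun [set: S] V).

Lemma measurable_set_le t : measurable [set w | V w <= t].
Proof.
by rewrite -[X in measurable X]setTI; exact: (measurable_fun_ler mV (measurable_cst t)).
Qed.

Lemma measurable_set_ge t : measurable [set w | t <= V w].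
Proof.
by rewrite -[X in measurable X]setTI; exact: (measurable_fun_ler (measurable_cst t) mV).
Qed.

Lemma measurable_set_gt t : measurable [set w | t < V w].
Proof.
by rewrite -[X in measurable X]setTI; exact: (measurable_fun_ltr (measurable_cst t) mV).
Qed.

End measurable_level_sets.

Section comparison.
Context (d1 d2 : measure_display) (Omega : measurableType d1)
  (T : measurableType d2) (R : realType).
Variables (P : probability Omega R) (Q : probability T R).
Variables (n : nat) (X : 'I_n -> Omega -> T) (Xiid : iid_fin P Q X).
Variables (L : T -> T -> R) (c B M : R) (e : T -> R) (sg : R).
Hypotheses (n0 : (0 < n)%N)
  (mL : measurable_fun setT (fun z : T * T => L z.1 z.2))
  (Lsym : forall x y, L x y = L y x) (Ldiag : forall x, L x x = c)
  (L2 : forall x, sqint Q (L x)) (LB : forall x, \int[Q]_y (L x y ^+ 2) <= B)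
  (me : measurable_fun [set: T] e) (eM : forall x, `|e x| <= M) (sg0 : 0 < sg).

Definition evar := \int[Q]_x (e x ^+ 2) - (\int[Q]_x e x) ^+ 2.

Definition rem_err := 64 * ksq Q L / n%:R + 16 * kbias Q L e + 16 * M ^+ 2 / n%:R ^+ 2.

Definition clt_err (u : R) :=
  2 / u ^+ 2 * `|evar - sg ^+ 2| +
  4 / 3 / u ^+ 3 * (64 * M ^+ 3 + 8 * sg ^+ 3) / Num.sqrt n%:R.

Definition cmp_err u := rem_err / u ^+ 2 + clt_err u.

Definition rcdf t := rad_cdf (2 * sg / Num.sqrt n%:R) n t.

Local Notation lin := (elin Q X e).
Local Notation W := (vnorm Q X L c).

Let M0 : 0 <= M. Proof. exact: le_trans (eM point). Qed.
Let N0 : 0 < n%:R :> R. Proof. by rewrite ltr0n. Qed.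
Let S0 : 0 < Num.sqrt n%:R :> R. Proof. by rewrite sqrtr_gt0. Qed.
Let SS : Num.sqrt n%:R ^+ 2 = n%:R :> R. Proof. by rewrite sqr_sqrtr ?ltW. Qed.

Let f (t u x : R) := step ((x - t) / u) : R.

Let mf t u : measurable_fun [set: R] (f t u).
Proof.
apply: (measurableT_comp (@measurable_step R)); apply: measurable_funM => //.
by apply: measurable_funB => //; exact: measurable_cst.
Qed.

Let f01 t u x : 0 <= f t u x <= 1.
Proof. by rewrite step_ge0 step_le1. Qed.

Let lin_swap (t u : R) : 0 < u ->
  `|\int[P]_w f t u (lin w) - rad (2 * sg / Num.sqrt n%:R) n (f t u) 0| <= clt_err u.
Proof.
move=> u0; pose a x := (2 / Num.sqrt n%:R) * (e x - emean Q e).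
have s0' : Num.sqrt n%:R != 0 :> R by rewrite gt_eqF.
have e2 := sqint_bounded Q me eM; have ie := sqint_integrable e2.
have emM : `|emean Q e| <= M.
  apply: (le_trans (le_normr_Rintegral measurableT ie)).
  rewrite -[leRHS](Rintegral_cstP Q); apply: le_Rintegral => //.
  - exact: (integrable_abse ie).
  - exact: integrableR_cst.
have ma : measurable_fun [set: T] a.
  by apply: measurable_funM => //; apply: measurable_funB => //; exact: measurable_cst.
have sn2 : 0 <= 2 / Num.sqrt n%:R :> R by rewrite divr_ge0 ?ltW.
have aA y : `|a y| <= 4 * M / Num.sqrt n%:R.
  rewrite normrM ger0_norm//.
  rewrite (_ : 4 * M / Num.sqrt n%:R = 2 / Num.sqrt n%:R * (M + M)); last by ring.
  apply: ler_wpM2l => //.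
  by apply: (le_trans (ler_normB _ _)); exact: lerD.
have iem : Q.-integrable [set: T] (EFin \o (fun x => e x - emean Q e)).
  by apply: integrableRB => //; exact: integrableR_cst.
have a0 : \int[Q]_y a y = 0.
  rewrite RintegralZl// RintegralB//; last exact: integrableR_cst.
  by rewrite Rintegral_cstP subrr mulr0.
have a2 : \int[Q]_y (a y ^+ 2) = 4 / n%:R * evar.
  rewrite /a; under eq_Rintegral do rewrite exprMn.
  rewrite RintegralZl//; last by apply: (sqintB e2 _).2; exact: sqint_cst.
  by rewrite Rintegral_var// expr_div_n SS -natrX.
have sp : 0 <= 2 * sg / Num.sqrt n%:R by rewrite divr_ge0 ?mulr_ge0 ?ltW.
have b0 : 0 <= u ^- 2 by rewrite invr_ge0 exprn_ge0 ?ltW.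
have c0 : 0 <= 4 / 3 * u ^- 3 by rewrite mulr_ge0 ?divr_ge0 ?invr_ge0 ?exprn_ge0 ?ltW.
have := lindeberg_swap Xiid ma aA a0 sp b0 c0 (taylor2_step t u0) (mf t u) (f01 t u).
rewrite a2 => /le_trans; apply.
have -> : 4 / n%:R * evar - (2 * sg / Num.sqrt n%:R) ^+ 2 = 4 / n%:R * (evar - sg ^+ 2).
  by rewrite expr_div_n SS; field; rewrite gt_eqF.
have n4 : 0 <= 4 / n%:R :> R by rewrite divr_ge0 ?ltW.
rewrite normrM (ger0_norm n4).
have SS' := SS; rewrite /clt_err; set S := Num.sqrt n%:R in SS' s0' *.
rewrite -SS' le_eqVlt; apply/orP; left; apply/eqP.
by field; rewrite s0' gt_eqF.
Qed.

Let Rf_int t u : P.-integrable [set: Omega] (EFin \o (fun w => f t u (lin w))).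
Proof.
apply: (@integrableR_bounded _ _ _ _ _ 1) => [|w].
  exact: (measurableT_comp (mf t u) (measurable_elin Xiid me)).
by have /andP[h1 h2] := f01 t u (lin w); rewrite ger0_norm.
Qed.

Let lin_le (t u : R) : 0 < u ->
  (P [set w | (lin w <= t)%R] <= (rcdf (t + 3 * u) + clt_err u)%:E)%E.
Proof.
move=> u0; have h := lin_swap t u0.
have i1 : P.-integrable [set: Omega] (EFin \o (fun w => 1 - f t u (lin w))).
  by apply: integrableRB => //; exact: integrableR_cst.
have p0 w : 0 <= 1 - f t u (lin w) by rewrite subr_ge0; have /andP[] := f01 t u (lin w).
have := markov_R ltr01 p0 i1.
rewrite divr1 RintegralB//; last exact: integrableR_cst.
rewrite Rintegral_cstP => hm.
apply: (@le_trans _ _ (P [set w | (1 <= 1 - f t u (lin w))%R])).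
  apply: le_measure; rewrite ?inE.
  - exact: (measurable_set_le (measurable_elin Xiid me)).
  - by apply: measurable_set_ge; apply/measurable_EFinP; exact: measurable_int i1.
  - move=> w /= wt; rewrite /f step_le0 ?subr0// pmulr_lle0 ?invr_gt0//.
    by rewrite subr_le0.
apply: (le_trans hm); rewrite lee_fin.
have hr : rad (2 * sg / Num.sqrt n%:R) n (fun x => 1 - f t u x) 0 <= rcdf (t + 3 * u).
  apply: rad_le => x; have /andP[h1 h2] := f01 t u x.
  case: (leP x (t + 3 * u)) => hx /=; first lra.
  rewrite subr_le0 /f step_ge3// ler_pdivlMr//; lra.
rewrite radB rad_cst in hr.
move: h; rewrite ler_norml => /andP[h1 h2]; lra.
Qed.

Let lin_gt (t u : R) : 0 < u ->
  (P [set w | (t < lin w)%R] <= (1 - rcdf (t - 3 * u) + clt_err u)%:E)%E.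
Proof.
move=> u0; have h := lin_swap (t - 3 * u) u0.
have p0 w : 0 <= f (t - 3 * u) u (lin w) by have /andP[] := f01 (t - 3 * u) u (lin w).
have := markov_R ltr01 p0 (Rf_int (t - 3 * u) u).
rewrite divr1 => hm.
apply: (@le_trans _ _ (P [set w | (1 <= f (t - 3 * u)%R u (lin w))%R])).
  apply: le_measure; rewrite ?inE.
  - exact: (measurable_set_gt (measurable_elin Xiid me)).
  - by apply: measurable_set_ge; apply/measurable_EFinP; exact: measurable_int (Rf_int _ _).
  - move=> w /= wt; rewrite /f step_ge3// ler_pdivlMr//; lra.
apply: (le_trans hm); rewrite lee_fin.
have hr : rcdf (t - 3 * u) <= rad (2 * sg / Num.sqrt n%:R) n (fun x => 1 - f (t - 3 * u) u x) 0.
  apply: rad_le => x; have /andP[h1 h2] := f01 (t - 3 * u) u x.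
  case: (leP x (t - 3 * u)) => hx /=; last lra.
  rewrite /f step_le0 ?subr0// pmulr_lle0 ?invr_gt0//; lra.
rewrite radB rad_cst in hr.
move: h; rewrite ler_norml => /andP[h1 h2]; lra.
Qed.

Let rem_tail (u : R) : 0 < u ->
  (P [set w | (u <= `|W w - lin w|)%R] <= (rem_err / u ^+ 2)%:E)%E.
Proof.
move=> u0; have [h1 h2] := vnorm_elin_sq Xiid mL Lsym Ldiag L2 LB me eM n0.
have := markov_R (exprn_gt0 2 u0) (fun w => sqr_ge0 (W w - lin w)) h1.2.
move=> hm; apply: (@le_trans _ _ (P [set w | (u ^+ 2 <= (W w - lin w) ^+ 2)%R])).
  apply: le_measure; rewrite ?inE.
  - by apply: measurable_set_ge; apply: measurableT_comp => //; exact: h1.1.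
  - by apply: measurable_set_ge; apply: measurable_funX; exact: h1.1.
  - move=> w /= wu; rewrite -[leRHS]real_normK ?num_real//.
    by rewrite lerXn2r ?nnegrE// ltW.
apply: (le_trans hm); rewrite lee_fin; apply: ler_wpM2r => //.
by rewrite invr_ge0 exprn_ge0// ltW.
Qed.

Let mW : measurable_fun [set: Omega] W.
Proof. exact: (measurable_vnorm Xiid c mL). Qed.
Let ml : measurable_fun [set: Omega] lin.
Proof. exact: (measurable_elin Xiid me). Qed.

Let m_rem (u : R) : measurable [set w | u <= `|W w - lin w|].
Proof.
apply: measurable_set_ge.
by apply: (measurableT_comp (@normr_measurable R setT)); exact: (measurable_funB mW ml).
Qed.

Lemma vnorm_cdf_le (t u : R) : 0 < u ->
  (P [set w | (W w <= t)%R] <= (rcdf (t + 4 * u) + cmp_err u)%:E)%E.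
Proof.
move=> u0.
apply: (@le_trans _ _ (P ([set w | (lin w <= t + u)%R] `|` [set w | (u <= `|W w - lin w|)%R]))).
  apply: le_measure; rewrite ?inE; [exact: (measurable_set_le mW)|apply: measurableU; [exact: (measurable_set_le ml)|exact: m_rem]|].
  move=> w /= wt; have [h|h] := leP u `|W w - lin w|; first by right.
  by left; move: h; rewrite ltr_norml => /andP[? ?]; lra.
apply: (le_trans (measureU2 _ _ _)); [exact: (measurable_set_le ml)|exact: m_rem|].
apply: (le_trans (leeD (lin_le (t + u) u0) (rem_tail u0))).
rewrite -EFinD lee_fin /cmp_err (_ : t + u + 3 * u = t + 4 * u); last by ring.
lra.
Qed.

Lemma vnorm_cdf_gt (t u : R) : 0 < u ->
  (P [set w | (t < W w)%R] <= (1 - rcdf (t - 4 * u) + cmp_err u)%:E)%E.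
Proof.
move=> u0.
apply: (@le_trans _ _ (P ([set w | (t - u < lin w)%R] `|` [set w | (u <= `|W w - lin w|)%R]))).
  apply: le_measure; rewrite ?inE; [exact: (measurable_set_gt mW)|apply: measurableU; [exact: (measurable_set_gt ml)|exact: m_rem]|].
  move=> w /= wt; have [h|h] := leP u `|W w - lin w|; first by right.
  by left; move: h; rewrite ltr_norml => /andP[? ?]; lra.
apply: (le_trans (measureU2 _ _ _)); [exact: (measurable_set_gt ml)|exact: m_rem|].
apply: (le_trans (leeD (lin_gt (t - u) u0) (rem_tail u0))).
rewrite -EFinD lee_fin /cmp_err (_ : t - u - 3 * u = t - 4 * u); last by ring.
lra.
Qed.

End comparison.

(** * The bootstrap world *)

Section uniform_nat.
Context (R : realType).

Definition unif (N : nat) : set nat -> \bar R :=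
  mscale (N.+1%:R^-1)%:nng (msum (fun i : nat => \d_i) N.+1).

HB.instance Definition _ N := Measure.on (unif N).

Lemma unifE N A : unif N A = (N.+1%:R^-1 * \sum_(i < N.+1) \1_A (i : nat))%:E.
Proof.
rewrite /unif /mscale /msum /= EFinM -sumEFin; congr (_ * _)%E.
Qed.

Lemma unifT N : unif N setT = 1%E.
Proof.
rewrite unifE (eq_bigr (fun=> 1)); last by move=> i _; rewrite indicT.
by rewrite sumr_const card_ord mulVf ?pnatr_eq0.
Qed.

HB.instance Definition _ N := Measure_isProbability.Build _ _ _ (unif N) (unifT N).

Lemma measurable_nat_fun d (S : measurableType d) (f : nat -> S) : measurable_fun setT f.
Proof. by []. Qed.

Lemma ge0_integral_unif N (f : nat -> R) : (forall i, 0 <= f i) ->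
  (\int[unif N]_i (f i)%:E = (N.+1%:R^-1 * \sum_(i < N.+1) f i)%:E)%E.
Proof.
move=> f0; rewrite /unif ge0_integral_mscale//=; last by move=> i _; rewrite lee_fin.
rewrite ge0_integral_measure_sum//; last by move=> i _; rewrite lee_fin.
rewrite EFinM -sumEFin; congr (_ * _)%E; apply: eq_bigr => i _.
by rewrite integral_dirac// diracT mul1e.
Qed.

Lemma integrable_unif N (f : nat -> R) : (unif N).-integrable setT (EFin \o f).
Proof.
apply/integrableP; split => //.
by rewrite (ge0_integral_unif N (f := fun i => `|f i|))// ltry.
Qed.

Lemma sqint_unif N (f : nat -> R) : sqint (unif N) f.
Proof. by split => //; exact: integrable_unif. Qed.

Lemma Rintegral_unif N (f : nat -> R) :
  \int[unif N]_i f i = N.+1%:R^-1 * \sum_(i < N.+1) f i.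
Proof.
have g0 i : 0 <= f i + `|f i| by have := ler_norm (- f i); rewrite normrN; lra.
transitivity (\int[unif N]_i ((f i + `|f i|) - `|f i|)).
  by apply: eq_Rintegral => i _; rewrite addrK.
rewrite RintegralB//; [|exact: integrable_unif|exact: integrable_unif].
rewrite /Rintegral (ge0_integral_unif N g0) (ge0_integral_unif N (f := fun i => `|f i|))//=.
by rewrite -mulrBr -sumrB; congr (_ * _); apply: eq_bigr => i _; rewrite addrK.
Qed.

Lemma measurable_nat2_fun d (S : measurableType d) (f : nat * nat -> S) :
  measurable_fun setT f.
Proof.
move=> _ B mB; rewrite setTI.
have -> : f @^-1` B = \bigcup_i \bigcup_j
   (if `[< B (f (i, j)) >] then [set i] `*` [set j] else set0).
  apply/seteqP; split => [[i j] Bij|[i j] [i' _ [j' _]]] /=.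
    by exists i => //; exists j => //; case: asboolP.
  by case: asboolP => // Bij [/= -> ->].
apply: bigcupT_measurable => i; apply: bigcupT_measurable => j.
by case: asboolP => // _; exact: measurableX.
Qed.

End uniform_nat.

Section bootstrap_iid.
Context (R : realType) (m : nat).
Local Notation n := m.+1.
Local Notation tup := (n.-tuple 'I_n).

(* The n^n index maps are enumerated by nat, which turns the bootstrap world into
   a probability space on nat, with IID draws from the uniform law on indices. *)
Definition dec (k : nat) : tup := nth [tuple ord0 | i < n] (enum {: tup}) k.

Definition ntup := (n ^ n).-1.

Lemma ntupE : ntup.+1 = #|{: tup}|.
Proof. by rewrite card_tuple card_ord /ntup prednK// expn_gt0. Qed.

Lemma sum_dec (F : tup -> R) : \sum_(k < ntup.+1) F (dec k) = \sum_s F s.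
Proof.
rewrite -[RHS]big_enum/= [RHS](big_nth [tuple ord0 | i < n]) big_mkord.
by rewrite -cardE -ntupE.
Qed.

Definition bidx (i : 'I_n) (k : nat) : nat := tnth (dec k) i.

Lemma bidx_iid : iid_fin (unif R ntup) (unif R m) bidx.
Proof.
split=> [i|A mA]; first exact: measurable_nat_fun.
rewrite [RHS](_ : _ = (\prod_i (n%:R^-1 * \sum_(k < n) (\1_(A i) (k : nat) : R)))%:E)%E; last first.
  by rewrite -prodEFin; apply: eq_bigr => i _; exact: unifE.
etransitivity; first exact: unifE.
congr (_%:E).
rewrite big_split /= prodr_const card_ord exprVn -natrX.
rewrite (_ : ntup.+1 = n ^ n)%N; last by rewrite ntupE card_tuple card_ord.
congr (_ * _).
transitivity (\sum_(k < ntup.+1) \prod_i (\1_(A i) (nat_of_ord (tnth (dec k) i)) : R)).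
  rewrite (_ : ntup.+1 = n ^ n)%N; last by rewrite ntupE card_tuple card_ord.
  apply: eq_bigr => k _; rewrite indicE.
  have [h|h] := boolP [forall i, `[< A i (bidx i k) >]].
    rewrite mem_set; last by move=> i _; exact/asboolP/(forallP h).
    by rewrite big1// => i _; rewrite indicE mem_set//; exact/asboolP/(forallP h).
  rewrite memNset; last by move=> hk; case/negP: h; apply/forallP => i; apply/asboolP/hk.
  move: h; rewrite negb_forall => /existsP[i /asboolP hi].
  by rewrite (bigD1 i)//= indicE memNset// mul0r.
rewrite (sum_dec (fun s => \prod_i (\1_(A i) (nat_of_ord (tnth s i)) : R))).
rewrite bigA_distr_bigA /=.
rewrite (reindex (fun f : {ffun 'I_n -> 'I_n} => [tuple f i | i < n])) /=.
  by apply: eq_bigr => f _; apply: eq_bigr => i _; rewrite tnth_mktuple.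
exists (fun s : tup => [ffun i => tnth s i]) => [f _|s _].
  by apply/ffunP => i; rewrite ffunE tnth_mktuple.
by apply: eq_from_tnth => i; rewrite tnth_mktuple ffunE.
Qed.

Lemma boot_probE d (x : n.-tuple 'rV[R]_d) (E : set (n.-tuple 'rV[R]_d)) :
  unif R ntup [set k | E (resample x (dec k))] = (boot_prob x E)%:E.
Proof.
rewrite unifE /boot_prob; congr (_%:E).
rewrite mulrC ntupE; congr (_ * _); rewrite -ntupE.
rewrite (sum_dec (fun s => \1_[set k | E (resample x k)] s : R)).
rewrite -sum1_card natr_sum [RHS]big_mkcond /=.
apply: eq_bigr => s _; rewrite indicE inE.
by case: ifP.
Qed.

End bootstrap_iid.

Section bootstrap_comparison.
Context (R : realType) (d : nat).
Local Notation rV := 'rV[R]_d.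
Implicit Types (L : rV -> rV -> R) (e : rV -> R).

Definition vst L n (x : n.-tuple rV) :=
  n%:R ^- 2 * \sum_i \sum_j L (tnth x i) (tnth x j).

Definition bsq L n (x : n.-tuple rV) :=
  n%:R ^- 2 * \sum_i \sum_j L (tnth x i) (tnth x j) ^+ 2.

Definition bbias L e n (x : n.-tuple rV) :=
  n%:R^-1 * \sum_i (n%:R^-1 * (\sum_j L (tnth x i) (tnth x j)) - e (tnth x i)) ^+ 2.

Definition bvar e n (x : n.-tuple rV) :=
  n%:R^-1 * (\sum_i e (tnth x i) ^+ 2) - (n%:R^-1 * \sum_i e (tnth x i)) ^+ 2.

Definition gen_err (M sg : R) n (v rho vr u : R) :=
  (64 * v / n%:R + 16 * rho + 16 * M ^+ 2 / n%:R ^+ 2) / u ^+ 2 +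
  (2 / u ^+ 2 * `|vr - sg ^+ 2| +
   4 / 3 / u ^+ 3 * (64 * M ^+ 3 + 8 * sg ^+ 3) / Num.sqrt n%:R).

Variables (L : rV -> rV -> R) (c M : R) (e : rV -> R) (sg : R).
Hypotheses (Lsym : forall x y, L x y = L y x) (Ldiag : forall x, L x x = c)
  (eM : forall x, `|e x| <= M) (sg0 : 0 < sg).
Variables (n : nat) (n0 : (0 < n)%N) (x : n.-tuple rV).

Definition bnorm (y : n.-tuple rV) :=
  Num.sqrt n%:R * (vst L y - c / n%:R - (1 - n%:R^-1) * vst L x).

Lemma boot_cdf (t u : R) : 0 < u ->
  rcdf n sg (t - 4 * u) - gen_err M sg n (bsq L x) (bbias L e x) (bvar e x) u
    <= boot_prob x [set y | bnorm y <= t] <=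
  rcdf n sg (t + 4 * u) + gen_err M sg n (bsq L x) (bbias L e x) (bvar e x) u.
Proof.
move=> u0.
rewrite /bnorm; case: n n0 x => // m _ xx.
pose p (i : nat) : rV := tnth xx (inord i).
pose L' i j := L (p i) (p j); pose e' i := e (p i).
pose Q := unif R m; pose P := unif R (ntup m).
have piv (i : 'I_m.+1) : p i = tnth xx i by rewrite /p inord_val.
have Lint i : \int[Q]_j (L' i j ^+ 2) <=
    \sum_(k < m.+1) m.+1%:R^-1 * \sum_(j < m.+1) L' k j ^+ 2.
  rewrite Rintegral_unif (_ : \sum_(j < m.+1) L' i j ^+ 2 =
     \sum_(j < m.+1) L' (@inord m i) j ^+ 2); last first.
    by apply: eq_bigr => j _; congr (L _ _ ^+ 2); rewrite piv.
  rewrite [leRHS](bigD1 (inord i))//= lerDl sumr_ge0// => k _.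
  by rewrite mulr_ge0 ?invr_ge0// sumr_ge0// => j _; exact: sqr_ge0.
have H := @bidx_iid R m.
have Lsym' i j : L' i j = L' j i by exact: Lsym.
have Ldiag' i : L' i i = c by exact: Ldiag.
have eM' i : `|e' i| <= M by exact: eM.
have L2' i := sqint_unif m (L' i).
have Eth : kmean Q L' = vst L xx.
  rewrite /kmean /kproj Rintegral_unif.
  under eq_bigr do rewrite Rintegral_unif.
  rewrite -mulr_sumr mulrA -invfM -expr2; congr (_ * _).
  by apply: eq_bigr => i _; apply: eq_bigr => j _; rewrite /L' !piv.
have Esq : ksq Q L' = bsq L xx.
  rewrite /ksq Rintegral_unif.
  under eq_bigr do rewrite Rintegral_unif.
  rewrite -mulr_sumr mulrA -invfM -expr2; congr (_ * _).
  by apply: eq_bigr => i _; apply: eq_bigr => j _; rewrite /L' !piv.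
have Ebi : kbias Q L' e' = bbias L e xx.
  rewrite /kbias /kproj Rintegral_unif; congr (_ * _); apply: eq_bigr => i _.
  rewrite Rintegral_unif /e' piv; congr ((_ * _ - _) ^+ 2).
  by apply: eq_bigr => j _; rewrite /L' !piv.
have Evr : evar Q e' = bvar e xx.
  rewrite /evar !Rintegral_unif /bvar; congr (_ * _ - (_ * _) ^+ 2);
  by apply: eq_bigr => i _; rewrite /e' piv.
have Ecmp : cmp_err Q m.+1 L' M e' sg u =
   gen_err M sg m.+1 (bsq L xx) (bbias L e xx) (bvar e xx) u.
  by rewrite /cmp_err /rem_err /clt_err /gen_err Esq Ebi Evr.
have EW k : vnorm Q (@bidx m) L' c k = Num.sqrt m.+1%:R *
    (vst L (resample xx (dec m k)) - c / m.+1%:R - (1 - m.+1%:R^-1) * vst L xx).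
  rewrite /vnorm Eth; congr (_ * (_ - _ - _)); rewrite /vstat /vst; congr (_ * _).
  apply: eq_bigr => i _; apply: eq_bigr => j _.
  by rewrite /L' /bidx !piv !tnth_mktuple.
have EP t' : P [set k | (vnorm Q (@bidx m) L' c k <= t')%R] =
    (boot_prob xx [set y | Num.sqrt m.+1%:R *
       (vst L y - c / m.+1%:R - (1 - m.+1%:R^-1) * vst L xx) <= t'])%:E.
  rewrite -(boot_probE xx); congr (P _); apply/seteqP; split => k /=; by rewrite EW.
have h1 := vnorm_cdf_le H (ltn0Sn m) (measurable_nat2_fun _) Lsym' Ldiag' L2' Lint
  (measurable_nat_fun e') eM' sg0 t u0.
have h2 := vnorm_cdf_gt H (ltn0Sn m) (measurable_nat2_fun _) Lsym' Ldiag' L2' Lint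
  (measurable_nat_fun e') eM' sg0 t u0.
rewrite Ecmp in h1 h2.
have e1 := EP t.
apply/andP; split; last by rewrite -lee_fin -e1.
have e2 : P [set k | (t < vnorm Q (@bidx m) L' c k)%R] =
    (1 - boot_prob xx [set y | Num.sqrt m.+1%:R *
       (vst L y - c / m.+1%:R - (1 - m.+1%:R^-1) * vst L xx) <= t])%:E.
  rewrite EFinB -e1 -probability_setC//; congr (P _).
  by apply/seteqP; split => k /=; [move=> h; rewrite leNgt h|move/negP; rewrite -ltNge].
have h3 : (P [set k | (t < vnorm Q (@bidx m) L' c k)%R] <= (1 - rcdf m.+1 sg (t - 4 * u) +
  gen_err M sg m.+1 (bsq L xx) (bbias L e xx) (bvar e xx) u)%:E)%E := h2.
move: h3; rewrite e2 lee_fin; lra.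
Qed.

End bootstrap_comparison.

(** * Moments of the data-dependent error terms *)

Section data_moments.
Context (d1 d2 : measure_display) (Omega : measurableType d1)
  (T : measurableType d2) (R : realType).
Variables (P : probability Omega R) (Q : probability T R).
Variables (n : nat) (n0 : (0 < n)%N) (X : 'I_n -> Omega -> T) (Xiid : iid_fin P Q X).
Variables (L : T -> T -> R) (c B M : R) (e : T -> R).
Hypotheses (mL : measurable_fun setT (fun z : T * T => L z.1 z.2))
  (Lsym : forall x y, L x y = L y x) (Ldiag : forall x, L x x = c)
  (L2 : forall x, sqint Q (L x)) (LB : forall x, \int[Q]_y (L x y ^+ 2) <= B)
  (me : measurable_fun [set: T] e) (eM : forall x, `|e x| <= M).
Local Notation r := (kproj Q L).
Local Notation v := (ksq Q L).

Let N0 : n%:R != 0 :> R. Proof. by rewrite pnatr_eq0 -lt0n. Qed.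
Let Np : 0 < n%:R :> R. Proof. by rewrite ltr0n. Qed.
Let r2 : sqint Q r := kproj_sqint mL L2 LB.
Let e2 : sqint Q e := sqint_bounded Q me eM.
Let v0 : 0 <= v.
Proof. by apply: le_trans (kmean_sq_le mL L2 LB); exact: sqr_ge0. Qed.

Lemma Lpair_sqint i j : sqint P (fun w => L (X i w) (X j w)).
Proof.
have [->|ij] := eqVneq i j; last exact: (pair_sqint Xiid mL L2 LB ij).1.
rewrite (_ : (fun w => _) = fun=> c); first exact: sqint_cst.
by apply/funext => w.
Qed.

Lemma sq_mean_moment :
  P.-integrable [set: Omega] (EFin \o (fun w =>
    n%:R ^- 2 * \sum_i \sum_j L (X i w) (X j w) ^+ 2)) /\
  \int[P]_w (n%:R ^- 2 * \sum_i \sum_j L (X i w) (X j w) ^+ 2) <= c ^+ 2 / n%:R + v.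
Proof.
have iL i j := (Lpair_sqint i j).2.
have iS : P.-integrable [set: Omega] (EFin \o (fun w => \sum_i \sum_j L (X i w) (X j w) ^+ 2)).
  by apply: integrableR_sum => i _; apply: integrableR_sum => j _; exact: iL.
split; first exact: integrableRZ.
rewrite RintegralZl// Rintegral_sumr; last first.
  by move=> i _; apply: integrableR_sum => j _; exact: iL.
have E i j : \int[P]_w (L (X i w) (X j w) ^+ 2) <= (if j == i then c ^+ 2 else 0) + v.
  have [->|ij] := eqVneq j i.
    under eq_Rintegral do rewrite Ldiag.
    by rewrite Rintegral_cstP lerDl.
  by rewrite (pair_sqint Xiid mL L2 LB _).2 ?add0r// eq_sym.
have -> : c ^+ 2 / n%:R + v = n%:R ^- 2 * \sum_(i < n) (c ^+ 2 + n%:R * v).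
  by rewrite sumr_const card_ord -(mulr_natl (c ^+ 2 + _)); field.
apply: ler_wpM2l; first by rewrite invr_ge0 exprn_ge0// ltW.
apply: ler_sum => i _; rewrite Rintegral_sumr//.
apply: le_trans (ler_sum _ (fun j _ => E i j)) _.
rewrite big_split /= -big_mkcond big_pred1_eq sumr_const card_ord.
by rewrite mulr_natl.
Qed.

Lemma row_moment i :
  sqint P (fun w => n%:R^-1 * (\sum_j L (X i w) (X j w)) - e (X i w)) /\
  \int[P]_w ((n%:R^-1 * (\sum_j L (X i w) (X j w)) - e (X i w)) ^+ 2) <=
    8 * (c ^+ 2 + v) / n%:R ^+ 2 + 16 * v / n%:R + 2 * kbias Q L e.
Proof.
pose fa w := n%:R^-1 * (c - r (X i w)).
pose Z j w := if j == i then 0 else L (X i w) (X j w) - r (X i w).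
pose fb w := n%:R^-1 * \sum_j Z j w.
pose fc w := r (X i w) - e (X i w).
have E : (fun w => n%:R^-1 * (\sum_j L (X i w) (X j w)) - e (X i w)) =
    (fun w => (fa w + fb w) + fc w).
  apply/funext => w; rewrite /fa /fb /fc.
  have -> : \sum_j L (X i w) (X j w) = c - r (X i w) + \sum_j Z j w + n%:R * r (X i w).
    rewrite (bigD1 i)//= Ldiag [in RHS](bigD1 i)//= /Z eqxx add0r.
    rewrite [X in _ = _ + X + _](eq_bigr (fun j => L (X i w) (X j w) - r (X i w))); last first.
      by move=> j /negbTE ->.
    rewrite sumrB sumr_const.
    have -> : #|[pred j : 'I_n | j != i]| = n.-1.
      by rewrite cardC1 card_ord.
    rewrite -(mulr_natl _ n.-1) (_ : n.-1%:R = n%:R - 1 :> R); first by ring.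
    by rewrite -subn1 natrB.
  by field.
have hr := iid_sqint Xiid i r2; have he := iid_sqint Xiid i e2.
have ha : sqint P fa by apply: sqintZ; apply: sqintB => //; exact: sqint_cst.
have hc : sqint P fc by exact: sqintB.
have hL j : sqint P (fun w => L (X i w) (X j w) - r (X i w)).
  by apply: sqintB => //; exact: Lpair_sqint.
have hZ j : sqint P (Z j).
  by rewrite /Z; case: eqP => // _; exact: sqint_cst.
have hb : sqint P fb by apply: sqintZ; exact: (@sqint_sum _ _ _ P _ _ _ Z).
have hab := sqintD ha hb.
have rv : \int[P]_w (r (X i w) ^+ 2) <= v.
  by rewrite (iid_Rintegral Xiid i r2.2); exact: (kproj_sq_le mL L2 LB).
have ba : \int[P]_w (fa w ^+ 2) <= 2 * (c ^+ 2 + v) / n%:R ^+ 2.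
  rewrite /fa; under eq_Rintegral do rewrite exprMn.
  rewrite RintegralZl//; last by apply: (sqintB _ hr).2; exact: sqint_cst.
  have h := Rintegral_sqD (sqint_cst P c) (sqintZ (-1) hr).
  have h' : \int[P]_w ((c - r (X i w)) ^+ 2) <= 2 * (c ^+ 2 + v).
    apply: le_trans (_ : _ <= 2 * c ^+ 2 + 2 * v) _; last by rewrite mulrDr.
    rewrite Rintegral_cstP in h.
    under eq_Rintegral do rewrite -mulN1r.
    apply: le_trans h _; rewrite lerD2l ler_wpM2l//.
    by under eq_Rintegral do rewrite mulN1r sqrrN.
  rewrite exprVn mulrC ler_wpM2r// invr_ge0 exprn_ge0// ltW.
have Zj j : \int[P]_w (Z j w ^+ 2) <= 4 * v.
  rewrite /Z; have [_|ji] := eqVneq j i.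
    by rewrite expr0n /= Rintegral_cstP mulr_ge0.
  have ij : i != j by rewrite eq_sym.
  have [h1 h2] := pair_sqint Xiid mL L2 LB ij.
  have h := Rintegral_sqD h1 (sqintZ (-1) hr).
  under eq_Rintegral do rewrite -mulN1r.
  apply: le_trans h _; rewrite h2.
  rewrite [leRHS](_ : _ = 2 * v + 2 * v); last by ring.
  rewrite lerD2l ler_wpM2l//.
  by under eq_Rintegral do rewrite mulN1r sqrrN.
have Zo j l : l != j -> \int[P]_w (Z j w * Z l w) = 0.
  move=> lj; rewrite /Z; have [_|ji] := eqVneq j i.
    by under eq_Rintegral do rewrite mul0r; rewrite Rintegral_cstP.
  have [_|li] := eqVneq l i.
    by under eq_Rintegral do rewrite mulr0; rewrite Rintegral_cstP.
  have ij : i != j by rewrite eq_sym.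
  have mLc (f g : g_sigma_algebraType (cyl X j) * T -> T) : measurable_fun setT f -> measurable_fun setT g ->
    measurable_fun setT (fun z => L (f z) (g z)).
    move=> mf mg; apply: (@measurableT_comp _ _ _ _ _ _ (fun z : T * T => L z.1 z.2) _ (fun s => (f s, g s))) => //.
    exact: measurable_fun_pair.
  have mXi := @measurable_rest_fst _ _ _ T n X j i ij.
  have mXl := @measurable_rest_fst _ _ _ T n X j l lj.
  apply: (iid_centered Xiid (l := j)
    (F := fun z => (L (X i z.1) z.2 - r (X i z.1)) * (L (X i z.1) (X l z.1) - r (X i z.1)))).
  - apply: measurable_funM; apply: measurable_funB.
    + by apply: mLc => //; exact: measurable_snd.
    + exact: (measurableT_comp (measurable_kproj Q mL) mXi).
    + exact: mLc.
    + exact: (measurableT_comp (measurable_kproj Q mL) mXi).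
  - exact: (sqint_mul (hL j) (hL l)).
  - move=> w /=; rewrite (_ : (fun y => _) =
      (fun y => (L (X i w) (X l w) - r (X i w)) * (L (X i w) y - r (X i w)))).
      apply: integrableRZ; apply: integrableRB; last exact: integrableR_cst.
      exact: sqint_integrable.
    by apply/funext => y; rewrite mulrC.
  - move=> w /=; transitivity (\int[Q]_y
      ((L (X i w) (X l w) - r (X i w)) * (L (X i w) y - r (X i w)))).
      by apply: eq_Rintegral => y _; rewrite mulrC.
    have iLw := sqint_integrable (L2 (X i w)).
    rewrite RintegralZl//; last by apply: integrableRB => //; exact: integrableR_cst.
    rewrite RintegralB//; last exact: integrableR_cst.
    by rewrite Rintegral_cstP subrr mulr0.
have bb : \int[P]_w (fb w ^+ 2) <= 4 * v / n%:R.
  rewrite /fb; under eq_Rintegral do rewrite exprMn.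
  rewrite RintegralZl//; last by apply: (@sqint_sum _ _ _ P _ _ _ Z _).2.
  rewrite (@Rintegral_sum_sq _ _ _ P _ Z)//.
  have -> : 4 * v / n%:R = n%:R^-1 ^+ 2 * \sum_(j < n) 4 * v.
    by rewrite sumr_const card_ord -mulr_natl; field.
  apply: ler_wpM2l; first exact: sqr_ge0.
  apply: ler_sum => j _; rewrite (bigD1 j)//= big1 ?addr0; last first.
    by move=> l lj; exact: Zo.
  by under eq_Rintegral do rewrite -expr2.
have bc : \int[P]_w (fc w ^+ 2) = kbias Q L e.
  exact: (iid_Rintegral Xiid i (sqintB r2 e2).2).
split; first by rewrite E; exact: sqintD.
have -> : \int[P]_w ((n%:R^-1 * (\sum_j L (X i w) (X j w)) - e (X i w)) ^+ 2) =
   \int[P]_w (((fa w + fb w) + fc w) ^+ 2).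
  by apply: eq_Rintegral => w _; rewrite (congr1 (fun f => f w) E).
apply: le_trans (Rintegral_sqD hab hc) _.
have h := Rintegral_sqD ha hb.
rewrite bc lerD2r.
have -> : 8 * (c ^+ 2 + v) / n%:R ^+ 2 + 16 * v / n%:R =
  2 * (2 * (2 * (c ^+ 2 + v) / n%:R ^+ 2) + 2 * (4 * v / n%:R)) by field.
apply: ler_wpM2l => //; apply: le_trans h _.
by apply: lerD; apply: ler_wpM2l.
Qed.

Lemma mean_dev_moment (q : T -> R) (A : R) : measurable_fun [set: T] q ->
  (forall x, `|q x| <= A) ->
  sqint P (fun w => n%:R^-1 * (\sum_i q (X i w)) - \int[Q]_x q x) /\
  \int[P]_w ((n%:R^-1 * (\sum_i q (X i w)) - \int[Q]_x q x) ^+ 2) <= A ^+ 2 / n%:R.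
Proof.
move=> mq qA; have hq := sqint_bounded Q mq qA; have iq := sqint_integrable hq.
pose q' x := q x - \int[Q]_y q y.
have hq' : sqint Q q' by apply: sqintB => //; exact: sqint_cst.
have q'0 : \int[Q]_x q' x = 0.
  by rewrite RintegralB// ?Rintegral_cstP ?subrr//; exact: integrableR_cst.
have hS : sqint P (fun w => \sum_i q' (X i w)).
  by apply: sqint_sum => i _; exact: (iid_sqint Xiid i hq').
have E : (fun w => n%:R^-1 * (\sum_i q (X i w)) - \int[Q]_x q x) =
    (fun w => n%:R^-1 * \sum_i q' (X i w)).
  apply/funext => w; rewrite sumrB sumr_const card_ord -(mulr_natl (\int[Q]_x q x)).
  by rewrite mulrBr mulKf.
split; first by rewrite E; exact: sqintZ.
have -> : \int[P]_w ((n%:R^-1 * (\sum_i q (X i w)) - \int[Q]_x q x) ^+ 2) =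
   \int[P]_w ((n%:R^-1 * \sum_i q' (X i w)) ^+ 2).
  by apply: eq_Rintegral => w _; rewrite (congr1 (fun f => f w) E).
under eq_Rintegral do rewrite exprMn.
rewrite RintegralZl//; last exact: hS.2.
rewrite (centered_sum_sq Xiid hq' q'0) exprVn expr2 invfM -mulrA mulKf// mulrC.
apply: ler_wpM2r; first by rewrite invr_ge0 ltW.
rewrite Rintegral_var// lerBlDr -[leLHS]addr0; apply: lerD; last exact: sqr_ge0.
rewrite -[leRHS](Rintegral_cstP Q); apply: le_Rintegral => //.
- exact: hq.2.
- exact: integrableR_cst.
- by move=> x _; rewrite -[leLHS]real_normK ?num_real// lerXn2r ?nnegrE// (le_trans _ (qA x)).
Qed.

End data_moments.

(** * Quantiles and coverage *)

Section quantile.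
Context (R : realType) (F : R -> R) (p : R).
Hypotheses (Fmono : forall s t, s <= t -> F s <= F t)
  (Fhi : exists s, p <= F s) (Flo : exists l, F l < p).
Definition qtl := inf [set s | p <= F s].

Let lb s : p <= F s -> forall l, F l < p -> l <= s.
Proof.
move=> ps l Fl; rewrite leNgt; apply/negP => sl.
by have := le_lt_trans (le_trans ps (Fmono (ltW sl))) Fl; rewrite ltxx.
Qed.

Let hi : has_inf [set s | p <= F s].
Proof.
split; first by case: Fhi => s ps; exists s.
by case: Flo => l Fl; exists l => s /= /lb; exact.
Qed.

Lemma qtl_le s : p <= F s -> qtl <= s.
Proof. by move=> ps; apply: ge_inf => //; exact: hi.2. Qed.

Lemma qtl_ge s : F s < p -> s <= qtl.
Proof. by move=> Fs; apply: lb_le_inf; [exact: hi.1|move=> t /= /lb; exact]. Qed.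

Lemma qtl_le_inv s t : qtl <= s -> s < t -> p <= F t.
Proof.
move=> qs st; rewrite leNgt; apply/negP => Ft.
by have := le_lt_trans (le_trans (qtl_ge Ft) qs) st; rewrite ltxx.
Qed.

Lemma qtl_ge_inv s t : s <= qtl -> t < s -> F t < p.
Proof.
move=> sq ts; rewrite ltNge; apply/negP => Ft.
by have := le_lt_trans (le_trans sq (qtl_le Ft)) ts; rewrite ltxx.
Qed.

End quantile.

Section outer_probability.
Context (d : measure_display) (Omega : measurableType d) (R : realType).
Variable P : probability Omega R.

Lemma mu_ext_measurable A : measurable A -> mu_ext P A = P A.
Proof. by move=> mA; rewrite measurable_mu_extE. Qed.

Lemma mu_extU A B : (mu_ext P (A `|` B) <= mu_ext P A + mu_ext P B)%E.
Proof. exact: outer_measureU2. Qed.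

End outer_probability.

Section coverage.
Context (d : measure_display) (Omega : measurableType d) (R : realType).
Variables (P : probability Omega R) (W : Omega -> R) (Good C : set Omega)
  (g : R -> R) (a b eta u om : R).
Hypotheses (mW : measurable_fun [set: Omega] W) (mGood : measurable Good)
  (PGood : (P (~` Good) <= eta%:E)%E)
  (gmono : forall s t, s <= t -> g s <= g t)
  (ghi : exists s, g s = 1) (glo : exists s, g s = 0)
  (gmod : forall t, g (t + 12 * u) <= g t + om)
  (u0 : 0 < u) (eta0 : 0 < eta) (a_eta : 3 * eta < a) (b_eta : 3 * eta < b)
  (ab1 : a + b < 1)
  (Wle : forall t, (P [set w | (W w <= t)%R] <= (g (t + 4 * u) + eta)%:E)%E)
  (Wgt : forall t, (P [set w | (t < W w)%R] <= (1 - g (t - 4 * u) + eta)%:E)%E)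
  (Cup : forall w, Good w -> C w -> b - eta <= g (W w + 6 * u) /\ g (W w - 6 * u) <= 1 - a + eta)
  (Clo : forall w, Good w -> b + eta <= g (W w - 6 * u) -> g (W w + 6 * u) < 1 - a - eta -> C w).

Let ghi' p : p < 1 -> exists s, p <= g s.
Proof. by move=> p1; case: ghi => s gs; exists s; rewrite gs ltW. Qed.
Let glo' p : 0 < p -> exists s, g s < p.
Proof. by move=> p0; case: glo => s gs; exists s; rewrite gs. Qed.

Let pr A := fine (P A).
Let prE A : measurable A -> P A = (pr A)%:E.
Proof. by move=> mA; rewrite /pr fineK// fin_num_measure. Qed.

Let mle t : measurable [set w | W w <= t]. Proof. exact: measurable_set_le. Qed.
Let mgt t : measurable [set w | t < W w]. Proof. exact: measurable_set_gt. Qed.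
Let mge t : measurable [set w | t <= W w]. Proof. exact: measurable_set_ge. Qed.
Let mlt t : measurable [set w | W w < t].
Proof.
rewrite (_ : [set w | _] = ~` [set w | t <= W w]); first exact: measurableC.
by apply/seteqP; split => w /=; [rewrite ltNge => /negP|move/negP; rewrite -ltNge].
Qed.

Let le_pr t : pr [set w | W w <= t] <= g (t + 4 * u) + eta.
Proof. by rewrite -lee_fin -prE. Qed.

Let ge_pr t : g (t - 4 * u) - eta <= pr [set w | W w <= t].
Proof.
have := Wgt t; rewrite (_ : [set w | t < W w] = ~` [set w | W w <= t]).
  by rewrite probability_setC// prE// -EFinB lee_fin; lra.
by apply/seteqP; split => w /=; [rewrite ltNge => /negP|move/negP; rewrite -ltNge].
Qed.

Lemma coverage_le : (mu_ext P C <= (1 - a - b + 6 * eta + 2 * om)%:E)%E.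
Proof.
have he := eta0; have ha := a_eta; have hb := b_eta; have hab := ab1; have hu := u0.
set p1 := b - eta; set p2 := 1 - a + 2 * eta.
have p1lo : 0 < p1 by rewrite /p1; lra.
have p1hi : p1 < 1 by rewrite /p1; lra.
have p2lo : 0 < p2 by rewrite /p2; lra.
have p2hi : p2 < 1 by rewrite /p2; lra.
set q1 := qtl g p1; set q2 := qtl g p2.
have q12 : q1 <= q2.
  rewrite leNgt; apply/negP => h.
  have h1 := qtl_ge_inv gmono (ghi' p1hi) (glo' p1lo) (lexx _) (_ : (q1 + q2) / 2 < q1).
  have h2 := qtl_le_inv gmono (ghi' p2hi) (glo' p2lo) (lexx _) (_ : q2 < (q1 + q2) / 2).
  have {}h1 : g ((q1 + q2) / 2) < p1 by apply: h1; lra.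
  have {}h2 : p2 <= g ((q1 + q2) / 2) by apply: h2; lra.
  by move: h1 h2; rewrite /p1 /p2; lra.
pose A := [set w | q1 - 6 * u <= W w] `&` [set w | W w <= q2 + 6 * u].
have mA : measurable A by exact: measurableI.
apply: (@le_trans _ _ (mu_ext P (A `|` ~` Good))).
  apply: le_mu_ext => w Cw; have [Gw|nG] := pselect (Good w); last by right.
  left; have [h1 h2] := Cup Gw Cw; split => /=.
    rewrite leNgt; apply/negP => h.
    have : g (W w + 6 * u) < p1.
      by apply: (qtl_ge_inv gmono (ghi' p1hi) (glo' p1lo) (lexx _)); rewrite -/q1; lra.
    by rewrite ltNge h1.
  rewrite leNgt; apply/negP => h.
  have : p2 <= g (W w - 6 * u).
    by apply: (qtl_le_inv gmono (ghi' p2hi) (glo' p2lo) (lexx _)); rewrite -/q2; lra.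
  by rewrite /p2; lra.
apply: (le_trans (mu_extU _ _ _)).
rewrite !mu_ext_measurable//; last exact: measurableC.
apply: (le_trans (leeD2l _ PGood)).
rewrite prE// -EFinD lee_fin.
have h1 : pr A + pr [set w | W w <= q1 - 7 * u] <= pr [set w | W w <= q2 + 6 * u].
  rewrite -lee_fin EFinD -!prE// -measureU//.
    apply: le_measure; rewrite ?inE//; first exact: measurableU.
    move=> w [[]//|/=]; lra.
  by apply/seteqP; split => // w [[/= h1 h2] h3]; lra.
have h2 := le_pr (q2 + 6 * u).
have h3 := ge_pr (q1 - 7 * u).
have h4 : g (q2 - 2 * u + 12 * u) <= g (q2 - 2 * u) + om by exact: gmod.
have h5 : g (q2 - 2 * u) < p2.
  by apply: (qtl_ge_inv gmono (ghi' p2hi) (glo' p2lo) (lexx _)); rewrite -/q2; lra.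
have h6 : g (q1 - 11 * u + 12 * u) <= g (q1 - 11 * u) + om by exact: gmod.
have h7 : p1 <= g (q1 - 11 * u + 12 * u).
  by apply: (qtl_le_inv gmono (ghi' p1hi) (glo' p1lo) (lexx _)); rewrite -/q1; lra.
rewrite (_ : q2 - 2 * u + 12 * u = q2 + 6 * u + 4 * u) in h4; last by ring.
rewrite (_ : q1 - 7 * u - 4 * u = q1 - 11 * u) in h3; last by ring.
by move: h5 h7; rewrite /p1 /p2; lra.
Qed.

Lemma coverage_ge : ((1 - a - b - 5 * eta - 2 * om)%:E <= mu_ext P C)%E.
Proof.
have he := eta0; have ha := a_eta; have hb := b_eta; have hab := ab1; have hu := u0.
set p1 := b + eta; set p2 := 1 - a - eta.
have p1lo : 0 < p1 by rewrite /p1; lra.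
have p1hi : p1 < 1 by rewrite /p1; lra.
have p2lo : 0 < p2 by rewrite /p2; lra.
have p2hi : p2 < 1 by rewrite /p2; lra.
set q1 := qtl g p1; set q2 := qtl g p2.
pose A := [set w | q1 + 6 * u < W w] `&` [set w | W w < q2 - 6 * u].
have mA : measurable A by exact: measurableI.
have h1 : (P A <= mu_ext P C + eta%:E)%E.
  apply: (@le_trans _ _ (mu_ext P (C `|` ~` Good))).
    rewrite -mu_ext_measurable//; apply: le_mu_ext => w [/= w1 w2].
    have [Gw|nG] := pselect (Good w); last by right.
    left; apply: Clo => //.
      by apply: (qtl_le_inv gmono (ghi' p1hi) (glo' p1lo) (lexx _)); rewrite -/q1; lra.
    by apply: (qtl_ge_inv gmono (ghi' p2hi) (glo' p2lo) (lexx _)); rewrite -/q2; lra.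
  apply: (le_trans (mu_extU _ _ _)); apply: leeD2l.
  by rewrite mu_ext_measurable//; exact: measurableC.
have h2 : pr [set w | W w <= q2 - 7 * u] <= pr A + pr [set w | W w <= q1 + 6 * u].
  rewrite -lee_fin EFinD -!prE//.
  apply: (@le_trans _ _ (P (A `|` [set w | W w <= q1 + 6 * u]))); last exact: measureU2.
  apply: le_measure; rewrite ?inE//; first exact: measurableU.
  move=> w /= h; have [h'|h'] := leP (W w) (q1 + 6 * u); first by right.
  by left; split => /=; lra.
have h3 := le_pr (q1 + 6 * u).
have h4 := ge_pr (q2 - 7 * u).
have h5 : g (q1 - 2 * u + 12 * u) <= g (q1 - 2 * u) + om by exact: gmod.
have h6 : g (q1 - 2 * u) < p1.
  by apply: (qtl_ge_inv gmono (ghi' p1hi) (glo' p1lo) (lexx _)); rewrite -/q1; lra.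
have h7 : g (q2 - 11 * u + 12 * u) <= g (q2 - 11 * u) + om by exact: gmod.
have h8 : p2 <= g (q2 - 11 * u + 12 * u).
  by apply: (qtl_le_inv gmono (ghi' p2hi) (glo' p2lo) (lexx _)); rewrite -/q2; lra.
rewrite (_ : q1 - 2 * u + 12 * u = q1 + 6 * u + 4 * u) in h5; last by ring.
rewrite (_ : q2 - 7 * u - 4 * u = q2 - 11 * u) in h4; last by ring.
have h9 : ((1 - a - b - 4 * eta - 2 * om)%:E <= P A)%E.
  by rewrite prE// lee_fin; move: h6 h8; rewrite /p1 /p2; lra.
have := le_trans h9 h1; rewrite -leeBlDr// -EFinB.
by apply: le_trans; rewrite lee_fin; lra.
Qed.

End coverage.

(** * Validity of percentile intervals for V-statistics *)

Lemma boot_prob_mono (R : realType) (d n : nat) (x : n.-tuple 'rV[R]_d)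
  (E F : set (n.-tuple 'rV[R]_d)) : E `<=` F -> boot_prob x E <= boot_prob x F.
Proof.
move=> EF; rewrite /boot_prob ler_wpM2r ?invr_ge0// ler_nat.
apply: subset_leq_card; apply/fintype.subsetP => s; rewrite !inE => h.
exact: EF.
Qed.

Lemma near_div_sqrt (R : realType) (k eps : R) : 0 < eps ->
  \forall n \near \oo, k / Num.sqrt n%:R <= eps.
Proof.
move=> e0; near=> n.
have n1 : (`|k| / eps) ^+ 2 + 1 <= n%:R by near: n; exact: nbhs_infty_ger.
have N0 : 0 < n%:R :> R by apply: lt_le_trans n1; rewrite ltr_wpDl ?sqr_ge0.
rewrite ler_pdivrMr ?sqrtr_gt0// mulrC -ler_pdivrMr//.
apply: (@le_trans _ _ (`|k| / eps)).
  by apply: ler_wpM2r; [rewrite invr_ge0 ltW|exact: ler_norm].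
rewrite -(ger0_norm (_ : 0 <= `|k| / eps)) ?divr_ge0 ?(ltW e0)//.
rewrite -sqrtr_sqr ler_sqrt; last exact: ltW.
by apply: le_trans n1; rewrite lerDl.
Unshelve. all: by end_near. Qed.

Lemma near_div_nat (R : realType) (k eps : R) : 0 < eps ->
  \forall n \near \oo, k / n%:R <= eps.
Proof.
move=> e0; near=> n.
have n1 : `|k| / eps + 1 <= n%:R by near: n; exact: nbhs_infty_ger.
have N0 : 0 < n%:R :> R by apply: lt_le_trans n1; rewrite ltr_wpDl// divr_ge0// ltW.
rewrite ler_pdivrMr// mulrC -ler_pdivrMr//.
apply: (@le_trans _ _ (`|k| / eps)).
  by apply: ler_wpM2r; [rewrite invr_ge0 ltW|exact: ler_norm].
by apply: le_trans n1; rewrite lerDl.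
Unshelve. all: by end_near. Qed.

Section bootstrap_sandwich.
Context (R : realType) (d n : nat).
Local Notation rV := 'rV[R]_d.
Variables (T : functional R d) (K : rV -> R) (h : R) (L : rV -> rV -> R) (c : R)
  (psi0 theta a b eta u : R) (g : R -> R) (x : n.-tuple rV).
Hypotheses (n0 : (0 < n)%N)
  (HT : forall y : n.-tuple rV, T (kde K h y) (empirical y) = vst L y)
  (gmono : forall s t, s <= t -> g s <= g t)
  (ghi : exists s, g s = 1) (glo : exists s, g s = 0)
  (u0 : 0 < u) (eta0 : 0 < eta) (a_eta : 3 * eta < a) (b_eta : 3 * eta < b)
  (ab1 : a + b < 1)
  (Gg : forall t, g (t - 4 * u) - eta <= boot_prob x [set y | bnorm L c x y <= t]
                  <= g (t + 4 * u) + eta).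

Let W := Num.sqrt n%:R * (vst L x - c / n%:R - (1 - n%:R^-1) * theta).
Let F (s : R) := boot_prob x [set y | vst L y - vst L x <= s].

Hypothesis tau_le :
  `|Num.sqrt n%:R * (theta - psi0) - theta / Num.sqrt n%:R
    + vst L x / Num.sqrt n%:R| <= u.

Let S0 : 0 < Num.sqrt n%:R :> R. Proof. by rewrite sqrtr_gt0 ltr0n. Qed.
Let SS : Num.sqrt n%:R ^+ 2 = n%:R :> R. Proof. by rewrite sqr_sqrtr. Qed.

Let FE s : F s = boot_prob x
  [set y | bnorm L c x y <= Num.sqrt n%:R * (s - c / n%:R + vst L x / n%:R)].
Proof.
rewrite /F; congr (boot_prob x _); apply/seteqP; split => y /=; rewrite /bnorm ler_pM2l//;
  have N0 : n%:R != 0 :> R by rewrite pnatr_eq0 -lt0n.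
  by rewrite mulrBl mul1r (mulrC n%:R^-1); lra.
by rewrite mulrBl mul1r (mulrC n%:R^-1); lra.
Qed.

Let Fmono s t : s <= t -> F s <= F t.
Proof. by move=> st; apply: boot_prob_mono => y /= /le_trans; exact. Qed.

Let sE t : exists s, Num.sqrt n%:R * (s - c / n%:R + vst L x / n%:R) = t.
Proof.
exists (t / Num.sqrt n%:R + c / n%:R - vst L x / n%:R).
rewrite (_ : _ - _ + _ = t / Num.sqrt n%:R); last by ring.
by rewrite mulrC divfK// gt_eqF.
Qed.

Let Fhi p : p < 1 - eta -> exists s, p <= F s.
Proof.
move=> p1; have [t gt] := ghi; have [s Es] := sE (t + 4 * u); exists s.
rewrite FE Es; have /andP[+ _] := Gg (t + 4 * u).
by rewrite addrK gt => H; rewrite (le_trans (ltW p1)).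
Qed.

Let Flo p : eta < p -> exists s, F s < p.
Proof.
move=> p1; have [t gt] := glo; have [s Es] := sE (t - 4 * u); exists s.
rewrite FE Es; have /andP[_ +] := Gg (t - 4 * u).
by rewrite subrK gt add0r => H; rewrite (le_lt_trans H).
Qed.

Let tau := Num.sqrt n%:R * (theta - psi0) - theta / Num.sqrt n%:R
    + vst L x / Num.sqrt n%:R.

Let FD k : F (vst L x - psi0 + k * u / Num.sqrt n%:R) =
  boot_prob x [set y | bnorm L c x y <= W + tau + k * u].
Proof.
rewrite FE; congr (boot_prob x _).
suff -> : Num.sqrt n%:R * (vst L x - psi0 + k * u / Num.sqrt n%:R - c / n%:R + vst L x / n%:R)
   = W + tau + k * u by [].
have s0 : Num.sqrt n%:R != 0 :> R by rewrite gt_eqF.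
have SS' := SS; rewrite /W /tau; set S := Num.sqrt n%:R in SS' s0 *; rewrite -SS'.
by field.
Qed.

Let Q p : boot_quantile T K h x p = qtl F p.
Proof.
rewrite /boot_quantile /qtl; congr inf; apply/funext => s; congr (is_true (_ <= _)).
by congr (boot_prob x _); apply/funext => y /=; rewrite !HT.
Qed.

Lemma boot_interval_up : boot_interval T K h a b x psi0 ->
  b - eta <= g (W + 6 * u) /\ g (W - 6 * u) <= 1 - a + eta.
Proof.
have he := eta0; have ha := a_eta; have hb := b_eta; have hab := ab1; have hu := u0.
have := tau_le; rewrite -/tau ler_norml => /andP[t1 t2].
rewrite /boot_interval !Q HT /= in_itv /= => /andP[h1 h2].
have b1 : b < 1 - eta by lra.
have b2 : eta < b by lra.
have a1 : 1 - a < 1 - eta by lra.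
have a2 : eta < 1 - a by lra.
have us : 0 < u / Num.sqrt n%:R by rewrite divr_gt0.
have k1 := qtl_le_inv Fmono (Fhi b1) (Flo b2) (s := vst L x - psi0)
  (t := vst L x - psi0 + 1 * u / Num.sqrt n%:R).
have k2 := qtl_ge_inv Fmono (Fhi a1) (Flo a2) (s := vst L x - psi0)
  (t := vst L x - psi0 + (-1) * u / Num.sqrt n%:R).
rewrite !FD in k1 k2.
have {}k1 : b <= boot_prob x [set y | bnorm L c x y <= W + tau + 1 * u].
  by apply: k1; [lra|rewrite mul1r ltrDl].
have {}k2 : boot_prob x [set y | bnorm L c x y <= W + tau + (-1) * u] < 1 - a.
  by apply: k2; [lra|rewrite mulN1r mulNr gtrBl].
have /andP[_ g1] := Gg (W + tau + 1 * u).
have /andP[g2 _] := Gg (W + tau + (-1) * u).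
have g3 : g (W + tau + 1 * u + 4 * u) <= g (W + 6 * u) by apply: gmono; lra.
have g4 : g (W - 6 * u) <= g (W + tau + -1 * u - 4 * u) by apply: gmono; lra.
by split; lra.
Qed.

Lemma boot_interval_lo : b + eta <= g (W - 6 * u) -> g (W + 6 * u) < 1 - a - eta ->
  boot_interval T K h a b x psi0.
Proof.
have he := eta0; have ha := a_eta; have hb := b_eta; have hab := ab1; have hu := u0.
have := tau_le; rewrite -/tau ler_norml => /andP[t1 t2] h1 h2.
have b1 : b < 1 - eta by lra.
have b2 : eta < b by lra.
have a1 : 1 - a < 1 - eta by lra.
have a2 : eta < 1 - a by lra.
have E := FD 0; rewrite !mul0r !addr0 in E.
have /andP[g1 g2] := Gg (W + tau).
have g3 : g (W + tau + 4 * u) <= g (W + 6 * u) by apply: gmono; lra.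
have g4 : g (W - 6 * u) <= g (W + tau - 4 * u) by apply: gmono; lra.
have k1 : qtl F b <= vst L x - psi0.
  by apply: (qtl_le Fmono (Fhi b1) (Flo b2)); rewrite E; lra.
have k2 : vst L x - psi0 <= qtl F (1 - a).
  by apply: (qtl_ge Fmono (Fhi a1) (Flo a2)); rewrite E; lra.
rewrite /boot_interval !Q HT /= in_itv /=; apply/andP; split; lra.
Qed.

End bootstrap_sandwich.

Lemma small_of_sum_sq (R : realType) (q x y z : R) : 0 <= x -> 0 <= y -> 0 <= q ->
  q ^+ 2 <= q -> x + y + z ^+ 2 <= q ^+ 2 -> [/\ x <= q, y <= q & `|z| <= q].
Proof.
move=> x0 y0 q0 qq s; have z0 := sqr_ge0 z; split; [lra|lra|].
by rewrite -(ger0_norm q0) -ler_sqr ?nnegrE// !real_normK ?num_real//; lra.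
Qed.

Section validity.
Context (R : realType) (d : nat) (dO : measure_display) (Omega : measurableType dO).
Local Notation rV := 'rV[R]_d.
Variables (P : probability Omega R) (P0 : probability rV R) (X : nat -> {RV P >-> rV}).
Hypothesis X_iid : iid_sample X P0.

Lemma iid_sample_fin n : iid_fin P P0 (fun i : 'I_n => X i : Omega -> rV).
Proof.
split=> [i|A mA]; first exact: measurable_funPT.
pose A' k := if insub k is Some i then A i else setT.
have A'E (i : 'I_n) : A' i = A i by rewrite /A' valK.
have mA' k : measurable (A' k) by rewrite /A'; case: insub.
have := X_iid.2 (iota 0 n) A' (iota_uniq 0 n) mA'.
rewrite (_ : \big[setI/setT]_(i <- iota 0 n) (X i @^-1` A' i) =
             \bigcap_(i in [set: 'I_n]) (X i @^-1` A i)); last first.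
  rewrite -[iota 0 n](_ : index_iota 0 n = _); last by rewrite /index_iota subn0.
  rewrite big_mkord -(bigcap_mkord n (fun i => X i @^-1` A' i)).
  apply/seteqP; split => w /= Aw; first by move=> i _ /=; rewrite -A'E; exact: (Aw i (ltn_ord i)).
  by move=> k kn; have := Aw (Ordinal kn) I; rewrite /= -A'E.
move=> ->.
rewrite -[iota 0 n](_ : index_iota 0 n = _); last by rewrite /index_iota subn0.
rewrite big_mkord; apply: eq_bigr => i _; rewrite A'E.
exact: (X_iid.1 i (A i) (mA i)).
Qed.

Variables (L : nat -> rV -> rV -> R) (c B : nat -> R) (M sg : R) (e : rV -> R).
Hypotheses (mL : forall n, measurable_fun setT (fun z : rV * rV => L n z.1 z.2))
  (Lsym : forall n x y, L n x y = L n y x) (Ldiag : forall n x, L n x x = c n)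
  (L2 : forall n x, sqint P0 (L n x)) (LB : forall n x, \int[P0]_y (L n x y ^+ 2) <= B n)
  (me : measurable_fun [set: rV] e) (eM : forall x, `|e x| <= M)
  (sg0 : 0 < sg) (evE : evar P0 e = sg ^+ 2).

Definition data_err n (w : Omega) :=
  bsq (L n) (sample X n w) / n%:R + bbias (L n) e (sample X n w) +
  (bvar e (sample X n w) - sg ^+ 2) ^+ 2.

Lemma ksq_leB n : ksq P0 (L n) <= B n.
Proof.
rewrite -[leRHS](Rintegral_cstP P0); apply: le_Rintegral => //.
- apply: (@integrableR_bounded _ _ _ _ _ (B n)) => [|x].
    apply: (measurable_Rintegral_param P0 (F := fun z => L n z.1 z.2 ^+ 2)).
    exact: measurable_funX.
  by rewrite ger0_norm ?Rintegral_sq_ge0.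
- exact: integrableR_cst.
Qed.

Lemma data_err_ge0 n w : 0 <= data_err n w.
Proof.
rewrite /data_err /bsq /bbias addr_ge0 ?sqr_ge0// addr_ge0//.
  rewrite divr_ge0// mulr_ge0 ?invr_ge0 ?exprn_ge0// sumr_ge0// => i _.
  by rewrite sumr_ge0// => j _; exact: sqr_ge0.
by rewrite mulr_ge0 ?invr_ge0// sumr_ge0// => i _; exact: sqr_ge0.
Qed.

Lemma data_err_moment n : (0 < n)%N ->
  P.-integrable [set: Omega] (EFin \o data_err n) /\
  \int[P]_w data_err n w <=
    9 * (c n / n%:R) ^+ 2 + 25 * (B n / n%:R) + 2 * kbias P0 (L n) e + 10 * M ^+ 4 / n%:R.
Proof.
move=> n0; have H := iid_sample_fin n.
have N0 : n%:R != 0 :> R by rewrite pnatr_eq0 -lt0n.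
have Np : 0 < n%:R :> R by rewrite ltr0n.
have tS w i : tnth (sample X n w) i = X i w by rewrite tnth_mktuple.
have M0 : 0 <= M by exact: le_trans (eM point).
pose f1 w := n%:R^-1 * (n%:R ^- 2 * \sum_(i < n) \sum_(j < n) L n (X i w) (X j w) ^+ 2).
pose f2i (i : 'I_n) w := (n%:R^-1 * (\sum_(j < n) L n (X i w) (X j w)) - e (X i w)) ^+ 2.
pose f2 w := n%:R^-1 * \sum_(i < n) f2i i w.
pose A w := n%:R^-1 * (\sum_(i < n) e (X i w) ^+ 2) - \int[P0]_x (e x ^+ 2).
pose D w := n%:R^-1 * (\sum_(i < n) e (X i w)) - \int[P0]_x e x.
pose f3 w := (A w - D w * (D w + 2 * \int[P0]_x e x)) ^+ 2.
have E : data_err n = (fun w => f1 w + f2 w + f3 w).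
  apply/funext => w; rewrite /data_err /f1 /f2 /f3; congr (_ + _ + _ ^+ 2).
  - rewrite mulrC; congr (_ * (_ * _)); apply: eq_bigr => i _; apply: eq_bigr => j _.
    by rewrite !tS.
  - congr (_ * _); apply: eq_bigr => i _; rewrite tS; congr ((_ * _ - _) ^+ 2).
    by apply: eq_bigr => j _; rewrite tS.
  - rewrite -evE /evar /bvar /A /D.
    have s1 : \sum_(i < n) e (tnth (sample (fun k => X k) n w) i) ^+ 2 =
      \sum_(i < n) e (X i w) ^+ 2 by apply: eq_bigr => i _; rewrite tS.
    have s2 : \sum_(i < n) e (tnth (sample (fun k => X k) n w) i) =
      \sum_(i < n) e (X i w) by apply: eq_bigr => i _; rewrite tS.
    by rewrite s1 s2; ring.
have [i1 b1] := sq_mean_moment n0 H (mL n) (Ldiag n) (L2 n) (LB n).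
have r2 i := row_moment n0 H (mL n) (Ldiag n) (L2 n) (LB n) me eM i.
have i2 (i : 'I_n) : P.-integrable [set: Omega] (EFin \o f2i i) by case: (r2 i) => -[].
have me2 : measurable_fun [set: rV] (fun x => e x ^+ 2) by exact: measurable_funX.
have eM2 x : `|e x ^+ 2| <= M ^+ 2 by rewrite normrX lerXn2r// nnegrE.
have [hA bA] := mean_dev_moment n0 H me2 eM2.
have [hD bD] := mean_dev_moment n0 H me eM.
have if1 : P.-integrable [set: Omega] (EFin \o f1) by exact: integrableRZ.
have if2 : P.-integrable [set: Omega] (EFin \o f2).
  by apply: integrableRZ; apply: integrableR_sum.
have ub : P.-integrable [set: Omega] (EFin \o (fun w => 2 * A w ^+ 2 + 2 * ((2 * M) ^+ 2 * D w ^+ 2))).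
  by apply: integrableRD; [apply: integrableRZ; exact: hA.2|
    apply: integrableRZ; apply: integrableRZ; exact: hD.2].
have mD : measurable_fun [set: Omega] D := hD.1.
have mA : measurable_fun [set: Omega] A := hA.1.
have mf3 : measurable_fun [set: Omega] f3.
  apply: measurable_funX; apply: measurable_funB => //; apply: measurable_funM => //.
  by apply: measurable_funD => //; exact: measurable_cst.
have emM : `|\int[P0]_x e x| <= M.
  have ie := sqint_integrable (sqint_bounded P0 me eM).
  apply: (le_trans (le_normr_Rintegral measurableT ie)).
  rewrite -[leRHS](Rintegral_cstP P0); apply: le_Rintegral => //.
  - exact: (integrable_abse ie).
  - exact: integrableR_cst.
have f3le w : f3 w <= 2 * A w ^+ 2 + 2 * ((2 * M) ^+ 2 * D w ^+ 2).
  have DM : `|D w + 2 * \int[P0]_x e x| <= 2 * M.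
    rewrite (_ : D w + _ = n%:R^-1 * (\sum_(i < n) e (X i w)) + \int[P0]_x e x); last first.
      by rewrite /D; ring.
    apply: le_trans (ler_normD _ _) _; rewrite mulrDl mul1r; apply: lerD => //.
    rewrite normrM ger0_norm ?invr_ge0// mulrC ler_pdivrMr//.
    apply: le_trans (ler_norm_sum _ _ _) _.
    apply: (@le_trans _ _ (\sum_(i < n) M)); first by apply: ler_sum => i _; exact: eM.
    by rewrite sumr_const card_ord mulr_natr.
  have h1 : (D w * (D w + 2 * \int[P0]_x e x)) ^+ 2 <= (2 * M) ^+ 2 * D w ^+ 2.
    rewrite exprMn mulrC ler_wpM2r ?sqr_ge0//.
    by rewrite -[leLHS]real_normK ?num_real// lerXn2r ?nnegrE// mulr_ge0.
  have h2 := sqr_ge0 (A w + D w * (D w + 2 * \int[P0]_x e x)).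
  rewrite /f3; move: h1 h2; set z := D w * _; rewrite !expr2 => h1 h2; nra.
have if3 : P.-integrable [set: Omega] (EFin \o f3).
  apply: integrableR_le ub => // w; rewrite ger0_norm ?f3le//; exact: sqr_ge0.
split; first by rewrite E; apply: integrableRD => //; exact: integrableRD.
rewrite E RintegralD//; last exact: integrableRD.
rewrite RintegralD//.
have B0 : 0 <= B n by apply: le_trans (LB n point); exact: Rintegral_sq_ge0.
have vB := ksq_leB n.
have N1 : 1 <= n%:R :> R by rewrite ler1n.
have I0 : 0 <= n%:R^-1 :> R by rewrite invr_ge0.
have I1 : n%:R^-1 <= 1 :> R by rewrite invf_le1.
have c1 : \int[P]_w f1 w <= (c n / n%:R) ^+ 2 + B n / n%:R.
  rewrite /f1 RintegralZl//.
  have -> : (c n / n%:R) ^+ 2 + B n / n%:R = n%:R^-1 * (c n ^+ 2 / n%:R + B n) by field.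
  by apply: ler_wpM2l => //; apply: le_trans b1 _; rewrite lerD2l.
have c2 : \int[P]_w f2 w <= 8 * (c n / n%:R) ^+ 2 + 24 * (B n / n%:R) + 2 * kbias P0 (L n) e.
  rewrite /f2 RintegralZl//; last exact: integrableR_sum.
  rewrite Rintegral_sumr//.
  apply: (@le_trans _ _ (n%:R^-1 * \sum_(i < n)
     (8 * (c n / n%:R) ^+ 2 + 24 * (B n / n%:R) + 2 * kbias P0 (L n) e))); last first.
    by rewrite sumr_const card_ord -[X in _ * X]mulr_natl mulKf.
  apply: ler_wpM2l => //; apply: ler_sum => i _; apply: le_trans (r2 i).2 _.
  rewrite lerD2r.
  have -> : 8 * (c n ^+ 2 + ksq P0 (L n)) / n%:R ^+ 2 =
     8 * (c n / n%:R) ^+ 2 + 8 * (ksq P0 (L n) * n%:R^-1) * n%:R^-1 by field.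
  have k0 : 0 <= ksq P0 (L n).
    by apply: Rintegral_ge0 => x _; exact: Rintegral_sq_ge0.
  have k1 : ksq P0 (L n) * n%:R^-1 <= B n * n%:R^-1 by apply: ler_wpM2r.
  have k2 : 0 <= ksq P0 (L n) * n%:R^-1 by rewrite mulr_ge0.
  have k3 : 8 * (ksq P0 (L n) * n%:R^-1) * n%:R^-1 <= 8 * (ksq P0 (L n) * n%:R^-1).
    by rewrite -[leRHS]mulr1 ler_wpM2l// mulr_ge0.
  lra.
have c3 : \int[P]_w f3 w <= 10 * M ^+ 4 / n%:R.
  apply: (@le_trans _ _ (\int[P]_w (2 * A w ^+ 2 + 2 * ((2 * M) ^+ 2 * D w ^+ 2)))).
    by apply: le_Rintegral.
  rewrite RintegralD//; last 2 first.
  - by apply: integrableRZ; exact: hA.2.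
  - by apply: integrableRZ; apply: integrableRZ; exact: hD.2.
  rewrite !RintegralZl//; last 3 first.
  - exact: hA.2.
  - exact: hD.2.
  - by apply: integrableRZ; exact: hD.2.
  have -> : 10 * M ^+ 4 / n%:R = 2 * ((M ^+ 2) ^+ 2 / n%:R) + 2 * ((2 * M) ^+ 2 * (M ^+ 2 / n%:R)).
    by field.
  apply: lerD; apply: ler_wpM2l => //; apply: ler_wpM2l => //; exact: sqr_ge0.
lra.
Qed.


Lemma vst_le n (x : n.-tuple rV) : (0 < n)%N ->
  `|vst (L n) x| <= M + 1 + bbias (L n) e x.
Proof.
move=> n0; have N0 : 0 < n%:R :> R by rewrite ltr0n.
pose row i := n%:R^-1 * (\sum_j L n (tnth x i) (tnth x j)).
have -> : vst (L n) x = n%:R^-1 * \sum_i row i.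
  by rewrite /vst /row -mulr_sumr mulrA -invfM -expr2.
have hr i : `|row i| <= M + 1 + (row i - e (tnth x i)) ^+ 2.
  have h1 := eM (tnth x i); have h2 := ler_normD (row i - e (tnth x i)) (e (tnth x i)).
  rewrite subrK in h2; have h3 := sqr_ge0 (`|row i - e (tnth x i)| - 1).
  have h4 := real_normK (num_real (row i - e (tnth x i))).
  rewrite -h4; move: h1 h2 h3; set p := `|row i - _|; set r := `|row i|; set s := `|e _|.
  by rewrite !expr2 => h1 h2 h3; nra.
rewrite normrM ger0_norm ?invr_ge0 ?(ltW N0)//.
have -> : M + 1 + bbias (L n) e x =
    n%:R^-1 * \sum_i (M + 1 + (row i - e (tnth x i)) ^+ 2).
  rewrite big_split /= mulrDr; congr (_ + _).
  by rewrite sumr_const card_ord -[(M + 1) *+ n]mulr_natl mulKf// gt_eqF.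
apply: ler_wpM2l; first by rewrite invr_ge0 ltW.
by apply: (le_trans (ler_norm_sum _ _ _)); exact: ler_sum.
Qed.

Lemma gen_err_le (q u eta : R) n v rho vr : 0 < u -> 164 * q <= eta * u ^+ 2 ->
  v / n%:R <= q -> rho <= q -> `|vr - sg ^+ 2| <= q ->
  (16 * M ^+ 2 / u ^+ 2) / n%:R <= eta / 4 ->
  (4 / 3 / u ^+ 3 * (64 * M ^+ 3 + 8 * sg ^+ 3)) / Num.sqrt n%:R <= eta / 4 ->
  gen_err M sg n v rho vr u <= eta.
Proof.
move=> u0 qe h1 h2 h3 h4 h5; rewrite /gen_err.
have u2 : 0 < u ^+ 2 by exact: exprn_gt0.
have N : 16 * M ^+ 2 / n%:R ^+ 2 / u ^+ 2 <= eta / 4.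
  apply: le_trans h4; rewrite mulrAC; apply: ler_wpM2l.
    by apply: divr_ge0; [apply: mulr_ge0 => //; exact: sqr_ge0|exact: ltW].
  case: n {h1 h5} => [|n]; first by rewrite expr0n/= invr0.
  by rewrite lef_pV2 ?posrE ?exprn_gt0// ler_eXnr// ler1n.
have Q : 82 * q / u ^+ 2 <= eta / 2.
  by rewrite ler_pdivrMr//; lra.
have V : 64 * v / n%:R / u ^+ 2 + 16 * rho / u ^+ 2 + 2 / u ^+ 2 * `|vr - sg ^+ 2|
    <= 82 * q / u ^+ 2.
  have -> : 64 * v / n%:R / u ^+ 2 + 16 * rho / u ^+ 2 + 2 / u ^+ 2 * `|vr - sg ^+ 2|
    = (64 * (v / n%:R) + 16 * rho + 2 * `|vr - sg ^+ 2|) / u ^+ 2 by ring.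
  by rewrite ler_pM2r ?invr_gt0//; lra.
move: Q V N h5; set e3 := 16 * M ^+ 2 / _ / _; set D := _ / Num.sqrt _.
set z := 82 * q / _ => Q V N h5.
rewrite (_ : _ + _ = 64 * v / n%:R / u ^+ 2 + 16 * rho / u ^+ 2 +
  2 / u ^+ 2 * `|vr - sg ^+ 2| + e3 + D); last by rewrite /e3; ring.
move: V; set y := _ + 2 / _ * _ => V.
lra.
Qed.

Variables (T : functional R d) (K : rV -> R) (h : nat -> R) (psi0 : R).
Hypotheses (HT : forall n (y : n.-tuple rV), (0 < n)%N ->
    T (kde K (h n) y) (empirical y) = vst (L n) y)
  (c_lim : c n / n%:R @[n --> \oo] --> 0) (B_lim : B n / n%:R @[n --> \oo] --> 0)
  (bias_lim : kbias P0 (L n) e @[n --> \oo] --> 0)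
  (mean_lim : Num.sqrt n%:R * (kmean P0 (L n) - psi0) @[n --> \oo] --> 0).

Lemma near_small (v : nat -> R) (r : R) : 0 < r -> v n @[n --> \oo] --> 0 ->
  \forall n \near \oo, `|v n| <= r.
Proof.
move=> r0 /cvgr0Pnorm_le; exact.
Qed.

Lemma asymptotic_coverage (a b eta : R) : 0 < eta -> 3 * eta < a -> 3 * eta < b ->
  a + b < 1 -> \forall n \near \oo,
  ((1 - a - b - 7 * eta)%:E <=
    mu_ext P [set w | boot_interval T K (h n) a b (sample X n w) psi0] <=
   (1 - a - b + 8 * eta)%:E)%E.
Proof.
move=> eta0 ha hb hab; have sg0' := sg0.
pose u := eta * sg / 12; have u0 : 0 < u by rewrite /u divr_gt0// mulr_gt0.
pose q := Num.min 1 (eta * u ^+ 2 / 164).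
have q0 : 0 < q by rewrite /q lt_min ltr01 divr_gt0// mulr_gt0// exprn_gt0.
have q1 : q <= 1 by rewrite /q ge_min lexx.
have qe : 164 * q <= eta * u ^+ 2.
  by rewrite mulrC -ler_pdivlMr// /q ge_min lexx orbT.
have qq : q ^+ 2 <= q by rewrite expr2 ler_piMl// ltW.
have M0 : 0 <= M by exact: le_trans (eM point).
pose r := Num.min (eta * q ^+ 2 / 40) q.
have r0 : 0 < r by rewrite /r lt_min q0 divr_gt0// mulr_gt0// exprn_gt0.
have r1 : 40 * r <= eta * q ^+ 2.
  by rewrite mulrC -ler_pdivlMr// /r ge_min lexx.
have rq : r <= q by rewrite /r ge_min lexx orbT.
near=> n.
have n0 : (0 < n)%N by near: n; exact: nbhs_infty_gt.
have N0 : 0 < n%:R :> R by rewrite ltr0n.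
have S0 : 0 < Num.sqrt n%:R :> R by rewrite sqrtr_gt0.
have S1 : 1 <= Num.sqrt n%:R :> R by rewrite -[leLHS]sqrtr1 ler_sqrt// ler1n.
have nc : `|c n / n%:R| <= r by near: n; exact: near_small.
have nB : `|B n / n%:R| <= r by near: n; exact: near_small.
have nb : `|kbias P0 (L n) e| <= r by near: n; exact: near_small.
have nM4 : 10 * M ^+ 4 / n%:R <= r by near: n; exact: near_div_nat.
have nE1 : (16 * M ^+ 2 / u ^+ 2) / n%:R <= eta / 4.
  by near: n; apply: near_div_nat; rewrite divr_gt0.
have nE2 : (4 / 3 / u ^+ 3 * (64 * M ^+ 3 + 8 * sg ^+ 3)) / Num.sqrt n%:R <= eta / 4.
  by near: n; apply: near_div_sqrt; rewrite divr_gt0.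
have nt1 : `|Num.sqrt n%:R * (kmean P0 (L n) - psi0)| <= Num.min 1 (u / 2).
  by near: n; apply: near_small => //; rewrite lt_min ltr01 divr_gt0.
have nt2 : (`|psi0| + 1 + (M + 2)) / Num.sqrt n%:R <= u / 2.
  by near: n; apply: near_div_sqrt; rewrite divr_gt0.
have nom : 1 / Num.sqrt n%:R <= eta / 4.
  by near: n; apply: near_div_sqrt; rewrite divr_gt0.
have H := iid_sample_fin n.
pose W := vnorm P0 (fun i : 'I_n => X i : Omega -> rV) (L n) (c n).
pose g := rcdf n sg.
have sn0 : 0 < 2 * sg / Num.sqrt n%:R by rewrite divr_gt0// mulr_gt0.
have gmono s t : s <= t -> g s <= g t by exact: rad_cdf_mono.
have ghi : exists s, g s = 1.
  by eexists; apply: rad_cdf_hi; [exact: ltW|exact: lexx].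
have glo : exists s, g s = 0.
  exists (- (2 * sg / Num.sqrt n%:R * n%:R) - 1); apply: rad_cdf_lo; first exact: ltW.
  by rewrite ltrBlDr ltrDl.
have gmod t : g (t + 12 * u) <= g t + eta.
  have u12 : 0 <= 12 * u by rewrite mulr_ge0// ltW.
  have := rad_cdf_modulus t sn0 n0 u12; rewrite -/(rcdf n sg _) -/(rcdf n sg _) -/g.
  have -> : (12 * u / (2 * (2 * sg / Num.sqrt n%:R)) + 1) / Num.sqrt n%:R =
     eta / 4 + 1 / Num.sqrt n%:R by rewrite /u; field; rewrite !gt_eqF.
  by lra.
have [iE bE] := data_err_moment n0.
have bE' : \int[P]_w data_err n w <= 40 * r.
  apply: (le_trans bE).
  have nc2 : (c n / n%:R) ^+ 2 <= r.
    rewrite -real_normK ?num_real//; apply: (le_trans _ nc); rewrite expr2 ler_piMr//.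
    by apply: (le_trans nc); apply: (le_trans rq).
  move: nc2 (le_trans (ler_norm _) nB) (le_trans (ler_norm _) nb) nM4.
  by lra.
pose Good := [set w | data_err n w < q ^+ 2].
have mG : measurable Good.
  rewrite (_ : Good = ~` [set w | q ^+ 2 <= data_err n w]).
    apply: measurableC; apply: measurable_set_ge.
    by apply/measurable_EFinP; exact: measurable_int iE.
  by apply/seteqP; split => w /=; rewrite /Good/=; [rewrite ltNge => /negP|move/negP; rewrite -ltNge].
have PG : (P (~` Good) <= eta%:E)%E.
  rewrite (_ : ~` Good = [set w | (q ^+ 2 <= data_err n w)%R]); last first.
    by apply/seteqP; split => w /=; rewrite /Good/=; [move/negP; rewrite -leNgt|rewrite leNgt => /negP].
  apply: le_trans (markov_R (exprn_gt0 2 q0) (data_err_ge0 n) iE) _.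
  rewrite lee_fin ler_pdivrMr ?exprn_gt0//; exact: le_trans r1.
have GoodE w : Good w -> [/\ bsq (L n) (sample X n w) / n%:R <= q,
   bbias (L n) e (sample X n w) <= q & `|bvar e (sample X n w) - sg ^+ 2| <= q].
  rewrite /Good /= /data_err; set x := sample _ n w => hx.
  have x1 : 0 <= bsq (L n) x / n%:R.
    rewrite divr_ge0// mulr_ge0 ?invr_ge0 ?exprn_ge0// sumr_ge0// => i _.
    by rewrite sumr_ge0// => j _; exact: sqr_ge0.
  have x2 : 0 <= bbias (L n) e x.
    by rewrite mulr_ge0 ?invr_ge0// sumr_ge0// => i _; exact: sqr_ge0.
  exact: (small_of_sum_sq x1 x2 (ltW q0) qq (ltW hx)).
have cmpE : cmp_err P0 n (L n) M e sg u <= eta.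
  apply: (gen_err_le u0 qe) => //.
  - apply: (@le_trans _ _ (B n / n%:R)); first by rewrite ler_pM2r ?invr_gt0// ksq_leB.
    by apply: le_trans (le_trans (ler_norm _) nB) rq.
  - by apply: le_trans (le_trans (ler_norm _) nb) rq.
  - by rewrite evE subrr normr0 ltW.
have Gg w : Good w -> forall t, g (t - 4 * u) - eta <=
    boot_prob (sample X n w) [set y | bnorm (L n) (c n) (sample X n w) y <= t]
      <= g (t + 4 * u) + eta.
  move=> /GoodE[g1 g2 g3] t; set x := sample _ n w in g1 g2 g3 *.
  have := boot_cdf (Lsym n) (Ldiag n) eM sg0 n0 x t u0.
  have := gen_err_le u0 qe g1 g2 g3 nE1 nE2.
  move=> hz /andP[h1 h2]; apply/andP; split.
    by apply: le_trans h1; rewrite lerD2l lerN2.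
  by apply: (le_trans h2); rewrite lerD2l.
have tauE w : Good w ->
  `|Num.sqrt n%:R * (kmean P0 (L n) - psi0) - kmean P0 (L n) / Num.sqrt n%:R
    + vst (L n) (sample X n w) / Num.sqrt n%:R| <= u.
  move=> /GoodE[_ g2 _]; set x := sample _ n w in g2 *.
  have v1 := vst_le x n0.
  have t1 : `|kmean P0 (L n)| <= `|psi0| + 1.
    have := ler_normD (kmean P0 (L n) - psi0) psi0; rewrite subrK => t1.
    move: nt1; rewrite le_min normrM (gtr0_norm S0) => /andP[t2 _].
    apply: (le_trans t1); rewrite addrC lerD2l.
    by apply: le_trans t2; rewrite ler_peMl.
  rewrite -addrA -mulNr -mulrDl.
  apply: (le_trans (ler_normD _ _)).
  have t2 : `|Num.sqrt n%:R * (kmean P0 (L n) - psi0)| <= u / 2.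
    by move: nt1; rewrite le_min => /andP[].
  have t3 : `|(- kmean P0 (L n) + vst (L n) x) / Num.sqrt n%:R| <= u / 2.
    apply: le_trans nt2; rewrite normrM (gtr0_norm (_ : 0 < (Num.sqrt n%:R)^-1)) ?invr_gt0//.
    rewrite ler_pM2r ?invr_gt0//; apply: (le_trans (ler_normD _ _)); rewrite normrN.
    apply: lerD => //; apply: (le_trans v1); rewrite -addrA lerD2l.
    by rewrite -[leRHS]/(1 + 1) lerD2l (le_trans g2).
  by rewrite (splitr u); exact: lerD.
have WE w : Num.sqrt n%:R * (vst (L n) (sample X n w) - c n / n%:R -
    (1 - n%:R^-1) * kmean P0 (L n)) = W w.
  rewrite /W /vnorm /vstat /vst; congr (_ * (_ * _ - _ - _)).
  by apply: eq_bigr => i _; apply: eq_bigr => j _; rewrite !tnth_mktuple.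
have HTn (y : n.-tuple rV) := HT y n0.
have Cup w : Good w -> boot_interval T K (h n) a b (sample X n w) psi0 ->
    b - eta <= g (W w + 6 * u) /\ g (W w - 6 * u) <= 1 - a + eta.
  move=> Gw; rewrite -WE.
  exact: (boot_interval_up n0 HTn gmono ghi glo u0 eta0 ha hb hab (Gg w Gw) (tauE w Gw)).
have Clo w : Good w -> b + eta <= g (W w - 6 * u) -> g (W w + 6 * u) < 1 - a - eta ->
    boot_interval T K (h n) a b (sample X n w) psi0.
  move=> Gw; rewrite -WE.
  exact: (boot_interval_lo n0 HTn gmono ghi glo u0 eta0 ha hb hab (Gg w Gw) (tauE w Gw)).
have mW : measurable_fun [set: Omega] W by exact: (measurable_vnorm H (c n) (mL n)).
have Wle t : (P [set w | (W w <= t)%R] <= (g (t + 4 * u) + eta)%:E)%E.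
  apply: (le_trans (vnorm_cdf_le H n0 (mL n) (Lsym n) (Ldiag n) (L2 n) (LB n) me eM sg0 t u0)).
  by rewrite lee_fin lerD2l.
have Wgt t : (P [set w | (t < W w)%R] <= (1 - g (t - 4 * u) + eta)%:E)%E.
  apply: (le_trans (vnorm_cdf_gt H n0 (mL n) (Lsym n) (Ldiag n) (L2 n) (LB n) me eM sg0 t u0)).
  by rewrite lee_fin lerD2l.
have up := coverage_le mW mG PG gmono ghi glo gmod u0 eta0 ha hb hab Wle Wgt Cup.
have lo := coverage_ge mW mG PG gmono ghi glo gmod u0 eta0 ha hb hab Wle Wgt Clo.
apply/andP; split.
  by apply: le_trans lo; rewrite lee_fin le_eqVlt; apply/orP; left; apply/eqP; ring.
by apply: (le_trans up); rewrite lee_fin le_eqVlt; apply/orP; left; apply/eqP; ring.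
Unshelve. all: by end_near. Qed.

Theorem vstat_asymptotically_valid : asymptotically_valid P X T K h psi0.
Proof.
move=> a b /andP[a0 a1] /andP[b0 b1] ab1.
apply/fine_cvgP.
have key eps : 0 < eps -> \forall n \near \oo,
  ((1 - a - b - eps)%:E <=
    mu_ext P [set w | boot_interval T K (h n) a b (sample X n w) psi0] <=
   (1 - a - b + eps)%:E)%E.
  move=> e0; pose eta := Num.min (Num.min a b) eps / 16.
  have z0 : 0 < Num.min (Num.min a b) eps by rewrite !lt_min a0 b0.
  have : 3 * eta < a /\ 3 * eta < b /\ 8 * eta <= eps /\ 0 < eta.
    have : Num.min (Num.min a b) eps <= a by rewrite !ge_min lexx.
    have : Num.min (Num.min a b) eps <= b by rewrite !ge_min lexx orbT.
    have : Num.min (Num.min a b) eps <= eps by rewrite !ge_min lexx orbT.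
    by rewrite /eta; move: (Num.min _ _) z0 => z; lra.
  move=> [h1 [h2 [h3 h4]]].
  near=> n.
  have /andP[l1 l2] : ((1 - a - b - 7 * eta)%:E <=
      mu_ext P [set w | boot_interval T K (h n) a b (sample X n w) psi0] <=
    (1 - a - b + 8 * eta)%:E)%E by near: n; exact: asymptotic_coverage.
  apply/andP; split; first by apply: le_trans l1; rewrite lee_fin; lra.
  by apply: (le_trans l2); rewrite lee_fin; lra.
split.
  apply: filterS (key 1 ltr01) => n /andP[l1 l2].
  by rewrite fin_numElt (lt_le_trans _ l1) ?ltNyr// (le_lt_trans l2) ?ltry.
apply/cvgrPdist_le => eps e0.
apply: filterS (key eps e0) => n /andP[] /=.
case: (mu_ext _ _) => [z| |] //=; rewrite !lee_fin => l1 l2.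
by rewrite ler_norml; apply/andP; split; lra.
Unshelve. all: by end_near. Qed.

End validity.

(** * Lebesgue measure on R^d *)

Section affine_line.
Context (R : realType) (a b : R).
Let phi : measurableTypeR R -> measurableTypeR R := fun t => a * t + b.

Lemma measurable_affine_line : measurable_fun setT phi.
Proof.
apply: measurable_funD; last exact: measurable_cst.
by apply: measurable_funM => //; exact: measurable_cst.
Qed.

Hypothesis a0 : a != 0.

Lemma lebesgue_measure_affine (A : set (measurableTypeR R)) : measurable A ->
  (`|a|%:E * lebesgue_measure (phi @^-1` A) = lebesgue_measure A)%E.
Proof.
move=> mA.
have := @lebesgue_measure_unique R
  (mscale (NngNum (normr_ge0 a)) (pushforward (@lebesgue_measure R) phi)).
move=> /(_ measurable_affine_line _ _ mA) ->//.
move=> _ [[x y]] _ <-; 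
change (lebesgue_measure `]x, y]%classic = `|a|%:E * lebesgue_measure (phi @^-1` `]x, y]))%E.
have [a1|a1] : 0 < a \/ a < 0 by move: a0; rewrite neq_lt => /orP[]; [right|left].
  rewrite (_ : phi @^-1` `]x, y] = `](x - b) / a, (y - b) / a]%classic); last first.
    apply/seteqP; split => t /=; rewrite !in_itv/= /phi ltr_pdivrMr// ler_pdivlMr// (mulrC t a);
     by lra.
  rewrite !lebesgue_measure_itv/= !lte_fin ltr_pM2r ?invr_gt0// gtr0_norm//.
  rewrite ltrD2r; case: ifP => _; last by rewrite mule0.
  rewrite -!EFinB -EFinM; congr EFin; field; exact: a0.
rewrite (_ : phi @^-1` `]x, y] = `[(y - b) / a, (x - b) / a[%classic); last first.
  apply/seteqP; split => t /=; rewrite !in_itv/= /phi ltr_ndivlMr// ler_ndivrMr// (mulrC t a);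
     by lra.
rewrite !lebesgue_measure_itv/= !lte_fin ltr_nM2r ?invr_lt0// ltr0_norm//.
rewrite ltrD2r; case: ifP => _; last by rewrite mule0.
rewrite -!EFinB -EFinM; congr EFin; field; exact: a0.
Qed.

End affine_line.

Section affine_space.
Context (R : realType) (d : nat).
Local Notation rV := 'rV[R]_d.
Local Notation lambda := (lebesgue_rV R d).

Definition rbox (A : 'I_d -> set (measurableTypeR R)) : set rV :=
  [set x | forall i, A i (x ord0 i)].

Let rboxes : set (set rV) := [set rbox A | A in [set A | forall i, measurable (A i)]].

Lemma measurable_rbox A : (forall i, measurable (A i)) -> measurable (rbox A).
Proof.
move=> mA; rewrite (_ : rbox A =
    \bigcap_(i in [set: 'I_d]) ((fun x : rV => x ord0 i) @^-1` A i)).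
  apply: fin_bigcap_measurable => // i _.
  by rewrite -[X in measurable X]setTI; exact: measurable_rV_coord.
by apply/seteqP; split => x /= h i; [move=> _; exact: h|exact: h].
Qed.

Let rboxesE : measurable = <<s rboxes >>.
Proof.
apply/seteqP; split; last first.
  apply: smallest_sub; first exact: sigma_algebra_measurable.
  by move=> _ [A mA <-]; exact: measurable_rbox.
apply: smallest_sub; first exact: smallest_sigma_algebra.
rewrite -bigcup_seq; apply: bigcup_sub => i _ _ [B mB <-].
apply: sub_sigma_algebra; exists (fun j => if j == i then B else setT).
  by move=> j /=; case: ifP.
rewrite setTI; apply/seteqP; split => x /=; first by move=> /(_ i); rewrite eqxx.
by move=> Bx j; case: eqP => // ->.
Qed.

Lemma lebesgue_rV_unique (mu : {measure set rV -> \bar R}) :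
  (forall A, (forall i, measurable (A i)) ->
    mu (rbox A) = (\prod_(i < d) (@lebesgue_measure R (A i)))%E) ->
  forall A, measurable A -> lambda A = mu A.
Proof.
move=> muE A mA.
apply: (measure_unique rboxes (fun k => rbox (fun=> `[- k%:R, k%:R]%classic))) => //.
- move=> _ _ [B mB <-] [C mC <-]; exists (fun i => B i `&` C i).
    by move=> i; exact: measurableI.
  by apply/seteqP; split => x /= h; [split => i; have [] := h i|move=> i; case: h].
- by move=> k; exists (fun=> `[- k%:R, k%:R]%classic).
- apply/seteqP; split => // x _.
  exists (Num.bound (\sum_i `|x ord0 i|)) => // i; rewrite /= in_itv/= -ler_norml.
  apply: (@le_trans _ _ (\sum_i `|x ord0 i|)); first by rewrite (bigD1 i)//= lerDl sumr_ge0.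
  by rewrite ltW// archi_boundP// sumr_ge0.
- by move=> _ [B mB <-]; rewrite muE//; exact: lebesgue_rV_box.
- move=> k; apply: (eq_ind_r (fun z => (z < +oo)%E) _
    (lebesgue_rV_box (A := fun=> `[- k%:R, k%:R]%classic) (fun=> measurable_itv _))).
  rewrite ltey_eq prode_fin_num//= => i _; rewrite lebesgue_measure_itv/= lte_fin.
  by case: ifP.
Qed.

Variables (a : R) (b : rV).
Hypothesis a0 : a != 0.
Let phi (x : rV) : rV := a *: x + b.

Lemma measurable_affine : measurable_fun setT phi.
Proof.
apply: measurable_fun_rV => i.
rewrite (_ : (fun _ => _) = (fun x : rV => a * x ord0 i + b ord0 i)); last first.
  by apply/funext => x; rewrite !mxE.
apply: measurable_funD; last exact: measurable_cst.
by apply: measurable_funM; [exact: measurable_cst|exact: measurable_rV_coord].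
Qed.

Lemma lebesgue_rV_affine A : measurable A ->
  ((`|a| ^+ d)%:E * lambda (phi @^-1` A) = lambda A)%E.
Proof.
move=> mA; have p0 : 0 <= `|a| ^+ d by exact: exprn_ge0.
apply/esym; have := lebesgue_rV_unique (mu := mscale (NngNum p0) (pushforward lambda phi)).
apply => //; first exact: measurable_affine.
move=> m B mB; rewrite /= /mscale/= /pushforward.
rewrite (_ : phi @^-1` rbox B =
  rbox (fun i => (fun t : R => a * t + b ord0 i) @^-1` B i)); last first.
  by apply/seteqP; split => x /= h i; have := h i; rewrite /= !mxE.
rewrite lebesgue_rV_box; last first.
  move=> i; rewrite -[X in measurable X]setTI; exact: (measurable_affine_line a (b ord0 i) measurableT).
have -> : (`|a| ^+ d)%:E = (\prod_(i < d) `|a|%:E)%E.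
  by rewrite prodEFin prodr_const card_ord.
rewrite -big_split/=; apply: eq_bigr => i _.
exact: lebesgue_measure_affine.
Qed.

Lemma ge0_integral_affine (f : rV -> \bar R) : measurable_fun setT f ->
  (forall x, (0 <= f x)%E) ->
  ((`|a| ^+ d)%:E * \int[lambda]_x f (a *: x + b)%R = \int[lambda]_x f x)%E.
Proof.
move=> mf f0; have p0 : 0 <= `|a| ^+ d by exact: exprn_ge0.
rewrite -(ge0_integral_pushforward measurable_affine lambda measurableT mf)//.
rewrite -(ge0_integral_mscale _ measurableT (NngNum p0))//.
  exact: measurable_affine.
move=> m; apply: eq_measure_integral => A mA _ /=.
exact: lebesgue_rV_affine.
Qed.

End affine_space.

Section continuous_measurable.
Context (R : realType) (d : nat).
Local Notation rV := 'rV[R]_d.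

Lemma measurable_open_rV (U : set rV) : open U -> measurable U.
Proof.
move=> oU.
pose q (p : 'rV[rat]_d) : rV := map_mx ratr p.
pose bx (p : 'rV[rat]_d * nat) := rbox (fun i => `](q p.1 ord0 i - p.2.+1%:R^-1),
   (q p.1 ord0 i + p.2.+1%:R^-1)[%classic).
rewrite (_ : U = \bigcup_p (if `[< bx p `<=` U >] then bx p else set0)).
  apply: countable_bigcupT_measurable; first exact: countableP.
  move=> p.
  case: ifP => // _; apply: measurable_rbox => i; exact: measurable_itv.
apply/seteqP; split => x; last by move=> [p _]; case: asboolP => // pU /pU.
move=> Ux; have /nbhs_ballP[e /= e0 eU] := open_nbhs_nbhs (conj oU Ux).
have [k ke] : exists k : nat, k.+1%:R^-1 < e / 2.
  have e2 : 0 < e / 2 by exact: divr_gt0.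
  exists (Num.trunc (e / 2)^-1); rewrite invf_plt ?posrE//.
  exact: truncnS_gt.
have /fin_all_exists[p px] i : exists p : rat, `|x ord0 i - ratr p| < k.+1%:R^-1.
  have := @rat_in_itvoo R (x ord0 i - k.+1%:R^-1) (x ord0 i + k.+1%:R^-1).
  have k0 : 0 < k.+1%:R^-1 :> R by rewrite invr_gt0.
  case; first by rewrite ltrBlDr -addrA ltrDl addr_gt0.
  move=> p; rewrite in_itv/= => /andP[p1 p2]; exists p.
  by rewrite distrC ltr_distl p1 p2.
exists (\row_i p i, k) => //.
case: asboolP => [_|[]].
  by move=> i /=; rewrite /q !mxE in_itv/=; rewrite -ltr_distl; exact: px.
move=> y /= hy; apply: eU; split => // i j; rewrite (ord1 i) /ball/=.
apply: (le_lt_trans (ler_distD (ratr (p j)) _ _)).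
have h2 : `|ratr (p j) - y ord0 j| < k.+1%:R^-1.
  by rewrite distrC ltr_distl; have := hy j; rewrite /q /= !mxE in_itv/=.
apply: (@lt_le_trans _ _ (k.+1%:R^-1 + k.+1%:R^-1)); first by apply: ltrD => //; exact: px.
by move: ke; set z := k.+1%:R^-1; lra.
Qed.

Lemma continuous_measurable_rV (f : rV -> R) : continuous f -> measurable_fun setT f.
Proof.
move=> cf; apply: (measurability _ (RGenOpens.measurableE R)) => _ [_ [a [b ->]] <-].
rewrite setTI; apply: measurable_open_rV.
by move/continuousP: cf; apply; exact: interval_open.
Qed.

End continuous_measurable.

Section density.
Context (R : realType) (d : nat).
Local Notation rV := 'rV[R]_d.
Local Notation lambda := (lebesgue_rV R d).
Variables (P0 : probability rV R) (eta : rV -> R).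
Hypotheses (P0_dom : P0 `<< lambda) (P0_eta : is_density P0 eta).

Let meta : measurable_fun setT eta. Proof. by case: P0_eta. Qed.
Let eta_ge0 x : 0 <= eta x. Proof. by case: P0_eta. Qed.

Lemma ge0_integral_density (f : rV -> \bar R) : measurable_fun setT f ->
  (forall x, (0 <= f x)%E) ->
  (\int[P0]_x f x = \int[lambda]_x (f x * (eta x)%:E))%E.
Proof.
move=> mf f0; case: P0_eta => _ _ dE.
rewrite -(Radon_Nikodym_SigmaFinite.change_of_variables P0_dom)//.
set g := Radon_Nikodym_SigmaFinite.f _ _.
have ig := Radon_Nikodym_SigmaFinite.f_integrable P0_dom.
have g0 := Radon_Nikodym_SigmaFinite.f_ge0 P0_dom.
have ae : ae_eq lambda setT g (EFin \o eta).
  apply: integral_ae_eq => //; first exact/measurable_EFinP.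
  move=> A _ mA; rewrite -dE//.
  by rewrite -(Radon_Nikodym_SigmaFinite.f_integral P0_dom).
apply: ge0_ae_eq_integral => //.
- by apply: emeasurable_funM => //; exact: measurable_int ig.
- by apply: emeasurable_funM => //; exact/measurable_EFinP.
- by move=> x _; rewrite mule_ge0.
- by move=> x _; rewrite mule_ge0// lee_fin.
- by apply: ae_eqe_mul2l.
Qed.

Lemma integrable_density (f : rV -> R) : measurable_fun setT f ->
  P0.-integrable setT (EFin \o f) <-> lambda.-integrable setT (EFin \o (fun x => f x * eta x)).
Proof.
move=> mf.
have E : (\int[P0]_x `|(f x)%:E| = \int[lambda]_x `|(f x * eta x)%:E|)%E.
  rewrite ge0_integral_density//; last by apply: measurableT_comp => //; exact/measurable_EFinP.
  by apply: eq_integral => x _; rewrite EFinM abseM [X in (_ = _ * X)%E]gee0_abs// lee_fin.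
split => /integrableP[m1 m2]; apply/integrableP; split.
- by apply/measurable_EFinP; exact: measurable_funM.
- by rewrite -E.
- exact/measurable_EFinP.
- by rewrite E.
Qed.

Lemma Rintegral_density (f : rV -> R) : measurable_fun setT f ->
  \int[P0]_x f x = \int[lambda]_x (f x * eta x).
Proof.
move=> mf; rewrite /Rintegral; congr fine; rewrite integralE [RHS]integralE.
have mf' : measurable_fun setT (EFin \o f) by exact/measurable_EFinP.
have M (p q : R) : 0 <= q -> (maxe (p * q)%:E 0 = maxe p%:E 0 * q%:E)%E.
  by move=> q0; rewrite -!EFin_max -EFinM maxr_pMl ?mul0r.
congr (_ - _)%E.
- rewrite ge0_integral_density//; last exact: measurable_funepos.
  by apply: eq_integral => x _; rewrite !funeposE M.
- rewrite ge0_integral_density//; last exact: measurable_funeneg.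
  by apply: eq_integral => x _; rewrite !funenegE -!EFinN -mulNr M.
Qed.

End density.

Section affine_real.
Context (R : realType) (d : nat) (a : R) (b : 'rV[R]_d).
Local Notation rV := 'rV[R]_d.
Local Notation lambda := (lebesgue_rV R d).
Hypothesis a0 : a != 0.
Variable f : rV -> R.
Hypothesis mf : measurable_fun setT f.

Let ad0 : 0 < `|a| ^+ d. Proof. by rewrite exprn_gt0// normr_gt0. Qed.

Lemma measurable_comp_affine : measurable_fun setT (fun x : rV => f (a *: x + b)).
Proof. exact: (measurableT_comp mf (measurable_affine a b)). Qed.

Lemma integrable_affine : lambda.-integrable setT (EFin \o f) ->
  lambda.-integrable setT (EFin \o (fun x => f (a *: x + b))).
Proof.
move=> /integrableP[_ fi]; apply/integrableP; split.
  by apply/measurable_EFinP; exact: measurable_comp_affine.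
rewrite -(@lte_pmul2l _ (`|a| ^+ d)%:E)// gt0_muley// (ge0_integral_affine b a0
  (f := fun x => `|(f x)%:E|%E))//.
by apply: measurableT_comp => //; exact/measurable_EFinP.
Qed.

Lemma Rintegral_affine : lambda.-integrable setT (EFin \o f) ->
  \int[lambda]_x f (a *: x + b) = `|a| ^- d * \int[lambda]_x f x.
Proof.
move=> fi; have E (g : rV -> \bar R) : measurable_fun setT g -> (forall x, (0 <= g x)%E) ->
   (\int[lambda]_x g (a *: x + b)%R = (`|a| ^- d)%:E * \int[lambda]_x g x)%E.
  move=> mg g0; rewrite -(ge0_integral_affine b a0 mg g0) muleA -EFinM mulVf ?mul1e//.
  by rewrite gt_eqF.
have mf' : measurable_fun setT (EFin \o f) by exact/measurable_EFinP.
have E1 := E _ (measurable_funepos mf') (funepos_ge0 _).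
have E2 := E _ (measurable_funeneg mf') (funeneg_ge0 _).
have F1 := integrable_pos_fin_num measurableT fi.
have F2 := integrable_neg_fin_num measurableT fi.
rewrite /Rintegral integralE [X in _ = _ * fine X]integralE.
rewrite (_ : (\int[lambda]_x _ - \int[lambda]_x _)%E =
  ((`|a| ^- d)%:E * (\int[lambda]_x (EFin \o f)^\+%E x - \int[lambda]_x (EFin \o f)^\-%E x))%E).
  by rewrite fineM// fin_numB F1 F2.
rewrite muleBr//; last by rewrite fin_num_adde_defr.
by rewrite -E1 -E2; congr (_ - _)%E; apply: eq_integral => x _; rewrite ?funeposE ?funenegE.
Qed.

End affine_real.

(** * Taylor expansion in L2 *)

Section taylor_line.
Context (R : realType) (d : nat) (i : 'I_d).
Local Notation rV := 'rV[R]_d.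
Local Notation lambda := (lebesgue_rV R d).
Local Notation mu := (@lebesgue_measure R).
Implicit Types (f : rV -> R) (x : rV) (s t u : R).
Local Notation e := (delta_mx ord0 i : rV).

Definition taylor_rem m f s x : R :=
  f (x + s *: e) - \sum_(k < m) s ^+ k / k`!%:R * iter k (partial i) f x.

Lemma Cn_continuous m f : Cn m f -> continuous f.
Proof. by case: m => // m []. Qed.

Lemma Cn_iter m k f : (k <= m)%N -> Cn m f -> Cn (m - k) (iter k (partial i) f).
Proof.
elim: k m f => [|k IH] m f; first by rewrite subn0.
case: m => // m; rewrite ltnS subSS iterSr => km [_ /(_ i)[_]]; exact: IH.
Qed.

Lemma is_derive_line f x u : derivable f (x + u *: e) e ->
  is_derive u 1 (fun v => f (x + v *: e)) (partial i f (x + u *: e)).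
Proof.
move=> df.
have E : (fun h : R => h^-1 *: (((fun v => f (x + v *: e)) \o shift u) (h *: 1) - f (x + u *: e)))
   = (fun h : R => h^-1 *: ((f \o shift (x + u *: e)) (h *: e) - f (x + u *: e))).
  apply/funext => h /=; congr (_ *: (f _ - _)).
  by rewrite scalerDl scaler1 addrCA addrA.
split; first by rewrite /derivable E.
by rewrite /derive E.
Qed.

Lemma is_derive_taylor_sum m (c : nat -> R) u :
  is_derive u 1 (fun v => \sum_(k < m.+1) v ^+ k / k`!%:R * c k)
    (\sum_(k < m) u ^+ k / k`!%:R * c k.+1).
Proof.
elim: m => [|m IH].
  rewrite big_ord0 (_ : (fun v => _) = fun=> c 0%N); first exact: is_derive_cst.
  by apply/funext => v; rewrite big_ord1 expr0 fact0 divr1 mul1r.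
rewrite big_ord_recr /=.
rewrite (_ : (fun v => _) = (fun v => (\sum_(k < m.+1) v ^+ k / k`!%:R * c k)) +
   (fun v => v ^+ m.+1 / m.+1`!%:R * c m.+1)); last first.
  by apply/funext => v; rewrite [LHS]big_ord_recr.
apply: is_deriveD.
have h : is_derive u 1 (fun v : R => v ^+ m.+1) (m.+1%:R * u ^+ m).
  have := is_deriveX (f := id) m.+1 (is_derive_id u (1 : R)).
  by rewrite exprfctE /GRing.scale/= mulr1.
rewrite (_ : (fun v => _) = ((c m.+1 / m.+1`!%:R) \*: (fun v : R => v ^+ m.+1))); last first.
  by apply/funext => v; rewrite /= /GRing.scale/=; ring.
rewrite (_ : u ^+ m / _ * _ = (c m.+1 / m.+1`!%:R) *: (m.+1%:R * u ^+ m)).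
  exact: is_deriveZ.
rewrite /GRing.scale/= factS natrM; field.
by rewrite nat1r !pnatr_eq0 -lt0n fact_gt0.
Qed.

Lemma is_derive_rem m f s x t : (forall y, derivable f y e) ->
  is_derive t 1 (fun v => taylor_rem m.+1 f (v * s) x) (s * taylor_rem m (partial i f) (t * s) x).
Proof.
move=> df.
have h : is_derive (t * s) 1 (fun v => taylor_rem m.+1 f v x) (taylor_rem m (partial i f) (t * s) x).
  rewrite /taylor_rem; apply: is_deriveB; first exact: is_derive_line.
  rewrite (eq_bigr (fun k : 'I_m => (t * s) ^+ k / k`!%:R * iter k.+1 (partial i) f x)).
    exact: (is_derive_taylor_sum m (fun k => iter k (partial i) f x)).
  by move=> k _; rewrite iterSr.
have g : is_derive t 1 (fun v : R => v * s) s.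
  rewrite (_ : (fun v => _) = s \*: id); last by apply/funext => v; rewrite /= /GRing.scale/= mulrC.
  by have := is_deriveZ s (is_derive_id t (1 : R)); rewrite /GRing.scale/= mulr1.
have := @is_derive1_comp R (fun v => taylor_rem m.+1 f v x) (fun v => v * s) t _ _ h g.
by rewrite mulrC.
Qed.

Lemma continuous_rem m f x : (forall y, {for y, continuous f}) ->
  continuous (fun s => taylor_rem m f s x).
Proof.
move=> cf s; apply: cvgB.
  apply: (@continuous_comp _ _ _ (fun v : R => x + v *: e) f); last exact: cf.
  apply: cvgD; first exact: cvg_cst.
  by apply: cvgZr_tmp; exact: cvg_id.
apply: (cvg_big (op := +%R)) => [|k _]; first exact: add_continuous.
apply: cvgM; last exact: cvg_cst.
apply: cvgM; last exact: cvg_cst.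
exact: exprn_continuous.
Qed.


Lemma rem_integral m f s x : Cn m.+1 f ->
  taylor_rem m.+1 f s x = s * \int[mu]_(t in `[0, 1]) taylor_rem m (partial i f) (t * s) x.
Proof.
move=> [cf /(_ i)[df Cf]]; have cp := Cn_continuous Cf.
pose F v := taylor_rem m.+1 f (v * s) x.
have dF t : is_derive t 1 F (s * taylor_rem m (partial i f) (t * s) x) by exact: is_derive_rem.
have F0 : F 0 = 0.
  rewrite /F /taylor_rem mul0r scale0r addr0 big_ord_recl/= expr0 fact0 divr1 mul1r big1 ?addr0 ?subrr//.
  by move=> k _; rewrite expr0n/= !mul0r.
have cr : continuous (fun t : R => s * taylor_rem m (partial i f) (t * s) x).
  move=> t; apply: cvgM; first exact: cvg_cst.
  apply: (@continuous_comp _ _ _ (fun t : R => t * s) (fun v => taylor_rem m (partial i f) v x)).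
    by apply: cvgM; [exact: cvg_id|exact: cvg_cst].
  exact: continuous_rem.
have cF t : {for t, continuous F}.
  apply: differentiable_continuous; apply/derivable1_diffP.
  by have [] := dF t.
have := @continuous_FTC2 R (fun t => s * taylor_rem m (partial i f) (t * s) x) F 0 1 ltr01 _ _ _.
move=> /(_ _ _ _) E.
have {}E : (\int[mu]_(t in `[0%R, 1%R]) (s * taylor_rem m (partial i f) (t * s) x)%:E =
  (F 1)%:E - (F 0)%:E)%E.
  apply: E.
  - exact: continuous_subspaceT.
  - split.
    + by move=> t _; have [] := dF t.
    + by apply: cvg_at_right_filter; exact: cF.
    + by apply: cvg_at_left_filter; exact: cF.
  - by move=> t _; rewrite derive1E; have [_] := dF t.
rewrite F0 sube0 in E.
have ir : mu.-integrable `[0, 1] (EFin \o (fun t => taylor_rem m (partial i f) (t * s) x)).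
  apply: continuous_compact_integrable; first exact: segment_compact.
  apply: continuous_subspaceT => t.
  apply: (@continuous_comp _ _ _ (fun t : R => t * s) (fun v => taylor_rem m (partial i f) v x)).
    by apply: cvgM; [exact: cvg_id|exact: cvg_cst].
  exact: continuous_rem.
rewrite -RintegralZl//.
by rewrite /Rintegral E /= /F mul1r.
Qed.

Lemma Rintegral_sq_mean01 (r : R -> R) : continuous r ->
  (((\int[mu]_(t in `[0, 1]) r t) ^+ 2)%:E <=
   \int[mu]_(t in `[0%R, 1%R]) (r t ^+ 2)%:E)%E.
Proof.
move=> cr.
have I (g : R -> R) : continuous g -> mu.-integrable `[0, 1] (EFin \o g).
  move=> cg; apply: continuous_compact_integrable; first exact: segment_compact.
  exact: continuous_subspaceT.
have c2 : continuous (fun t => r t ^+ 2).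
  by move=> t; rewrite (_ : (fun t => _) = (fun t => r t * r t))//; apply: cvgM; exact: cr.
set c := \int[mu]_(t in `[0, 1]) r t.
have i1 := I _ cr; have i2 := I _ c2.
have cc : \int[mu]_(t in `[0, 1]) (c ^+ 2) = c ^+ 2.
  rewrite /Rintegral integral_cst//= lebesgue_measure_itv/= lte_fin ltr01.
  by rewrite oppr0 adde0 mule1.
have ic : mu.-integrable `[0, 1] (EFin \o (fun=> c ^+ 2)) by apply: I => t; exact: cvg_cst.
have : 0 <= \int[mu]_(t in `[0, 1]) ((r t - c) ^+ 2).
  by apply: Rintegral_ge0 => t _; exact: sqr_ge0.
rewrite (_ : Rintegral _ _ _ = \int[mu]_(t in `[0, 1]) (r t ^+ 2 + c ^+ 2 - (2 * c) * r t)); last first.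
  by apply: eq_Rintegral => t _; ring.
rewrite RintegralB//; last 2 first.
- exact: (integrableD _ i2 ic).
- exact: (integrableZl _ (2 * c) i1).
rewrite [X in X - _]RintegralD// [X in _ - X]RintegralZl// -/c.
rewrite [X in _ + X - _](_ : _ = c ^+ 2) => [h|]; last exact: cc.
rewrite -[leRHS]fineK; last by apply: (integrable_fin_num _ i2).
by rewrite lee_fin; move: h; rewrite /Rintegral; set z := fine _; lra.
Qed.

Lemma measurable_rem m f : Cn m f ->
  measurable_fun setT (fun p : rV * measurableTypeR R => taylor_rem m f p.2 p.1).
Proof.
move=> Cf; apply: measurable_funB.
  apply: (measurableT_comp (continuous_measurable_rV (Cn_continuous Cf))).
  apply: measurable_fun_rV => j.
  rewrite (_ : (fun _ => _) = (fun p : rV * measurableTypeR R =>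
     p.1 ord0 j + p.2 * e ord0 j)); last by apply/funext => p; rewrite !mxE.
  apply: measurable_funD; last by apply: measurable_funM => //; exact: measurable_snd.
  exact: (measurableT_comp (@measurable_rV_coord R d j) measurable_fst).
apply: measurable_sum => k; apply: measurable_funM.
  apply: measurable_funM => //; apply: measurable_funX; exact: measurable_snd.
apply: (measurableT_comp _ measurable_fst).
apply: continuous_measurable_rV; apply: Cn_continuous.
exact: (Cn_iter (ltnW (ltn_ord k)) Cf).
Qed.

Lemma rem_sq_le m f s : Cn m f ->
  (\int[lambda]_x (taylor_rem m f s x ^+ 2)%:E <=
   (s ^+ (2 * m))%:E * \int[lambda]_x (iter m (partial i) f x ^+ 2)%:E)%E.
Proof.
elim: m f s => [|m IH] f s Cf.
  rewrite muln0 expr0 mul1e.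
  have mf : measurable_fun setT (fun x => (f x ^+ 2)%:E).
    apply/measurable_EFinP; apply: measurable_funX; exact: continuous_measurable_rV.
  rewrite -(ge0_integral_affine (s *: e) (oner_neq0 R) mf); last first.
    by move=> x; rewrite lee_fin sqr_ge0.
  rewrite normr1 expr1n mul1e le_eqVlt; apply/orP; left; apply/eqP; apply: eq_integral => x _.
  by rewrite /taylor_rem big_ord0 subr0 scale1r.
have [cf /(_ i)[df Cpf]] := Cf.
pose U : probability (measurableTypeR R) R := uniform_prob (@ltr01 R).
pose r t x := taylor_rem m (partial i f) (t * s) x.
have mr : measurable_fun setT (fun p : rV * measurableTypeR R => (r p.2 p.1 ^+ 2)%:E).
  apply/measurable_EFinP; apply: measurable_funX.
  have mg : measurable_fun setT (fun p : rV * measurableTypeR R => (p.1, p.2 * s : measurableTypeR R)).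
    apply/measurable_fun_pairP; split; first exact: measurable_fst.
    exact: (measurable_funM (f := snd) (g := fun=> s) measurable_snd (measurable_cst s)).
  exact: (measurableT_comp (measurable_rem Cpf) mg).
have r0 p : (0 <= (r p.2 p.1 ^+ 2)%:E)%E by rewrite lee_fin sqr_ge0.
have cr x : continuous (fun t => r t x).
  move=> t; apply: (@continuous_comp _ _ _ (fun t : R => t * s) (fun v => taylor_rem m (partial i f) v x)).
    by apply: cvgM; [exact: cvg_id|exact: cvg_cst].
  by apply: continuous_rem; exact: (Cn_continuous Cpf).
have mrt x : measurable_fun setT (fun t : measurableTypeR R => (r t x ^+ 2)%:E).
  exact: (measurableT_comp mr (pair1_measurable x)).
have mrx t : measurable_fun setT (fun x => (r t x ^+ 2)%:E).
  exact: (measurableT_comp mr (pair2_measurable t)).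
have mI : measurable_fun setT (fun x => \int[U]_t (r t x ^+ 2)%:E)%E.
  exact: (measurable_fun_fubini_tonelli_F (m2 := U) _ mr r0).
have mR : measurable_fun setT (fun x => (taylor_rem m.+1 f s x ^+ 2)%:E).
  apply/measurable_EFinP; apply: measurable_funX.
  exact: (measurableT_comp (measurable_rem Cf) (pair2_measurable (s : measurableTypeR R))).
apply: (@le_trans _ _ (\int[lambda]_x ((s ^+ 2)%:E * \int[U]_t (r t x ^+ 2)%:E))%E).
  apply: ge0_le_integral => //.
  - by move=> x _; rewrite lee_fin sqr_ge0.
  - by apply: emeasurable_funM.
  - move=> x _; rewrite rem_integral// exprMn EFinM lee_wpmul2l ?lee_fin ?sqr_ge0//.
    rewrite integral_uniform//; last by move=> t; rewrite lee_fin sqr_ge0.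
    by rewrite subr0 invr1 mul1e; exact: (Rintegral_sq_mean01 (cr x)).
rewrite ge0_integralZl//; last 2 first.
- by move=> x _; apply: integral_ge0 => t _; rewrite lee_fin sqr_ge0.
- by rewrite lee_fin sqr_ge0.
rewrite (fubini_tonelli (m1 := lambda) (m2 := U) _ mr r0).
have N0 : (0 <= \int[lambda]_x (iter m.+1 (partial i) f x ^+ 2)%:E)%E.
  by apply: integral_ge0 => x _; rewrite lee_fin sqr_ge0.
have IHt t := IH _ (t * s) Cpf; rewrite -iterSr in IHt.
set N := (\int[lambda]_x (iter m.+1 _ _ _ ^+ 2)%:E)%E in N0 IHt *.
rewrite (_ : 2 * m.+1 = 2 + 2 * m)%N; last by rewrite mulnS.
have -> : (s ^+ (2 + 2 * m))%:E = ((s ^+ 2)%:E * (s ^+ (2 * m))%:E)%E.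
  by rewrite -EFinM -exprD.
rewrite -muleA; apply: lee_wpmul2l; first by rewrite lee_fin sqr_ge0.
rewrite integral_uniform//; last 2 first.
- exact: (measurable_fun_fubini_tonelli_G (m1 := lambda) _ mr r0).
- by move=> t; apply: integral_ge0 => x _; rewrite lee_fin sqr_ge0.
rewrite subr0 invr1 mul1e.
apply: (@le_trans _ _ (\int[mu]_(t in `[0%R, 1%R]) (cst ((s ^+ (2 * m))%:E * N) t))%E).
  apply: ge0_le_integral => //.
  - by move=> t _; apply: integral_ge0 => x _; rewrite lee_fin sqr_ge0.
  - by apply: measurable_funTS; exact: (measurable_fun_fubini_tonelli_G (m1 := lambda) _ mr r0).
  move=> t; rewrite /= in_itv/= => /andP[t0 t1].
  apply: (le_trans (IHt t)); apply: lee_wpmul2r => //.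
  rewrite lee_fin exprMn -[leRHS]mul1r ler_wpM2r//.
    by rewrite exprM exprn_ge0// sqr_ge0.
  by rewrite exprn_ile1.
by rewrite integral_cst//= lebesgue_measure_itv/= lte_fin ltr01 oppr0 adde0 mule1.
Qed.

End taylor_line.

Section taylor_space.
Context (R : realType) (d : nat).
Local Notation rV := 'rV[R]_d.
Local Notation lambda := (lebesgue_rV R d).
Implicit Types (f : rV -> R) (x z : rV) (l : seq 'I_d).

Definition sqint_le (g : rV -> R) (c : R) :=
  sqint lambda g /\ \int[lambda]_x (g x ^+ 2) <= c.

Lemma sqint_le_integral (g : rV -> R) c : measurable_fun [set: rV] g ->
  (\int[lambda]_x (g x ^+ 2)%:E <= c%:E)%E -> sqint_le g c.
Proof.
move=> mg h; have ig : lambda.-integrable setT (EFin \o (fun x => g x ^+ 2)).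
  apply/integrableP; split; first by apply/measurable_EFinP; exact: measurable_funX.
  apply: (le_lt_trans _ (ltry c)); apply: le_trans h.
  by under eq_integral do rewrite gee0_abs ?lee_fin ?sqr_ge0//.
split; first by split.
rewrite -lee_fin /Rintegral fineK//; exact: (integrable_fin_num _ ig).
Qed.

Lemma sqint_le_sum (I : finType) (F : I -> rV -> R) (c : I -> R) :
  (forall i, sqint_le (F i) (c i)) ->
  sqint_le (fun x => \sum_i F i x) (#|I|%:R * \sum_i c i).
Proof.
move=> h; split; first by apply: sqint_sum => i _; exact: (h i).1.
apply: le_trans (Rintegral_sum_sq_le (fun i => (h i).1)) _.
by apply: ler_wpM2l => //; apply: ler_sum => i _; exact: (h i).2.
Qed.

Lemma sqint_leZ (k : R) g c : sqint_le g c -> sqint_le (fun x => k * g x) (k ^+ 2 * c).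
Proof.
move=> [h1 h2]; split; first exact: sqintZ.
under eq_Rintegral do rewrite exprMn.
rewrite RintegralZl//; last exact: h1.2.
by apply: ler_wpM2l => //; exact: sqr_ge0.
Qed.

Lemma sqint_leD g1 g2 c1 c2 : sqint_le g1 c1 -> sqint_le g2 c2 ->
  sqint_le (fun x => g1 x + g2 x) (2 * c1 + 2 * c2).
Proof.
move=> [h1 k1] [h2 k2]; split; first exact: sqintD.
apply: le_trans (Rintegral_sqD h1 h2) _.
by apply: lerD; apply: ler_wpM2l.
Qed.

Lemma sqint_le_shift b g c : sqint_le g c -> sqint_le (fun x => g (x + b)) c.
Proof.
move=> [[mg ig] h].
have E : (fun x => g (x + b)) = (fun x => g (1 *: x + b)).
  by apply/funext => x; rewrite scale1r.
rewrite E; split; [split|].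
- exact: (measurable_comp_affine 1 b mg).
- exact: (integrable_affine b (oner_neq0 R) (measurable_funX 2 mg) ig).
- rewrite (Rintegral_affine b (oner_neq0 R) (measurable_funX 2 mg) ig).
  by rewrite normr1 expr1n invr1 mul1r.
Qed.

Definition lderive l (a : 'I_d -> nat) f := foldl (fun g i => iter (a i) (partial i) g) f l.

Definition lshift l z : rV := \sum_(i <- l) z ord0 i *: delta_mx ord0 i.

(* Expanding one coordinate at a time, the derivatives appear in the order used by
   mderive, so that symmetry of second derivatives is never needed. *)
Fixpoint ltaylor l m f x z : R :=
  if l is i :: l' then
    \sum_(k < m) z ord0 i ^+ k / k`!%:R * ltaylor l' (m - k)%N (iter k (partial i) f) x z
  else f x.

Lemma measurable_ltaylor l m f : Cn m f ->
  measurable_fun setT (fun p : rV * rV => ltaylor l m f p.1 p.2).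
Proof.
elim: l m f => [|i l IH] m f Cf /=.
  apply: (measurableT_comp (continuous_measurable_rV (Cn_continuous Cf))).
  exact: measurable_fst.
apply: measurable_sum => k; apply: measurable_funM.
  apply: measurable_funM => //; apply: measurable_funX.
  exact: (measurableT_comp (@measurable_rV_coord R d i) measurable_snd).
by apply: IH; exact: (Cn_iter i (ltnW (ltn_ord k)) Cf).
Qed.

Lemma lderive_ext l a b f : {in l, a =1 b} -> lderive l a f = lderive l b f.
Proof.
elim: l f => //= i l IH f ab; rewrite ab ?mem_head//.
by apply: IH => j jl; apply: ab; rewrite inE jl orbT.
Qed.

Lemma lderive0 l f : lderive l (fun=> 0%N) f = f.
Proof. by elim: l f => //= i l IH f. Qed.

Lemma sqint_le_rem i m f s (r C : R) : Cn m f -> `|s| <= r ->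
  (\int[lambda]_x (iter m (partial i) f x ^+ 2)%:E <= C%:E)%E -> 0 <= C ->
  sqint_le (taylor_rem i m f s) (C * r ^+ (2 * m)).
Proof.
move=> Cf sr hC C0; apply: sqint_le_integral.
  exact: (measurableT_comp (measurable_rem i Cf) (pair2_measurable (s : measurableTypeR R))).
apply: (le_trans (rem_sq_le i s Cf)).
rewrite mulrC EFinM; apply: lee_pmul => //.
- by rewrite lee_fin exprM exprn_ge0// sqr_ge0.
- by apply: integral_ge0 => x _; rewrite lee_fin sqr_ge0.
rewrite lee_fin !exprM lerXn2r ?nnegrE ?sqr_ge0//.
by rewrite -[leLHS]real_normK ?num_real// lerXn2r// nnegrE (le_trans _ sr).
Qed.

Lemma ltaylor_rem l m f : uniq l -> Cn m f ->
  (forall a, (\sum_(j <- l) a j = m)%N ->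
    (\int[lambda]_x (lderive l a f x ^+ 2)%:E < +oo)%E) ->
  exists2 C : R, 0 <= C & forall z (r : R), (forall i, `|z ord0 i| <= r) ->
    sqint_le (fun x => f (x + lshift l z) - ltaylor l m f x z) (C * r ^+ (2 * m)).
Proof.
elim: l m f => [|i l IH] m f.
  move=> _ Cf _; exists 0 => // z r zr; rewrite mul0r.
  rewrite (_ : (fun x => _) = cst 0).
    apply: sqint_le_integral => //.
    by under eq_integral do rewrite /cst expr0n/=; rewrite integral0.
  by apply/funext => x; rewrite /lshift big_nil addr0 /= subrr.
rewrite cons_uniq => /andP[il ul] Cf h.
have /choice[C hC] (k : 'I_m) : exists C : R, 0 <= C /\ forall z (r : R), (forall i, `|z ord0 i| <= r) ->
    sqint_le (fun x => iter k (partial i) f (x + lshift l z) -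
      ltaylor l (m - k)%N (iter k (partial i) f) x z) (C * r ^+ (2 * (m - k))).
  have := IH (m - k)%N (iter k (partial i) f) ul (Cn_iter i (ltnW (ltn_ord k)) Cf).
  case; last by move=> C C0 H; exists C.
  move=> a ha; pose b j := if j == i then k : nat else a j.
  have bl j : j \in l -> b j = a j.
    by rewrite /b; case: eqP => // ->; rewrite (negbTE il).
  have := h b; rewrite big_cons /= {1}/b eqxx.
  rewrite (eq_big_seq a) => [|j /bl//]; rewrite ha subnKC ?(ltnW (ltn_ord k))//.
  move=> /(_ erefl); rewrite (lderive_ext (b := a))// {1}/b eqxx.
  exact.
have hi : (\int[lambda]_x (iter m (partial i) f x ^+ 2)%:E < +oo)%E.
  have := h (fun j => if j == i then m else 0%N); rewrite big_cons /= eqxx.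
  rewrite big_seq big1 ?addn0 => [|j jl]; last by case: eqP jl => // ->; rewrite (negbTE il).
  move=> /(_ erefl); rewrite (lderive_ext (b := fun=> 0%N)) ?lderive0//.
  by move=> j jl; case: eqP jl => // ->; rewrite (negbTE il).
set V := (\int[lambda]_x (iter m (partial i) f x ^+ 2)%:E)%E in hi.
have V0 : (0 <= V)%E by apply: integral_ge0 => x _; rewrite lee_fin sqr_ge0.
have Vf : V = (fine V)%:E by rewrite fineK// ge0_fin_numE.
exists (2 * fine V + 2 * (m%:R * \sum_(k < m) C k)).
  rewrite addr_ge0// mulr_ge0// ?fine_ge0// mulr_ge0// sumr_ge0// => k _.
  exact: (hC k).1.
move=> z r zr; have r0 : 0 <= r by exact: le_trans (zr i).
rewrite (_ : (fun x => _) = (fun x => taylor_rem i m f (z ord0 i) (x + lshift l z) +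
  \sum_(k < m) z ord0 i ^+ k / k`!%:R * (iter k (partial i) f (x + lshift l z) -
      ltaylor l (m - k)%N (iter k (partial i) f) x z))); last first.
  apply/funext => x; rewrite /taylor_rem /= /lshift big_cons.
  rewrite (_ : \sum_(k < m) _ * (_ - _) =
    \sum_(k < m) z ord0 i ^+ k / k`!%:R * iter k (partial i) f (x + lshift l z) -
    \sum_(k < m) z ord0 i ^+ k / k`!%:R * ltaylor l (m - k)%N (iter k (partial i) f) x z).
    by rewrite -/(lshift l z) (addrC (z ord0 i *: _)) (addrA x) addrA subrK.
  by rewrite -sumrB; apply: eq_bigr => k _; rewrite mulrBr.
rewrite mulrDl -!mulrA; apply: sqint_leD.
  apply: sqint_le_shift; apply: sqint_le_rem => //; last by rewrite fine_ge0.
  by rewrite -Vf.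
have E : m%:R * ((\sum_(k < m) C k) * r ^+ (2 * m)) =
    #|'I_m|%:R * \sum_(k < m) (r ^+ k) ^+ 2 * (C k * r ^+ (2 * (m - k))).
  rewrite card_ord mulr_suml; congr (_ * _); apply: eq_bigr => k _.
  rewrite mulrCA -exprM -exprD; congr (_ * _ ^+ _).
  by rewrite (mulnC k) -mulnDr subnKC// ltnW.
rewrite E; apply: sqint_le_sum => k.
have := sqint_leZ (z ord0 i ^+ k / k`!%:R) ((hC k).2 z r zr).
move=> [h1 h2]; split => //; apply: (le_trans h2).
apply: ler_wpM2r; first by rewrite mulr_ge0 ?exprn_ge0// (hC k).1.
rewrite exprMn -[leRHS]mulr1; apply: ler_pM; rewrite ?sqr_ge0//.
  rewrite -[leLHS]real_normK ?num_real// lerXn2r ?nnegrE ?exprn_ge0// normrX.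
  by rewrite lerXn2r// nnegrE.
by rewrite exprVn invf_le1 ?exprn_gt0 ?ltr0n ?fact_gt0// expr_ge1// ler1n fact_gt0.
Qed.

End taylor_space.

(** * Kernels of higher order and the bias of smoothing *)

Section low_degree.
Context (R : realType) (d : nat).
Local Notation rV := 'rV[R]_d.
Implicit Types (f g : rV -> R) (x z : rV) (l : seq 'I_d).

(* polynomials without constant term and of degree less than m *)
Definition lowpoly (m : nat) g := exists2 s : seq (R * ('I_d -> nat)),
  all (fun p => (0 < mlen p.2 < m)%N) s &
  forall z, g z = \sum_(p <- s) p.1 * mpow z p.2.

Lemma lowpoly0 m : lowpoly m (fun=> 0).
Proof. by exists [::] => // z; rewrite big_nil. Qed.

Lemma lowpolyD m f g : lowpoly m f -> lowpoly m g -> lowpoly m (fun z => f z + g z).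
Proof.
move=> [s ls fs] [t lt gt]; exists (s ++ t); first by rewrite all_cat ls.
by move=> z; rewrite big_cat /= fs gt.
Qed.

Lemma lowpoly_sum m (I : Type) (s : seq I) (F : I -> rV -> R) :
  (forall i, lowpoly m (F i)) -> lowpoly m (fun z => \sum_(i <- s) F i z).
Proof.
move=> h; elim: s => [|i s IH].
  by rewrite (_ : (fun z => _) = fun=> 0); [exact: lowpoly0|apply/funext => z; rewrite big_nil].
rewrite (_ : (fun z => _) = fun z => F i z + \sum_(j <- s) F j z); first exact: lowpolyD.
by apply/funext => z; rewrite big_cons.
Qed.

Let addi (i : 'I_d) (k : nat) (a : 'I_d -> nat) j := (a j + (j == i) * k)%N.

Let mlen_addi i k a : mlen (addi i k a) = (mlen a + k)%N.
Proof.
rewrite /mlen big_split /=; congr (_ + _)%N.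
by rewrite (bigD1 i)//= eqxx mul1n big1 ?addn0// => j /negbTE ->; rewrite mul0n.
Qed.

Let mpow_addi i k a z : mpow z (addi i k a) = z ord0 i ^+ k * mpow z a.
Proof.
rewrite /mpow mulrC; under eq_bigr do rewrite exprD.
rewrite big_split /=; congr (_ * _).
by rewrite (bigD1 i)//= eqxx mul1n big1 ?mulr1// => j /negbTE ->; rewrite mul0n.
Qed.

Lemma lowpolyXM m i k (c : R) g : (k <= m)%N -> lowpoly (m - k) g ->
  lowpoly m (fun z => c * z ord0 i ^+ k * g z).
Proof.
move=> km [s ls gs]; exists [seq (c * p.1, addi i k p.2) | p <- s].
  rewrite all_map; apply: sub_all ls => p /= /andP[p0 pm].
  by rewrite mlen_addi; lia.
move=> z; rewrite big_map gs mulr_sumr; apply: eq_bigr => p _ /=.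
by rewrite mpow_addi; ring.
Qed.

Lemma lowpolyX m i k (c : R) : (0 < k < m)%N -> lowpoly m (fun z => z ord0 i ^+ k * c).
Proof.
move=> km; exists [:: (c, addi i k (fun=> 0%N))].
  by rewrite /= andbT mlen_addi /mlen big1.
by move=> z; rewrite big_seq1 /= mpow_addi /mpow big1 ?mulr1 1?mulrC// => j _; rewrite expr0.
Qed.

Lemma lowpoly_ltaylor l m f x : (0 < m)%N ->
  lowpoly m (fun z => ltaylor l m f x z - f x).
Proof.
elim: l m f => [|i l IH] m f m0 /=.
  by under eq_fun do rewrite subrr; exact: lowpoly0.
rewrite (_ : (fun z => _) = (fun z =>
  \sum_(k < m) k`!%:R^-1 * z ord0 i ^+ k *
     (ltaylor l (m - k)%N (iter k (partial i) f) x z - iter k (partial i) f x) +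
  \sum_(k < m.-1) z ord0 i ^+ k.+1 * (k.+1`!%:R^-1 * iter k.+1 (partial i) f x))); last first.
  apply/funext => z; case: m m0 => // m _ /=.
  set SA := \sum_(k < m.+1) _; pose SB := \sum_(k < m.+1) z ord0 i ^+ k / k`!%:R * iter k (partial i) f x.
  rewrite (_ : \sum_(k < m.+1) _ = SA - SB); last first.
    by rewrite -sumrB; apply: eq_bigr => k _; ring.
  rewrite (_ : SB = f x + \sum_(k < m) z ord0 i ^+ k.+1 * (k.+1`!%:R^-1 * iter k.+1 (partial i) f x)).
    by rewrite opprD addrA subrK.
  rewrite /SB big_ord_recl /= expr0 fact0 divr1 mul1r; congr (_ + _).
  by apply: eq_bigr => k _; rewrite mulrA.
apply: lowpolyD; apply: lowpoly_sum => k.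
  by apply: lowpolyXM; [exact: ltnW|apply: IH; rewrite subn_gt0].
by apply: lowpolyX; have := ltn_ord k; lia.
Qed.

End low_degree.

Section kernel_moments.
Context (R : realType) (d m : nat).
Local Notation rV := 'rV[R]_d.
Local Notation lambda := (lebesgue_rV R d).
Variable K : rV -> R.
Implicit Types z : rV.
Hypotheses (m_gt0 : (0 < m)%N) (Kker : is_kernel K) (Kord : kernel_order m K).

Definition amax (z : rV) : R := \big[Num.max/0]_i `|z ord0 i|.

Lemma amax_ge z i : `|z ord0 i| <= amax z.
Proof. by rewrite /amax (bigD1 i)//= le_max lexx. Qed.

Lemma amax_ge0 z : 0 <= amax z.
Proof. by rewrite /amax; elim/big_ind: _ => // a b a0 b0; rewrite le_max a0. Qed.

Lemma amaxX z : amax z ^+ m <= \sum_i `|z ord0 i| ^+ m.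
Proof.
rewrite /amax; elim/big_ind: _ => [|a b ha hb|i _].
- by rewrite expr0n; case: (m) m_gt0 => // *; rewrite sumr_ge0// => i _; rewrite exprn_ge0.
- by rewrite /Num.max; case: ifP.
- by rewrite (bigD1 i)//= lerDl sumr_ge0// => j _; rewrite exprn_ge0.
Qed.

Lemma measurable_amax : measurable_fun setT amax.
Proof.
rewrite /amax; elim: (index_enum _) => [|i s IH].
  by under eq_fun do rewrite big_nil; exact: measurable_cst.
under eq_fun do rewrite big_cons; apply: measurable_maxr => //.
by apply: (measurableT_comp (@normr_measurable R setT)); exact: measurable_rV_coord.
Qed.

Lemma measurable_mpow a : measurable_fun setT (fun z : rV => mpow z a).
Proof.
rewrite /mpow; apply: measurable_prod => i _; apply: measurable_funX.
exact: measurable_rV_coord.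
Qed.

Lemma kernel_integrable : lambda.-integrable setT (EFin \o K).
Proof. by case: Kker. Qed.

Lemma kernel_measurable : measurable_fun setT K.
Proof. by apply/measurable_EFinP; exact: measurable_int kernel_integrable. Qed.

Lemma kernel_sqint : sqint lambda K.
Proof.
split; first exact: kernel_measurable.
case: Kker => _ _ K2; apply/integrableP; split.
  by apply/measurable_EFinP; apply: measurable_funX; exact: kernel_measurable.
by under eq_integral do rewrite gee0_abs ?lee_fin ?sqr_ge0//.
Qed.

Lemma kernel_integral : \int[lambda]_z K z = 1.
Proof. by rewrite /Rintegral; case: Kker => _ ->. Qed.

Lemma kernel_amax_integrable : lambda.-integrable setT (EFin \o (fun z => `|K z| * amax z ^+ m)).
Proof.
have I i : lambda.-integrable setT (EFin \o (fun z => `|z ord0 i ^+ m * K z|)).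
  pose a (j : 'I_d) := ((j == i) * m)%N.
  have E z : mpow z a = z ord0 i ^+ m.
    rewrite /mpow (bigD1 i)//= /a eqxx mul1n big1 ?mulr1// => j /negbTE ->.
    by rewrite mul0n.
  have la : mlen a = m.
    by rewrite /mlen (bigD1 i)//= /a eqxx mul1n big1 ?addn0// => j /negbTE ->.
  apply/integrableP; split.
    apply/measurable_EFinP; apply: (measurableT_comp (@normr_measurable R setT)).
    apply: measurable_funM; last exact: kernel_measurable.
    by apply: measurable_funX; exact: measurable_rV_coord.
  have := Kord.2 a la; apply: le_lt_trans; rewrite le_eqVlt; apply/orP; left; apply/eqP.
  by apply: eq_integral => z _; rewrite E /= normr_id.
apply: (integrableR_le _ _ (integrableR_sum (index_enum 'I_d) (p := xpredT) (fun i _ => I i))).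
  apply: measurable_funM; first exact: (measurableT_comp (@normr_measurable R setT) kernel_measurable).
  by apply: measurable_funX; exact: measurable_amax.
move=> z; rewrite ger0_norm ?mulr_ge0 ?exprn_ge0 ?amax_ge0//.
under eq_bigr do rewrite normrM normrX.
by rewrite -mulr_suml mulrC ler_wpM2r// amaxX.
Qed.

Lemma mpow_amax z a : `|mpow z a| <= amax z ^+ mlen a.
Proof.
rewrite /mpow /mlen normr_prod -prodrXr; apply: ler_prod => i _.
by rewrite normr_ge0 normrX lerXn2r ?nnegrE ?amax_ge0// amax_ge.
Qed.

Lemma expr_le1D (r : R) k : 0 <= r -> (k <= m)%N -> r ^+ k <= 1 + r ^+ m.
Proof.
move=> r0 km; have [r1|r1] := leP r 1.
  by rewrite (le_trans (exprn_ile1 k r0 r1))// lerDl exprn_ge0.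
by rewrite (le_trans (ler_weXn2l (ltW r1) km))// lerDr.
Qed.

Lemma kernel_mpow_integrable a : (mlen a <= m)%N ->
  lambda.-integrable setT (EFin \o (fun z => mpow z a * K z)).
Proof.
move=> am.
have iK : lambda.-integrable setT (EFin \o (fun z => `|K z|)) by exact: integrable_abse kernel_integrable.
apply: (integrableR_le _ _ (integrableRD iK kernel_amax_integrable)).
  by apply: measurable_funM; [exact: measurable_mpow|exact: kernel_measurable].
move=> z; rewrite normrM mulrC -[X in X + _]mulr1 -mulrDr ler_wpM2l//.
by apply: (le_trans (mpow_amax z a)); exact: expr_le1D (amax_ge0 z) am.
Qed.

Lemma mpowZ (c : R) z (a : 'I_d -> nat) : mpow (c *: z) a = c ^+ mlen a * mpow z a.
Proof.
rewrite /mpow /mlen -prodrXr -big_split /=; apply: eq_bigr => i _.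
by rewrite mxE exprMn.
Qed.

Lemma kernel_lowpoly g (c : R) : lowpoly m g ->
  lambda.-integrable setT (EFin \o (fun z => K z * g (c *: z))) /\
  \int[lambda]_z (K z * g (c *: z)) = 0.
Proof.
move=> [s ls gs].
have E : (fun z => K z * g (c *: z)) =
    (fun z => \sum_(p <- s | (0 < mlen p.2 < m)%N) p.1 * c ^+ mlen p.2 * (mpow z p.2 * K z)).
  apply/funext => z; rewrite gs mulr_sumr big_seq_cond [RHS]big_seq_cond.
  rewrite [LHS](eq_bigl (fun p => (p \in s) && (0 < mlen p.2 < m)%N)); last first.
    move=> p; rewrite andbT; case: (boolP (p \in s)) => //= ps.
    by rewrite (allP ls _ ps).
  by apply: eq_bigr => p _; rewrite mpowZ; ring.
have I p : (0 < mlen p.2 < m)%N ->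
  lambda.-integrable setT (EFin \o (fun z => p.1 * c ^+ mlen p.2 * (mpow z p.2 * K z))).
  by move=> /andP[p0 pm]; apply: integrableRZ; apply: kernel_mpow_integrable; exact: ltnW.
rewrite E; split; first by apply: integrableR_sum => p; exact: I.
rewrite Rintegral_sumr//; apply: big1 => p /andP[p0 pm].
rewrite RintegralZl//; last by apply: kernel_mpow_integrable; exact: ltnW.
rewrite /Rintegral Kord.1 ?mulr0//.
by rewrite p0 /=; lia.
Qed.

End kernel_moments.

Section kernel_smoothing.
Context (R : realType) (d : nat).
Local Notation rV := 'rV[R]_d.
Local Notation lambda := (lebesgue_rV R d).
Variable K : rV -> R.
Hypothesis Kker : is_kernel K.
Implicit Types (x z : rV) (g : rV -> R).

Let mK := kernel_measurable Kker.
Let iK := kernel_integrable Kker.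

Definition kernel_l1 := \int[lambda]_z `|K z|.

Let iaK : lambda.-integrable setT (EFin \o (fun z => `|K z|)).
Proof. exact: integrable_abse iK. Qed.

Lemma kernel_l1_ge0 : 0 <= kernel_l1.
Proof. by apply: Rintegral_ge0. Qed.

(* For a symmetric kernel this is the convolution of g with h^-d K(./h), after the
   substitution y = x + h z. *)
Definition smoothing (h : R) g x := \int[lambda]_z (K z * g (x + h *: z)).

Lemma measurable_shift_scale (h : R) :
  measurable_fun setT (fun p : rV * rV => p.1 + h *: p.2).
Proof.
apply: measurable_fun_rV => i.
rewrite (_ : (fun _ => _) = (fun p : rV * rV => p.1 ord0 i + h * p.2 ord0 i)); last first.
  by apply/funext => p; rewrite !mxE.
apply: measurable_funD.
  exact: (measurableT_comp (@measurable_rV_coord R d i) measurable_fst).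
apply: measurable_funM => //.
exact: (measurableT_comp (@measurable_rV_coord R d i) measurable_snd).
Qed.

Section bounded.
Variables (h M : R) (g : rV -> R).
Hypotheses (mg : measurable_fun setT g) (gM : forall x, `|g x| <= M).

Let m2 : measurable_fun setT (fun p : rV * rV => K p.2 * g (p.1 + h *: p.2)).
Proof.
apply: measurable_funM; first exact: (measurableT_comp mK measurable_snd).
exact: (measurableT_comp mg (measurable_shift_scale h)).
Qed.

Lemma measurable_smoothing : measurable_fun setT (smoothing h g).
Proof. exact: (measurable_Rintegral_param lambda m2). Qed.

Let M0 : 0 <= M. Proof. exact: le_trans (gM point). Qed.

Lemma smoothing_integrable x :
  lambda.-integrable setT (EFin \o (fun z => K z * g (x + h *: z))).
Proof.
apply: (integrableR_le _ _ (integrableRZ M iaK)).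
  exact: (measurableT_comp m2 (pair1_measurable x)).
by move=> z; rewrite normrM mulrC ler_wpM2r.
Qed.

Lemma smoothing_bounded x : `|smoothing h g x| <= M * kernel_l1.
Proof.
apply: (le_trans (le_normr_Rintegral measurableT (smoothing_integrable x))).
rewrite -RintegralZl//; apply: le_Rintegral => //.
- exact: (integrable_abse (smoothing_integrable x)).
- exact: integrableRZ.
- by move=> z _; rewrite normrM mulrC ler_wpM2r.
Qed.

Lemma smoothing_sq x : (smoothing h g x) ^+ 2 <=
  kernel_l1 * \int[lambda]_z (`|K z| * g (x + h *: z) ^+ 2).
Proof.
pose f1 z := Num.sqrt `|K z|; pose f2 z := Num.sqrt `|K z| * `|g (x + h *: z)|.
have mgx : measurable_fun setT (fun z => g (x + h *: z)).
  exact: (measurableT_comp mg (measurableT_comp (measurable_shift_scale h) (pair1_measurable x))).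
have maK : measurable_fun setT (fun z => `|K z|).
  exact: (measurableT_comp (@normr_measurable R setT) mK).
have mf1 : measurable_fun setT f1.
  by apply: (measurableT_comp _ maK); apply: continuous_measurable_fun; exact: sqrt_continuous.
have E1 z : f1 z ^+ 2 = `|K z| by rewrite sqr_sqrtr.
have E2 z : f2 z ^+ 2 = `|K z| * g (x + h *: z) ^+ 2.
  by rewrite exprMn sqr_sqrtr// real_normK// num_real.
have s1 : sqint lambda f1 by split => //; under eq_fun do rewrite E1.
have s2 : sqint lambda f2.
  split.
    apply: measurable_funM => //.
    exact: (measurableT_comp (@normr_measurable R setT) mgx).
  under eq_fun do rewrite E2.
  apply: (integrableR_le _ _ (integrableRZ (M ^+ 2) iaK)).
    by apply: measurable_funM => //; exact: measurable_funX.
  move=> z; rewrite normrM normr_id mulrC ler_wpM2r// normrX.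
  by rewrite lerXn2r// nnegrE.
have := cauchy_schwarz_R s1 s2.
under [in X in _ <= X -> _]eq_Rintegral do rewrite E1.
under [in X in _ <= _ * X -> _]eq_Rintegral do rewrite E2.
move=> h1; apply: le_trans h1.
rewrite -[leLHS]real_normK ?num_real// lerXn2r ?nnegrE//.
  by apply: Rintegral_ge0 => z _; rewrite /f1 /f2 !mulr_ge0 ?sqrtr_ge0.
apply: (le_trans (le_normr_Rintegral measurableT (smoothing_integrable x))).
apply: le_Rintegral => //.
- exact: (integrable_abse (smoothing_integrable x)).
- exact: sqint_mul.
- by move=> z _; rewrite /f1 /f2 mulrA -expr2 sqr_sqrtr// normrM.
Qed.

Lemma smoothing_sqint_le c : sqint_le g c -> sqint_le (smoothing h g) (kernel_l1 ^+ 2 * c).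
Proof.
move=> gc; have c0 : 0 <= c by exact: le_trans (Rintegral_sq_ge0 _ _) gc.2.
apply: sqint_le_integral; first exact: measurable_smoothing.
pose F (p : rV * rV) := (`|K p.2| * g (p.1 + h *: p.2) ^+ 2)%:E.
have F0 p : (0 <= F p)%E by rewrite lee_fin mulr_ge0// sqr_ge0.
have mF : measurable_fun setT F.
  apply/measurable_EFinP; apply: measurable_funM.
    exact: (measurableT_comp (@normr_measurable R setT) (measurableT_comp mK measurable_snd)).
  by apply: measurable_funX; exact: (measurableT_comp mg (measurable_shift_scale h)).
apply: (@le_trans _ _ (\int[lambda]_x (kernel_l1%:E * \int[lambda]_z F (x, z)))%E).
  apply: ge0_le_integral => //.
  - by move=> x _; rewrite lee_fin sqr_ge0.
  - apply/measurable_EFinP; apply: measurable_funX; exact: measurable_smoothing.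
  - apply: emeasurable_funM => //.
    exact: (measurable_fun_fubini_tonelli_F (m2 := lambda) _ mF F0).
  move=> x _.
  have iF : lambda.-integrable setT (fun z => F (x, z)).
    apply: (integrableR_le (f := fun z => `|K z| * g (x + h *: z) ^+ 2) _ _ (integrableRZ (M ^+ 2) iaK)).
      by apply/measurable_EFinP; exact: (measurableT_comp mF (pair1_measurable x)).
    move=> z; rewrite normrM normr_id mulrC ler_wpM2r// normrX.
    by rewrite lerXn2r// nnegrE.
  rewrite -(fineK (integrable_fin_num measurableT iF)) -EFinM lee_fin.
  exact: smoothing_sq.
rewrite ge0_integralZl//; last 3 first.
- exact: (measurable_fun_fubini_tonelli_F (m2 := lambda) _ mF F0).
- by move=> x _; apply: integral_ge0.
- by rewrite lee_fin kernel_l1_ge0.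
rewrite (fubini_tonelli (m1 := lambda) (m2 := lambda) _ mF F0) expr2 -mulrA EFinM.
apply: lee_wpmul2l; first by rewrite lee_fin kernel_l1_ge0.
apply: (@le_trans _ _ (\int[lambda]_z (`|K z| * c)%:E)%E).
  apply: ge0_le_integral => //.
  - by move=> z _; apply: integral_ge0.
  - exact: (measurable_fun_fubini_tonelli_G (m1 := lambda) _ mF F0).
  - by apply/measurable_EFinP; apply: measurable_funM => //; apply: (measurableT_comp (@normr_measurable R setT)).
  move=> z _; have [[mgz igz] hgz] := sqint_le_shift (h *: z) gc.
  under eq_integral do rewrite /F /= EFinM.
  rewrite ge0_integralZl//.
  - rewrite EFinM lee_wpmul2l//.
    by rewrite -(fineK (integrable_fin_num measurableT igz)) lee_fin.
  - by apply/measurable_EFinP; exact: measurable_funX.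
  - by move=> x _; rewrite lee_fin sqr_ge0.
under eq_integral do rewrite EFinM muleC.
rewrite integralZl// muleC EFinM lee_wpmul2r ?lee_fin//.
by rewrite /kernel_l1 /Rintegral fineK//; exact: (integrable_fin_num measurableT iaK).
Qed.

End bounded.

End kernel_smoothing.

Lemma sqint_norm d (T : measurableType d) (R : realType)
  (mu : {measure set T -> \bar R}) (f : T -> R) :
  sqint mu f -> sqint mu (fun x => `|f x|) /\
  \int[mu]_x (`|f x| ^+ 2) = \int[mu]_x (f x ^+ 2).
Proof.
move=> [mf hf]; have E : (fun x => `|f x| ^+ 2) = (fun x => f x ^+ 2).
  by apply/funext => x; rewrite real_normK// num_real.
split; last by rewrite E.
split; last by rewrite E.
exact: (measurableT_comp (@normr_measurable R setT) mf).
Qed.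

Lemma sqint_norm_mul_le d (T : measurableType d) (R : realType)
  (mu : {measure set T -> \bar R}) (f g : T -> R) (a b : R) : 0 <= a -> 0 <= b ->
  sqint mu f -> sqint mu g ->
  \int[mu]_x (f x ^+ 2) <= a ^+ 2 -> \int[mu]_x (g x ^+ 2) <= b ^+ 2 ->
  \int[mu]_x (`|f x| * `|g x|) <= a * b.
Proof.
move=> a0 b0 /sqint_norm[sf ef] /sqint_norm[sg eg] fa gb.
have := cauchy_schwarz_R sf sg; rewrite ef eg => h.
rewrite -(@ler_pXn2r _ 2)// ?nnegrE ?mulr_ge0//; last first.
  by apply: Rintegral_ge0 => x _; rewrite mulr_ge0.
rewrite exprMn; apply: (le_trans h); apply: ler_pM => //; exact: Rintegral_sq_ge0.
Qed.

Section smoothing_bias.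
Context (R : realType) (d m : nat).
Local Notation rV := 'rV[R]_d.
Local Notation lambda := (lebesgue_rV R d).
Variables (K eta : rV -> R) (M : R).
Hypotheses (m_gt0 : (0 < m)%N) (Kker : is_kernel K) (Kord : kernel_order m K)
  (eta_Cm : Cn m eta) (etaM : forall x, `|eta x| <= M) (eta_sq : sqint lambda eta)
  (eta_L2 : forall a : 'I_d -> nat, mlen a = m ->
     (\int[lambda]_x (mderive a eta x ^+ 2)%:E < +oo)%E).

Definition smoothing_bias h x := smoothing K h eta x - eta x.

Let meta : measurable_fun setT eta := eta_sq.1.

Let coords := rev (enum 'I_d).

Let lshift_coords z : @lshift R d coords z = z.
Proof.
rewrite /lshift /coords (perm_big (enum 'I_d)) ?perm_rev//.
by rewrite big_enum; exact/esym/row_sum_delta.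
Qed.

Let lderive_coords a f : @lderive R d coords a f = mderive a f.
Proof. by rewrite /lderive /coords foldl_rev. Qed.

Lemma sqint_smoothing_bias h : sqint lambda (smoothing_bias h).
Proof.
apply: sqintB => //.
exact: (smoothing_sqint_le Kker h meta etaM (conj eta_sq (lexx _))).1.
Qed.

Lemma smoothing_bias_le : exists2 C : R, 0 <= C &
  forall h, \int[lambda]_x (smoothing_bias h x ^+ 2) <= C * `|h| ^+ (2 * m).
Proof.
have [C C0 hC] : exists2 C : R, 0 <= C & forall (z : rV) (r : R), (forall i, `|z ord0 i| <= r) ->
    sqint_le (fun x => eta (x + lshift coords z) - ltaylor coords m eta x z) (C * r ^+ (2 * m)).
  apply: ltaylor_rem => //; first by rewrite rev_uniq enum_uniq.
  move=> a ha; rewrite lderive_coords; apply: eta_L2.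
  rewrite /mlen -ha /coords; apply/esym.
  by rewrite (perm_big (enum 'I_d)) ?perm_rev// big_enum.
pose Rm x z := eta (x + z) - ltaylor coords m eta x z.
have mRm : measurable_fun setT (fun p : rV * rV => Rm p.1 p.2).
  apply: measurable_funB; last exact: measurable_ltaylor.
  apply: (measurableT_comp meta).
  have := @measurable_shift_scale R d 1.
  by under eq_fun do rewrite scale1r.
have hR z : sqint_le (Rm^~ z) (C * amax z ^+ (2 * m)).
  have := hC z (amax z) (amax_ge z).
  by under eq_fun do rewrite lshift_coords.
have mKer := kernel_measurable Kker.
pose A := \int[lambda]_z (`|K z| * amax z ^+ m).
have iA := kernel_amax_integrable m_gt0 Kker Kord.
have A0 : 0 <= A.
  by apply: Rintegral_ge0 => z _; rewrite mulr_ge0// exprn_ge0// amax_ge0.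
exists (C * A ^+ 2); first by rewrite mulr_ge0// sqr_ge0.
move=> h; set B := smoothing_bias h; have sB : sqint lambda B := sqint_smoothing_bias h.
have BE x : lambda.-integrable setT (EFin \o (fun z => K z * Rm x (h *: z))) /\
    B x = \int[lambda]_z (K z * Rm x (h *: z)).
  have [i2 e2] := kernel_lowpoly m_gt0 Kker Kord h (lowpoly_ltaylor coords eta x m_gt0).
  have i1 := smoothing_integrable Kker h meta etaM x.
  have i3 := integrableRZ (eta x) (kernel_integrable Kker).
  have E : (fun z => K z * Rm x (h *: z)) = (fun z => K z * eta (x + h *: z) -
      K z * (ltaylor coords m eta x (h *: z) - eta x) - eta x * K z).
    by apply/funext => z; rewrite /Rm; ring.
  split; first by rewrite E; apply: integrableRB => //; exact: integrableRB.
  rewrite E RintegralB//; last exact: integrableRB.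
  rewrite RintegralB// e2 subr0 RintegralZl//; last exact: kernel_integrable.
  by rewrite (kernel_integral Kker) mulr1.
set V := \int[lambda]_x (B x ^+ 2).
have V0 : 0 <= V by exact: Rintegral_sq_ge0.
pose k := Num.sqrt C * `|h| ^+ m * A.
have k0 : 0 <= k by rewrite !mulr_ge0 ?sqrtr_ge0 ?exprn_ge0.
have mB : measurable_fun setT B := sB.1.
pose F (p : rV * rV) := (`|B p.1| * (`|K p.2| * `|Rm p.1 (h *: p.2)|))%:E.
have F0 p : (0 <= F p)%E by rewrite lee_fin !mulr_ge0.
have mF : measurable_fun setT F.
  have nm := @normr_measurable R setT.
  apply/measurable_EFinP; apply: measurable_funM.
    exact: (measurableT_comp nm (measurableT_comp mB measurable_fst)).
  apply: measurable_funM.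
    exact: (measurableT_comp nm (measurableT_comp mKer measurable_snd)).
  apply: (measurableT_comp nm).
  have ms : measurable_fun setT (fun p : rV * rV => (p.1, h *: p.2)).
    apply/measurable_fun_pairP; split; first exact: measurable_fst.
    apply: measurable_fun_rV => i.
    rewrite (_ : (fun _ => _) = (fun p : rV * rV => h * p.2 ord0 i)); last first.
      by apply/funext => p; rewrite !mxE.
    apply: measurable_funM => //.
    exact: (measurableT_comp (@measurable_rV_coord R d i) measurable_snd).
  exact: (measurableT_comp mRm ms).
have step1 : (V%:E <= \int[lambda]_x \int[lambda]_z F (x, z))%E.
  rewrite /V /Rintegral fineK; last exact: (integrable_fin_num measurableT sB.2).
  apply: ge0_le_integral => //.
  - by move=> x _; rewrite lee_fin sqr_ge0.
  - by apply/measurable_EFinP; exact: measurable_funX.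
  - exact: (measurable_fun_fubini_tonelli_F (m2 := lambda) _ mF F0).
  move=> x _; have [i1 e1] := BE x.
  have E : (fun z => F (x, z)) = EFin \o (fun z => `|B x| * `|K z * Rm x (h *: z)|).
    by apply/funext => z; rewrite /F /= normrM.
  have ia : lambda.-integrable setT (EFin \o (fun z => `|K z * Rm x (h *: z)|)).
    exact: (integrable_abse i1).
  have iF := integrableRZ `|B x| ia.
  rewrite E -(fineK (integrable_fin_num measurableT iF)) lee_fin.
  have := le_normr_Rintegral measurableT i1; rewrite -e1 => h1.
  rewrite -[fine _]/(\int[lambda]_z (`|B x| * `|K z * Rm x (h *: z)|)) RintegralZl//.
  by rewrite -real_normK ?num_real// expr2 ler_wpM2l.
have step2 : (\int[lambda]_x \int[lambda]_z F (x, z) <= (k * Num.sqrt V)%:E)%E.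
  rewrite (fubini_tonelli (m1 := lambda) (m2 := lambda) _ mF F0).
  apply: (@le_trans _ _ (\int[lambda]_z ((Num.sqrt V * (Num.sqrt C * `|h| ^+ m)) *
     (`|K z| * amax z ^+ m))%:E)%E); last first.
    have iA2 := integrableRZ (Num.sqrt V * (Num.sqrt C * `|h| ^+ m)) iA.
    rewrite -(fineK (integrable_fin_num measurableT iA2)) lee_fin.
    rewrite -[fine _]/(\int[lambda]_z ((Num.sqrt V * (Num.sqrt C * `|h| ^+ m)) *
     (`|K z| * amax z ^+ m))) RintegralZl// -/A /k.
    by rewrite -!mulrA mulrC -!mulrA.
  apply: ge0_le_integral => //.
  - by move=> z _; apply: integral_ge0.
  - exact: (measurable_fun_fubini_tonelli_G (m1 := lambda) _ mF F0).
  - apply/measurable_EFinP; apply: measurable_funM => //; apply: measurable_funM.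
      exact: (measurableT_comp (@normr_measurable R setT)).
    by apply: measurable_funX; exact: measurable_amax.
  move=> z _; have [sR lR] := hR (h *: z).
  have amaxZ : amax (h *: z) <= `|h| * amax z.
    rewrite /amax; elim/big_ind: _ => [|a b ha hb|i _].
    - by rewrite mulr_ge0// amax_ge0.
    - by rewrite ge_max ha.
    - by rewrite mxE normrM ler_wpM2l// amax_ge.
  have lR' : \int[lambda]_x (Rm x (h *: z) ^+ 2) <= (Num.sqrt C * (`|h| * amax z) ^+ m) ^+ 2.
    apply: (le_trans lR); rewrite exprMn sqr_sqrtr// -exprM mulnC ler_wpM2l//.
    by rewrite lerXn2r// nnegrE ?mulr_ge0 ?amax_ge0.
  have lB : \int[lambda]_x (B x ^+ 2) <= Num.sqrt V ^+ 2 by rewrite sqr_sqrtr.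
  have r0 : 0 <= Num.sqrt C * (`|h| * amax z) ^+ m.
    by rewrite mulr_ge0 ?sqrtr_ge0// exprn_ge0// mulr_ge0// amax_ge0.
  have := sqint_norm_mul_le (sqrtr_ge0 V) r0 sB sR lB lR'.
  have iBR := sqint_mul (sqint_norm sB).1 (sqint_norm sR).1.
  have iF := integrableRZ `|K z| iBR.
  rewrite (_ : (fun x => F (x, z)) = EFin \o (fun x => `|K z| * (`|B x| * `|Rm x (h *: z)|))); last first.
    by apply/funext => x; rewrite /F /= mulrCA.
  rewrite -(fineK (integrable_fin_num measurableT iF)) lee_fin => h1.
  rewrite -[fine _]/(\int[lambda]_x (`|K z| * (`|B x| * `|Rm x (h *: z)|))) RintegralZl//.
  apply: (le_trans (ler_wpM2l (normr_ge0 (K z)) h1)); rewrite exprMn le_eqVlt.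
  by apply/orP; left; apply/eqP; ring.
have : V <= k * Num.sqrt V by rewrite -lee_fin; exact: le_trans step2.
have VE : Num.sqrt V ^+ 2 = V by rewrite sqr_sqrtr.
have s0 := sqrtr_ge0 V.
move=> hV; have hs : Num.sqrt V <= k.
  have [//|ks] := leP (Num.sqrt V) k.
  have sp : 0 < Num.sqrt V by exact: le_lt_trans ks.
  by move: hV; rewrite -{1}VE expr2 ler_pM2r// leNgt ks.
rewrite -VE; apply: (@le_trans _ _ (k ^+ 2)); first by rewrite lerXn2r// nnegrE.
by rewrite /k !exprMn sqr_sqrtr// -exprM mulnC mulrAC.
Qed.

End smoothing_bias.

(** * Nondegeneracy of the limit variance *)

Section nondegeneracy.
Context (R : realType) (d : nat) (d_gt0 : (0 < d)%N).
Local Notation rV := 'rV[R]_d.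
Local Notation lambda := (lebesgue_rV R d).

Lemma lebesgue_rV_cube (x : rV) (r : R) : 0 <= r ->
  lambda (rbox (fun i => `[x ord0 i - r, x ord0 i + r]%classic)) = ((2 * r) ^+ d)%:E.
Proof.
move=> r0; rewrite /rbox.
have E := lebesgue_rV_box (A := fun i => `[x ord0 i - r, x ord0 i + r]%classic : set (measurableTypeR R))
  (fun=> measurable_itv _).
rewrite [LHS]E.
have -> : ((2 * r) ^+ d)%:E = (\prod_(i < d) (2 * r)%:E)%E.
  by rewrite prodEFin prodr_const card_ord.
apply: eq_bigr => i _; rewrite lebesgue_measure_itv/= lte_fin.
case: ltP => h; first by rewrite -EFinD; congr EFin; ring.
by congr EFin; lra.
Qed.

Lemma continuous_ge0_integral0 (g : rV -> R) : continuous g -> (forall x, 0 <= g x) ->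
  (\int[lambda]_x (g x)%:E = 0)%E -> forall x, g x = 0.
Proof.
move=> cg g0 ig x; apply/eqP; rewrite eq_le g0 andbT leNgt; apply/negP => gx.
have e0 : 0 < g x / 2 by exact: divr_gt0.
have : nbhs x [set y | g x / 2 < g y].
  have /cvgrPdist_lt := cg x; move=> /(_ _ e0); apply: filterS => y /=.
  by rewrite ltr_norml => /andP[_ h]; lra.
move=> /nbhs_ballP[r /= r0 hr].
pose D := rbox (fun i => `[x ord0 i - r / 2, x ord0 i + r / 2]%classic : set (measurableTypeR R)).
have mD : measurable D by apply: measurable_rbox => i; exact: measurable_itv.
have Dg y : D y -> g x / 2 <= g y.
  move=> Dy; apply/ltW/hr; split => // i j; rewrite (ord1 i) /ball/= distrC.
  have := Dy j; rewrite /= in_itv/= -ler_distl => h; apply: (le_lt_trans h).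
  by rewrite ltr_pdivrMr// ltr_pMr// ltr1n.
have mg := continuous_measurable_rV cg.
have : ((g x / 2 * (2 * (r / 2)) ^+ d)%:E <= \int[lambda]_x (g x)%:E)%E.
  rewrite EFinM -(lebesgue_rV_cube x); last by rewrite divr_ge0// ltW.
  rewrite -/D -integral_cst//.
  apply: (@le_trans _ _ (\int[lambda]_(x in D) (g x)%:E)%E).
    apply: ge0_le_integral => //.
    - by move=> y _; rewrite lee_fin ltW.
    - by apply: measurable_funTS; exact/measurable_EFinP.
  apply: ge0_subset_integral => //.
  - exact/measurable_EFinP.
  - by move=> y _; rewrite lee_fin.
rewrite ig lee_fin leNgt mulr_gt0// exprn_gt0// mulr_gt0// divr_gt0//.
Qed.

Variables (P0 : probability rV R) (eta : rV -> R) (M : R).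
Hypotheses (P0_dom : P0 `<< lambda) (P0_eta : is_density P0 eta)
  (etaM : forall x, `|eta x| <= M) (ceta : continuous eta).

Let eta_ge0 x : 0 <= eta x. Proof. by case: P0_eta. Qed.
Let meta : measurable_fun setT eta. Proof. by case: P0_eta. Qed.

Lemma evar_gt0 : 0 < evar P0 eta.
Proof.
have sP := sqint_bounded P0 meta etaM.
set psi := \int[P0]_x eta x.
have V := Rintegral_var sP; rewrite -/psi in V.
rewrite /evar -/psi -V lt_neqAle Rintegral_sq_ge0 andbT; apply/eqP => V0.
have sc : sqint P0 (fun x => eta x - psi) by apply: sqintB => //; exact: sqint_cst.
pose g x := (eta x - psi) ^+ 2 * eta x.
have cg : continuous g.
  have h : continuous (fun y : rV => eta y - psi).
    by move=> y; apply: (@cvgB _ _ _ (nbhs y)); [exact: ceta|exact: cvg_cst].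
  move=> x; apply: (@cvgM _ _ (nbhs x)); last exact: ceta.
  by apply: (@cvgM _ _ (nbhs x)); exact: (h x).
have g0 x : 0 <= g x by rewrite mulr_ge0 ?sqr_ge0.
have ig : (\int[lambda]_x (g x)%:E = 0)%E.
  have := ge0_integral_density P0_dom P0_eta (f := fun x => ((eta x - psi) ^+ 2)%:E).
  rewrite /g; under [in RHS]eq_integral do rewrite -EFinM.
  move=> <-.
  - have := V0; rewrite /Rintegral => /esym h.
    by rewrite -(fineK (integrable_fin_num measurableT sc.2)) h.
  - by apply/measurable_EFinP; apply: measurable_funX; exact: sc.1.
  - by move=> x; rewrite lee_fin sqr_ge0.
have g_0 := continuous_ge0_integral0 cg g0 ig.
have eta2 x : eta x = 0 \/ eta x = psi.
  have /eqP := g_0 x; rewrite /g mulf_eq0 expf_eq0 /= subr_eq0.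
  by case/orP => /eqP; [right|left].
have P1 : (\int[lambda]_x (eta x)%:E = 1)%E.
  by case: P0_eta => _ _ /(_ _ measurableT) <-; exact: probability_setT.
have [x0 ex0] : exists x0, eta x0 != 0.
  apply: contrapT => h; have : (\int[lambda]_x (eta x)%:E = 0)%E.
    apply: integral0_eq => x _; congr EFin; apply/eqP; apply: contrapT => ex.
    by apply: h; exists x; apply/negP.
  by rewrite P1 => /eqP; rewrite onee_eq0.
have ex0' : eta x0 = psi by case: (eta2 x0) => // h; rewrite h eqxx in ex0.
have psi0 : 0 < psi by rewrite lt_neqAle -ex0' eta_ge0 eq_sym ex0.
have etaE x : eta x = psi.
  case: (eta2 x) => // ex.
  pose f (t : R) := eta (x0 + t *: (x - x0)).
  have cf : continuous f.
    move=> t; apply: (@continuous_comp _ _ _ (fun t : R => x0 + t *: (x - x0)) eta); last exact: ceta.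
    apply: cvgD; first exact: cvg_cst.
    by apply: cvgZr_tmp; exact: cvg_id.
  have f0 : f 0 = psi by rewrite /f scale0r addr0.
  have f1 : f 1 = 0 by rewrite /f scale1r addrC subrK.
  have [t _ ft] : exists2 c, c \in `[0%R, 1%R] & f c = psi / 2.
    apply: IVT => //; first exact: continuous_subspaceT.
    rewrite f0 f1 ge_min le_max; apply/andP; split; apply/orP.
      by right; rewrite divr_ge0// ltW.
    by left; rewrite ler_pdivrMr// ler_pMr// ler1n.
  have := eta2 (x0 + t *: (x - x0)); rewrite -/(f t) ft => -[]; lra.
have [k hk] : exists k : nat, psi^-1 < k.+1%:R.
  exists (Num.trunc psi^-1); exact: truncnS_gt.
pose D := rbox (fun i => `[(0 : rV) ord0 i - k.+1%:R, (0 : rV) ord0 i + k.+1%:R]%classic : set (measurableTypeR R)).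
have mD : measurable D by apply: measurable_rbox => i; exact: measurable_itv.
have : (P0 D <= 1)%E by exact: probability_le1.
case: P0_eta => _ _ ->//.
under eq_integral do rewrite etaE.
rewrite integral_cst// [X in (_ * X)%E](lebesgue_rV_cube 0 (ler0n R k.+1)) -EFinM lee_fin.
rewrite leNgt => /negP; apply.
apply: (@lt_le_trans _ _ (psi * k.+1%:R)); first by rewrite mulrC -ltr_pdivrMr// div1r.
rewrite ler_pM2l//; apply: (@le_trans _ _ (2 * k.+1%:R)).
  by rewrite ler_peMl// ler1n.
by rewrite ler_eXnr// -natrM ler1n.
Qed.

End nondegeneracy.

Lemma Rintegral_fubini d1 d2 (T1 : measurableType d1) (T2 : measurableType d2) (R : realType)
  (m1 : {sigma_finite_measure set T1 -> \bar R}) (m2 : {sigma_finite_measure set T2 -> \bar R})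
  (f : T1 * T2 -> R) : measurable_fun setT f ->
  (\int[m1]_x \int[m2]_y `|(f (x, y))%:E| < +oo)%E ->
  (forall x, m2.-integrable setT (fun y => (f (x, y))%:E)) ->
  (forall y, m1.-integrable setT (fun x => (f (x, y))%:E)) ->
  \int[m1]_x \int[m2]_y f (x, y) = \int[m2]_y \int[m1]_x f (x, y).
Proof.
move=> mf fi i1 i2.
have If : (m1 \x m2)%E.-integrable setT (EFin \o f).
  apply/integrable12ltyP => //; exact/measurable_EFinP.
rewrite /Rintegral; congr fine.
transitivity (\int[m1]_x \int[m2]_y (f (x, y))%:E)%E.
  by apply: eq_integral => x _; rewrite fineK//; exact: (integrable_fin_num measurableT (i1 x)).
transitivity (\int[m2]_y \int[m1]_x (f (x, y))%:E)%E; first exact: (Fubini If).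
by apply: eq_integral => y _; rewrite fineK//; exact: (integrable_fin_num measurableT (i2 y)).
Qed.

(** * The kernels of the three estimators *)

Section pair_kernels.
Context (R : realType) (d : nat).
Local Notation rV := 'rV[R]_d.
Local Notation lambda := (lebesgue_rV R d).
Variables (K : rV -> R) (h : R).
Hypotheses (Kker : is_kernel K) (Ksym : symmetric_kernel K) (h0 : 0 < h).
Implicit Types (x y t z : rV) (f g : rV -> R).
Local Notation S := (smoothing K h).

Definition kern x y := h ^- d * K (h^-1 *: (x - y)).

Definition kernel_l2 := \int[lambda]_z (K z ^+ 2).

Let mK := kernel_measurable Kker.
Let iK := kernel_integrable Kker.
Let nm := @normr_measurable R setT.

Let hd0 : 0 < h ^+ d. Proof. exact: exprn_gt0. Qed.
Let a0 : - h^-1 != 0 :> R. Proof. by rewrite oppr_eq0 invr_eq0 gt_eqF. Qed.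

Lemma kernC x y : kern x y = kern y x.
Proof. by rewrite /kern -(Ksym (h^-1 *: (y - x))) -scalerN opprB. Qed.

Lemma kern_diag x : kern x x = h ^- d * K 0.
Proof. by rewrite /kern subrr scaler0. Qed.

Let kernE x : kern x = fun y => h ^- d * K ((- h^-1) *: y + h^-1 *: x).
Proof. by apply/funext => y; rewrite /kern scalerBr scaleNr addrC. Qed.

Lemma measurable_kern : measurable_fun setT (fun p : rV * rV => kern p.1 p.2).
Proof.
apply: measurable_funM => //; apply: (measurableT_comp mK).
apply: measurable_fun_rV => i.
rewrite (_ : (fun _ => _) = (fun p : rV * rV => h^-1 * (p.1 ord0 i - p.2 ord0 i))); last first.
  by apply/funext => p; rewrite !mxE.
apply: measurable_funM => //; apply: measurable_funB.
  exact: (measurableT_comp (@measurable_rV_coord R d i) measurable_fst).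
exact: (measurableT_comp (@measurable_rV_coord R d i) measurable_snd).
Qed.

Lemma measurable_kern1 x : measurable_fun setT (kern x).
Proof. exact: (measurableT_comp measurable_kern (pair1_measurable x)). Qed.

Let affE f b : measurable_fun setT f -> lambda.-integrable setT (EFin \o f) ->
  \int[lambda]_y f ((- h^-1) *: y + b) = h ^+ d * \int[lambda]_z f z.
Proof.
move=> mf fi; rewrite (Rintegral_affine b a0 mf fi) normrN gtr0_norm ?invr_gt0//.
by rewrite exprVn invrK.
Qed.

Lemma kern_integrable x : lambda.-integrable setT (EFin \o kern x).
Proof. by rewrite kernE; apply: integrableRZ; exact: integrable_affine. Qed.

Lemma kern_norm x : \int[lambda]_y `|kern x y| = kernel_l1 K.
Proof.
rewrite kernE; under eq_Rintegral do rewrite normrM ger0_norm ?invr_ge0 ?(ltW hd0)//.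
have maK : measurable_fun setT (fun z => `|K z|) := measurableT_comp nm mK.
have iaK : lambda.-integrable setT (EFin \o (fun z => `|K z|)) := integrable_abse iK.
rewrite RintegralZl//; last exact: (integrable_affine _ a0 maK iaK).
by rewrite (affE (f := fun z => `|K z|))// mulKf// gt_eqF.
Qed.

Let mK2 : measurable_fun setT (fun z => K z ^+ 2). Proof. exact: measurable_funX. Qed.
Let iK2 : lambda.-integrable setT (EFin \o (fun z => K z ^+ 2)).
Proof. exact: (kernel_sqint Kker).2. Qed.

Lemma kern_sqint x : sqint lambda (kern x).
Proof.
split; first exact: measurable_kern1.
rewrite kernE; under eq_fun do rewrite exprMn.
by apply: integrableRZ; exact: (integrable_affine _ a0 mK2 iK2).
Qed.

Lemma kern_sq x : \int[lambda]_y (kern x y ^+ 2) = h ^- d * kernel_l2.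
Proof.
rewrite kernE; under eq_Rintegral do rewrite exprMn.
rewrite RintegralZl//; last exact: (integrable_affine _ a0 mK2 iK2).
rewrite (affE (f := fun z => K z ^+ 2))//= expr2 -mulrA; congr (_ * _).
by rewrite mulKf// gt_eqF.
Qed.

Section bounded.
Variables (M : R) (g : rV -> R).
Hypotheses (mg : measurable_fun setT g) (gM : forall x, `|g x| <= M).

Lemma kern_mul_integrable x : lambda.-integrable setT (EFin \o (fun y => kern x y * g y)).
Proof.
apply: (integrableR_le _ _ (integrableRZ M (integrable_abse (kern_integrable x)))).
  by apply: measurable_funM => //; exact: measurable_kern1.
by move=> y; rewrite normrM mulrC ler_wpM2r.
Qed.

Lemma kern_smoothing x : \int[lambda]_y (kern x y * g y) = S g x.
Proof.
have mf : measurable_fun setT (fun y => kern x y * g y).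
  by apply: measurable_funM => //; exact: measurable_kern1.
have h' : h != 0 by rewrite gt_eqF.
have := Rintegral_affine x h' mf (kern_mul_integrable x).
rewrite gtr0_norm// (_ : (fun y : rV => _) = (fun z => h ^- d * (K z * g (x + h *: z)))).
  rewrite RintegralZl//; last exact: (smoothing_integrable Kker h mg gM x).
  by move=> /mulfI <-//; rewrite invr_eq0 gt_eqF.
apply/funext => z; rewrite /kern opprD addrC addrAC -addrA addrN ?addr0.
by rewrite scalerN scalerA mulVf// scale1r Ksym -mulrA (addrC x).
Qed.

End bounded.

Lemma smoothing_adjoint (M : R) f g : measurable_fun setT f -> measurable_fun setT g ->
  (forall x, `|f x| <= M) -> (forall x, `|g x| <= M) ->
  lambda.-integrable setT (EFin \o f) ->
  \int[lambda]_x (f x * S g x) = \int[lambda]_x (S f x * g x).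
Proof.
move=> mf mg fM gM fi.
have M0 : 0 <= M by exact: le_trans (fM point).
pose F (p : rV * rV) := f p.1 * (kern p.1 p.2 * g p.2).
have mF : measurable_fun setT F.
  apply: measurable_funM; first exact: (measurableT_comp mf measurable_fst).
  apply: measurable_funM; first exact: measurable_kern.
  exact: (measurableT_comp mg measurable_snd).
transitivity (\int[lambda]_x \int[lambda]_y F (x, y)).
  apply: eq_Rintegral => x _; rewrite /F /= RintegralZl ?(kern_smoothing mg gM)//.
  exact: (kern_mul_integrable mg gM).
rewrite Rintegral_fubini//.
- apply: eq_Rintegral => y _; rewrite /F /= mulrC -(kern_smoothing mf fM).
  rewrite -RintegralZl//; last exact: (kern_mul_integrable mf fM).
  by apply: eq_Rintegral => x _; rewrite (kernC x); ring.
- have i2 := integrableRZ (M * kernel_l1 K) (integrable_abse fi).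
  case/integrableP : (i2) => _; apply: le_lt_trans.
  apply: ge0_le_integral => //.
  + by move=> x _; apply: integral_ge0.
  + have mF' : measurable_fun setT (fun p => `|(F p)%:E|%E).
      by apply: measurableT_comp => //; exact/measurable_EFinP.
    exact: (measurable_fun_fubini_tonelli_F (m2 := lambda) _ mF' (fun p => abse_ge0 _)).
  + by apply: measurableT_comp => //; exact: (measurable_int _ i2).
  move=> x _.
  have ia : lambda.-integrable setT (EFin \o (fun y => `|kern x y * g y|)).
    exact: (integrable_abse (kern_mul_integrable mg gM x)).
  have ia2 := integrableRZ `|f x| ia.
  rewrite (_ : (fun y => _) = EFin \o (fun y => `|f x| * `|kern x y * g y|)); last first.
    by apply/funext => y; rewrite /F /= normrM.
  rewrite -(fineK (integrable_fin_num measurableT ia2)) lee_fin.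
  rewrite -[fine _]/(\int[lambda]_y (`|f x| * `|kern x y * g y|)) RintegralZl//.
  rewrite ger0_norm ?mulr_ge0// ?kernel_l1_ge0// mulrC ler_wpM2r//.
  rewrite -(kern_norm x) -RintegralZl//; last exact: (integrable_abse (kern_integrable x)).
  apply: le_Rintegral => //.
    exact: (integrableRZ M (integrable_abse (kern_integrable x))).
  by move=> y _; rewrite normrM mulrC ler_wpM2r.
- move=> x; exact: (integrableRZ (f x) (kern_mul_integrable mg gM x)).
- move=> y; have := integrableRZ (g y) (kern_mul_integrable mf fM y).
  congr (lambda.-integrable _ _); apply/funext => x; rewrite /F /=.
  by rewrite (kernC x); congr EFin; ring.
Qed.

Definition dkern x y := \int[lambda]_t (kern t x * kern t y).

Lemma dkernC x y : dkern x y = dkern y x.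
Proof. by apply: eq_Rintegral => t _; rewrite mulrC. Qed.

Let kernC' x : (fun t => kern t x) = kern x.
Proof. by apply/funext => t; rewrite kernC. Qed.

Lemma dkern_diag x : dkern x x = h ^- d * kernel_l2.
Proof. by rewrite -(kern_sq x); apply: eq_Rintegral => t _; rewrite kernC expr2. Qed.

Lemma kernel_l2_ge0 : 0 <= kernel_l2. Proof. exact: Rintegral_sq_ge0. Qed.

Lemma dkern_mul_integrable x y :
  lambda.-integrable setT (EFin \o (fun t => kern t x * kern t y)).
Proof. by apply: sqint_mul; rewrite kernC'; exact: kern_sqint. Qed.

Lemma dkern_bounded x y : `|dkern x y| <= h ^- d * kernel_l2.
Proof.
have p0 : 0 <= h ^- d * kernel_l2 by rewrite mulr_ge0 ?kernel_l2_ge0// invr_ge0 ltW.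
apply: (le_trans (le_normr_Rintegral measurableT (dkern_mul_integrable x y))).
under eq_Rintegral do rewrite normrM.
rewrite -[leRHS]sqr_sqrtr// expr2.
have sk z : sqint lambda (fun t => kern t z) by rewrite kernC'; exact: kern_sqint.
have se z : \int[lambda]_t (kern t z ^+ 2) <= Num.sqrt (h ^- d * kernel_l2) ^+ 2.
  by rewrite sqr_sqrtr// -(kern_sq z); under eq_Rintegral do rewrite kernC.
exact: (sqint_norm_mul_le (sqrtr_ge0 _) (sqrtr_ge0 _) (sk x) (sk y) (se x) (se y)).
Qed.

Lemma measurable_dkern : measurable_fun setT (fun p : rV * rV => dkern p.1 p.2).
Proof.
apply: (measurable_Rintegral_param lambda
  (F := fun q : (rV * rV) * rV => kern q.2 q.1.1 * kern q.2 q.1.2)).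
apply: measurable_funM.
  have m1 : measurable_fun setT (fun q : (rV * rV) * rV => (q.2, q.1.1)).
    by apply/measurable_fun_pairP; split; [exact: measurable_snd|exact: (measurableT_comp measurable_fst measurable_fst)].
  exact: (measurableT_comp measurable_kern m1).
have m1 : measurable_fun setT (fun q : (rV * rV) * rV => (q.2, q.1.2)).
  by apply/measurable_fun_pairP; split; [exact: measurable_snd|exact: (measurableT_comp measurable_snd measurable_fst)].
exact: (measurableT_comp measurable_kern m1).
Qed.

Lemma measurable_dkern1 x : measurable_fun setT (dkern x).
Proof. exact: (measurableT_comp measurable_dkern (pair1_measurable x)). Qed.

Let ikern x : lambda.-integrable setT (EFin \o (fun y => `|kern x y|)).
Proof. exact: (integrable_abse (kern_integrable x)). Qed.

Let kern_abs_le (g : rV -> R) (M : R) x t : measurable_fun setT g -> (forall y, `|g y| <= M) ->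
  (\int[lambda]_y `|(kern t x * kern t y * g y)%:E| <= (M * kernel_l1 K * `|kern x t|)%:E)%E.
Proof.
move=> mg gM; have ia := integrableRZ (`|kern x t| * M) (ikern t).
apply: (@le_trans _ _ (\int[lambda]_y (`|kern x t| * M * `|kern t y|)%:E)%E).
  apply: ge0_le_integral => //.
  - apply: measurableT_comp => //; apply/measurable_EFinP; apply: measurable_funM => //.
    by apply: measurable_funM => //; exact: measurable_kern1.
  - exact: (measurable_int _ ia).
  move=> y _; rewrite lee_fin 2!normrM (kernC t x) -2!mulrA ler_wpM2l// mulrC.
  by rewrite ler_wpM2r.
rewrite -(fineK (integrable_fin_num measurableT ia)) lee_fin.
rewrite -[fine _]/(\int[lambda]_y (`|kern x t| * M * `|kern t y|)) RintegralZl//.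
by rewrite kern_norm le_eqVlt; apply/orP; left; apply/eqP; ring.
Qed.

Let dkern_tonelli (g : rV -> R) (M : R) x : measurable_fun setT g -> (forall y, `|g y| <= M) ->
  (\int[lambda]_t \int[lambda]_y `|(kern t x * kern t y * g y)%:E| <=
   (M * kernel_l1 K ^+ 2)%:E)%E.
Proof.
move=> mg gM; have ia := integrableRZ (M * kernel_l1 K) (ikern x).
apply: (@le_trans _ _ (\int[lambda]_t (M * kernel_l1 K * `|kern x t|)%:E)%E).
  apply: ge0_le_integral => //.
  - by move=> t _; apply: integral_ge0.
  - have mF : measurable_fun setT (fun p : rV * rV => `|(kern p.1 x * kern p.1 p.2 * g p.2)%:E|%E).
      apply: measurableT_comp => //; apply/measurable_EFinP; apply: measurable_funM; last first.
        exact: (measurableT_comp mg measurable_snd).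
      apply: measurable_funM; last exact: measurable_kern.
      apply: (measurableT_comp (f := fun t => kern t x)) => //.
      by rewrite kernC'; exact: measurable_kern1.
    exact: (measurable_fun_fubini_tonelli_F (m2 := lambda) _ mF (fun p => abse_ge0 _)).
  - exact: (measurable_int _ ia).
  by move=> t _; exact: kern_abs_le.
rewrite -(fineK (integrable_fin_num measurableT ia)) lee_fin.
rewrite -[fine _]/(\int[lambda]_t (M * kernel_l1 K * `|kern x t|)) RintegralZl//.
by rewrite kern_norm -mulrA.
Qed.

Let mF2 (g : rV -> R) x : measurable_fun setT g ->
  measurable_fun setT (fun p : rV * rV => kern p.1 x * kern p.1 p.2 * g p.2).
Proof.
move=> mg; apply: measurable_funM; last exact: (measurableT_comp mg measurable_snd).
apply: measurable_funM; last exact: measurable_kern.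
apply: (measurableT_comp (f := fun t => kern t x)) => //.
by rewrite kernC'; exact: measurable_kern1.
Qed.

Lemma dkern_smoothing (M : R) g x : measurable_fun setT g -> (forall y, `|g y| <= M) ->
  \int[lambda]_y (dkern x y * g y) = S (S g) x.
Proof.
move=> mg gM.
have mS := measurable_smoothing Kker h mg.
have SM := smoothing_bounded Kker h mg gM.
transitivity (\int[lambda]_y \int[lambda]_t (kern t x * kern t y * g y)).
  apply: eq_Rintegral => y _; rewrite mulrC -RintegralZl//; last exact: dkern_mul_integrable.
  by apply: eq_Rintegral => t _; rewrite mulrC.
rewrite -(Rintegral_fubini (m1 := lambda) (m2 := lambda)
  (f := fun p : rV * rV => kern p.1 x * kern p.1 p.2 * g p.2)).
- rewrite -(kern_smoothing mS SM); apply: eq_Rintegral => t _.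
  rewrite -(kern_smoothing mg gM) (kernC x) -RintegralZl//; last first.
    exact: (kern_mul_integrable mg gM).
  by apply: eq_Rintegral => y _; rewrite /= -mulrA.
- exact: mF2.
- exact: le_lt_trans (dkern_tonelli x mg gM) (ltry _).
- move=> t; have := integrableRZ (kern t x) (kern_mul_integrable mg gM t).
  by congr (lambda.-integrable _ _); apply/funext => y /=; rewrite mulrA.
- move=> y; have := integrableRZ (g y) (dkern_mul_integrable x y).
  by congr (lambda.-integrable _ _); apply/funext => t /=; rewrite mulrC.
Qed.

Lemma dkern_sq x : sqint lambda (dkern x) /\
  \int[lambda]_y (dkern x y ^+ 2) <= h ^- d * kernel_l2 * kernel_l1 K ^+ 2.
Proof.
have p0 : 0 <= h ^- d * kernel_l2 by rewrite mulr_ge0 ?kernel_l2_ge0// invr_ge0 ltW.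
have g1 y : `|(1 : R)| <= 1 by rewrite normr1.
have m1 : measurable_fun setT (fun _ : rV => (1 : R)) by exact: measurable_cst.
have L1 : (\int[lambda]_y `|dkern x y|%:E <= (kernel_l1 K ^+ 2)%:E)%E.
  have := dkern_tonelli x m1 g1; rewrite mul1r; apply: le_trans.
  have mF : measurable_fun setT (fun p : rV * rV => `|(kern p.1 x * kern p.1 p.2 * 1)%:E|%E).
    by apply: measurableT_comp => //; apply/measurable_EFinP; exact: (mF2 x m1).
  rewrite (fubini_tonelli (m1 := lambda) (m2 := lambda) _ mF (fun p => abse_ge0 _)).
  apply: ge0_le_integral => //.
  - apply/measurable_EFinP; exact: (measurableT_comp nm (measurable_dkern1 x)).
  - exact: (measurable_fun_fubini_tonelli_G (m1 := lambda) _ mF (fun p => abse_ge0 _)).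
  move=> y _; have ii := dkern_mul_integrable x y.
  have := le_normr_Rintegral measurableT ii; rewrite -lee_fin => /le_trans; apply.
  rewrite /Rintegral fineK; last exact: (integrable_fin_num measurableT (integrable_abse ii)).
  by under [leRHS]eq_integral do rewrite /= mulr1.
apply: sqint_le_integral; first exact: measurable_dkern1.
apply: (@le_trans _ _ (\int[lambda]_y ((h ^- d * kernel_l2)%:E * `|dkern x y|%:E))%E).
  apply: ge0_le_integral => //.
  - by move=> y _; rewrite lee_fin sqr_ge0.
  - by apply/measurable_EFinP; apply: measurable_funX; exact: measurable_dkern1.
  - apply/measurable_EFinP; apply: measurable_funM => //.
    exact: (measurableT_comp nm (measurable_dkern1 x)).
  move=> y _; rewrite -EFinM lee_fin -real_normK ?num_real// expr2 ler_wpM2r//.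
  exact: dkern_bounded.
rewrite ge0_integralZl//.
- by rewrite (EFinM (h ^- d * kernel_l2)); apply: lee_wpmul2l => //; rewrite lee_fin.
- by apply/measurable_EFinP; exact: (measurableT_comp nm (measurable_dkern1 x)).
Qed.

End pair_kernels.

(** * Validity for kernel density estimators *)

Section estimators_vstat.
Context (R : realType) (d : nat).
Local Notation rV := 'rV[R]_d.
Local Notation lambda := (lebesgue_rV R d).

Lemma ge0_integral_empirical (n : nat) (x : n.-tuple rV) (f : rV -> \bar R) :
  measurable_fun setT f -> (forall y, (0 <= f y)%E) ->
  (\int[empirical x]_y f y = (n%:R^-1)%:E * \sum_(i < n) f (tnth x i))%E.
Proof.
move=> mf f0.
rewrite ge0_integral_mscale// ge0_integral_measure_sum//; congr (_ * _)%E.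
apply: eq_bigr => i _; rewrite integral_dirac// diracT mul1e.
by rewrite (tnth_nth 0).
Qed.

Lemma Rintegral_empirical (n : nat) (x : n.-tuple rV) (f : rV -> R) :
  measurable_fun setT f ->
  \int[empirical x]_y f y = n%:R^-1 * \sum_(i < n) f (tnth x i).
Proof.
move=> mf; have mf' : measurable_fun setT (EFin \o f) by exact/measurable_EFinP.
rewrite /Rintegral integralE.
rewrite ge0_integral_empirical//; last exact: measurable_funepos.
rewrite ge0_integral_empirical//; last exact: measurable_funeneg.
under eq_bigr do rewrite funeposE -EFin_max.
under [in X in (_ - X)%E]eq_bigr do rewrite funenegE -EFinN -EFin_max.
rewrite !sumEFin -!EFinM -EFinB /= -mulrBr -sumrB; congr (_ * _); apply: eq_bigr => i _.
have [f1|f1] := leP 0 (f (tnth x i)).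
  by rewrite (max_idPr _) ?subr0// oppr_le0.
by rewrite (max_idPl _) ?sub0r ?opprK// oppr_ge0 ltW.
Qed.

Variables (K : rV -> R) (h : R).
Hypotheses (Kker : is_kernel K) (Ksym : symmetric_kernel K) (h0 : 0 < h).
Variables (n : nat) (y : n.-tuple rV).

Lemma kdeE t : kde K h y t = n%:R^-1 * \sum_i kern K h t (tnth y i).
Proof. by []. Qed.

Lemma mean_plug_in_vstat :
  mean_plug_in (kde K h y) (empirical y) = vst (kern K h) y.
Proof.
rewrite /mean_plug_in Rintegral_empirical.
  under eq_bigr do rewrite kdeE.
  by rewrite -mulr_sumr mulrA /vst -invfM -expr2.
apply: measurable_funM => //; apply: measurable_sum => i.
have := measurableT_comp (measurable_kern h Kker) (pair2_measurable (tnth y i)).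
exact.
Qed.

Lemma plug_in_vstat P : plug_in (kde K h y) P = vst (dkern K h) y.
Proof.
rewrite /plug_in /vst.
rewrite (_ : (fun x => kde K h y x ^+ 2) = fun t => n%:R ^- 2 *
   \sum_i \sum_j kern K h t (tnth y i) * kern K h t (tnth y j)); last first.
  apply/funext => t; rewrite kdeE exprMn exprVn; congr (_ * _).
  by rewrite expr2 mulr_suml; apply: eq_bigr => i _; rewrite mulr_sumr.
have I i j := dkern_mul_integrable Kker Ksym h0 (tnth y i) (tnth y j).
rewrite RintegralZl//; last first.
  by apply: integrableR_sum => i _; apply: integrableR_sum => j _; exact: I.
congr (_ * _); rewrite Rintegral_sumr; last by move=> i _; apply: integrableR_sum.
by apply: eq_bigr => i _; rewrite Rintegral_sumr.
Qed.

Lemma one_step_vstat : one_step (kde K h y) (empirical y) =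
  vst (fun s t => 2 * kern K h s t - dkern K h s t) y.
Proof.
have -> : one_step (kde K h y) (empirical y) =
  2 * mean_plug_in (kde K h y) (empirical y) - plug_in (kde K h y) (empirical y) by [].
rewrite mean_plug_in_vstat plug_in_vstat /vst mulrCA -mulrBr; congr (_ * _).
rewrite mulr_sumr -sumrB; apply: eq_bigr => i _.
by rewrite mulr_sumr -sumrB.
Qed.

End estimators_vstat.

Section rates.
Context (R : realType).

Lemma powR_root (k n : nat) : (0 < k)%N -> (0 < n)%N ->
  (n%:R `^ (- k%:R^-1)) ^+ k * n%:R = 1 :> R.
Proof.
move=> k0 n0; rewrite -powR_mulrn ?powR_ge0// -powRrM mulNr mulVf ?pnatr_eq0 -?lt0n//.
by rewrite powR_inv1// mulVf// pnatr_eq0 -lt0n.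
Qed.

Lemma cvg0_le_expr (u r : nat -> R) (C : R) (k : nat) : (0 < k)%N ->
  (forall n, (0 < n)%N -> `|u n| <= C * `|r n| ^+ k) ->
  r n @[n --> \oo] --> 0 -> u n @[n --> \oo] --> 0.
Proof.
move=> k0 ur r0; apply/cvgr0Pnorm_le => e e0.
have e1 : 0 < Num.min 1 (e / (`|C| + 1)).
  by rewrite lt_min ltr01 divr_gt0// ltr_wpDl.
near=> n.
have n0 : (0 < n)%N by near: n; exact: nbhs_infty_gt.
have : `|r n| <= Num.min 1 (e / (`|C| + 1)) by near: n; exact: near_small.
rewrite le_min => /andP[r1 re].
apply: (le_trans (ur n n0)); apply: (@le_trans _ _ (`|C| * `|r n|)).
  apply: (@le_trans _ _ (`|C| * `|r n| ^+ k)).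
    by rewrite ler_wpM2r ?exprn_ge0// ler_norm.
  by rewrite ler_wpM2l// -[leRHS]expr1 ler_wiXn2l.
apply: (le_trans (ler_wpM2l (normr_ge0 C) re)); rewrite mulrCA ger_pMr//.
by rewrite ler_pdivrMr ?mul1r ?lerDl// ltr_wpDl.
Unshelve. all: by end_near. Qed.

Lemma prec_cvg0 (k : nat) (h : nat -> R) : (0 < k)%N ->
  prec h (fun n => n%:R `^ (- k%:R^-1)) -> h n @[n --> \oo] --> 0.
Proof.
move=> k0; apply: (cvg0_le_expr (C := 1) (k := 1)) => // n n0; rewrite mul1r expr1.
have s1 := powR_root k0 n0; set s := _ `^ _ in s1 *.
have s0 : 0 <= s by exact: powR_ge0.
have sle : s <= 1.
  rewrite -(@expr_le1 _ k)// -s1 ler_peMr ?exprn_ge0// ler1n//.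
have sn0 : s != 0 by apply: contra_eq_neq s1 => ->; rewrite expr0n gtn_eqF// mul0r eq_sym oner_eq0.
have E : h n = h n / s * s by rewrite divfK.
rewrite {1}E normrM (ger0_norm s0).
by rewrite -[leRHS]mulr1 ler_wpM2l.
Qed.

Lemma sqrt_root (k n : nat) : (0 < k)%N -> (0 < n)%N ->
  Num.sqrt n%:R * (n%:R `^ (- (2 * k)%:R^-1)) ^+ k = 1 :> R.
Proof.
move=> k0 n0; have := @powR_root (2 * k) n _ n0; rewrite muln_gt0 => /(_ k0).
have := powR_ge0 (n%:R : R) (- (2 * k)%:R^-1); set s := _ `^ _ => s0 s1.
have E : (Num.sqrt n%:R * s ^+ k) ^+ 2 = 1.
  by rewrite exprMn sqr_sqrtr// -exprM (mulnC k) mulrC.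
apply/eqP; rewrite -(@eqrXn2 _ 2)// ?expr1n ?E//.
by rewrite mulr_ge0 ?sqrtr_ge0 ?exprn_ge0.
Qed.

End rates.

Section asymptotics.
Context (R : realType) (d m : nat) (d_gt0 : (0 < d)%N) (m_gt0 : (0 < m)%N)
  (dO : measure_display) (Omega : measurableType dO) (P : probability Omega R).
Local Notation rV := 'rV[R]_d.
Local Notation lambda := (lebesgue_rV R d).
Variables (P0 : probability rV R) (X : nat -> {RV P >-> rV}).
Hypothesis X_iid : iid_sample X P0.
Variables (K eta : rV -> R) (M : R).
Hypotheses (P0_dom : P0 `<< lambda) (P0_eta : is_density P0 eta)
  (etaM : forall x, `|eta x| <= M) (eta_Cm : Cn m eta)
  (eta_L2 : forall a : 'I_d -> nat, mlen a = m ->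
     (\int[lambda]_x (mderive a eta x ^+ 2)%:E < +oo)%E)
  (Kker : is_kernel K) (Ksym : symmetric_kernel K) (Kord : kernel_order m K).

Let eta_ge0 x : 0 <= eta x. Proof. by case: P0_eta. Qed.
Let meta : measurable_fun setT eta. Proof. by case: P0_eta. Qed.
Let M0 : 0 <= M. Proof. exact: le_trans (etaM point). Qed.

Let psi := avg_density eta.

Let eta_int : lambda.-integrable setT (EFin \o eta).
Proof.
apply/integrableP; split; first exact/measurable_EFinP.
under eq_integral do rewrite /= ger0_norm//.
case: P0_eta => _ _ /(_ _ measurableT) <-.
by rewrite (le_lt_trans (probability_le1 _ measurableT))// ltry.
Qed.

Let eta_sq : sqint lambda eta.
Proof.
split => //; apply: integrableR_le (integrableRZ M eta_int); first exact: measurable_funX.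
by move=> x; rewrite ger0_norm ?sqr_ge0// expr2 ler_wpM2r// (le_trans (ler_norm _)).
Qed.

Let P0_mean f : measurable_fun setT f -> \int[P0]_x f x = \int[lambda]_x (f x * eta x).
Proof. exact: Rintegral_density. Qed.

Lemma sqint_density g : sqint lambda g ->
  sqint P0 g /\ \int[P0]_x (g x ^+ 2) <= M * \int[lambda]_x (g x ^+ 2).
Proof.
move=> [mg ig]; have mg2 : measurable_fun setT (fun x => g x ^+ 2) by exact: measurable_funX.
have le x : g x ^+ 2 * eta x <= M * g x ^+ 2.
  by rewrite mulrC ler_wpM2r ?sqr_ge0// (le_trans (ler_norm _)).
have i2 := integrableRZ M ig.
have i1 : lambda.-integrable setT (EFin \o (fun x => g x ^+ 2 * eta x)).
  apply: (integrableR_le _ _ i2); first exact: measurable_funM.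
  by move=> x; rewrite ger0_norm// mulr_ge0// sqr_ge0.
split; first by split => //; apply/(integrable_density P0_dom P0_eta).
rewrite P0_mean// -RintegralZl//; apply: le_Rintegral => //.
Qed.

Theorem vkernel_asymptotically_valid (T : functional R d) (L : R -> rV -> rV -> R)
  (c b A : R) (k : nat) (h : nat -> R) : (0 < k)%N ->
  (forall r, 0 < r -> [/\ measurable_fun setT (fun z : rV * rV => L r z.1 z.2),
     forall x y, L r x y = L r y x, forall x, L r x x = r ^- d * c,
     forall x, sqint P0 (L r x) & forall x, \int[P0]_y (L r x y ^+ 2) <= r ^- d * b]) ->
  (forall r, 0 < r -> kbias P0 (L r) eta <= A * r ^+ (2 * m)) ->
  (forall r, 0 < r -> `|kmean P0 (L r) - psi| <= A * r ^+ k) ->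
  (forall r n (y : n.-tuple rV), 0 < r -> T (kde K r y) (empirical y) = vst (L r) y) ->
  (forall n, 0 < h n) -> prec (fun n => n%:R `^ (- (d%:R)^-1)) h ->
  prec h (fun n => n%:R `^ (- (2 * k)%:R^-1)) ->
  asymptotically_valid P X T K h psi.
Proof.
move=> k0 hL hb hm hT h0 hlo hhi.
have h_0 : h n @[n --> \oo] --> 0 by apply: prec_cvg0 hhi; rewrite muln_gt0.
have ev := evar_gt0 d_gt0 P0_dom P0_eta etaM (Cn_continuous eta_Cm).
have lo (a : R) : h n ^- d * a / n%:R @[n --> \oo] --> 0.
  apply: (cvg0_le_expr (C := `|a|) d_gt0 _ hlo) => n n0.
  have q1 := powR_root R d_gt0 n0; have q0 := powR_ge0 (n%:R : R) (- d%:R^-1).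
  set q := _ `^ _ in q1 q0 *; have N0 : n%:R != 0 :> R by rewrite pnatr_eq0 -lt0n.
  have qn : q ^+ d = n%:R^-1 by rewrite -[LHS](mulfK N0) q1 mul1r.
  have E : `|q / h n| ^+ d = n%:R^-1 * h n ^- d.
    by rewrite normrM normfV (ger0_norm q0) (gtr0_norm (h0 n)) exprMn exprVn qn.
  have hd : 0 <= h n ^- d by rewrite invr_ge0 exprn_ge0// ltW.
  have nn : 0 <= n%:R^-1 :> R by rewrite invr_ge0.
  rewrite E !normrM (ger0_norm hd) (ger0_norm nn).
  by rewrite le_eqVlt; apply/orP; left; apply/eqP; ring.
apply: (vstat_asymptotically_valid X_iid (L := fun n => L (h n))
  (c := fun n => h n ^- d * c) (B := fun n => h n ^- d * b) (M := M)
  (sg := Num.sqrt (evar P0 eta)) (e := eta)) => //.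
- by move=> n; case: (hL _ (h0 n)).
- by move=> n; case: (hL _ (h0 n)).
- by move=> n; case: (hL _ (h0 n)).
- by move=> n; case: (hL _ (h0 n)).
- by move=> n; case: (hL _ (h0 n)).
- by rewrite sqrtr_gt0.
- by rewrite sqr_sqrtr// ltW.
- by move=> n y _; exact: hT.
- apply: (cvg0_le_expr (C := A) (k := 2 * m) _ _ h_0); first by rewrite muln_gt0.
  move=> n n0; rewrite (gtr0_norm (h0 n)) ger0_norm ?hb//.
  exact: Rintegral_sq_ge0.
- apply: (cvg0_le_expr (C := A) k0 _ hhi) => n n0.
  have s1 := sqrt_root R k0 n0; have s0 := powR_ge0 (n%:R : R) (- (2 * k)%:R^-1).
  set s := _ `^ _ in s1 s0 *.
  have sk : s ^+ k != 0.
    by apply: contra_eq_neq s1 => ->; rewrite mulr0 eq_sym oner_eq0.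
  have Es : Num.sqrt n%:R = (s ^+ k)^-1 by rewrite -[LHS](mulfK sk) s1 mul1r.
  rewrite normrM (ger0_norm (sqrtr_ge0 _)) normrM normrV ?unitfE; last first.
    by apply: contraNneq sk => ->; rewrite expr0n gtn_eqF.
  rewrite (gtr0_norm (h0 n)) (ger0_norm s0) exprMn exprVn -Es mulrC mulrA.
  by apply: ler_wpM2r; [exact: sqrtr_ge0|exact: hm].
Qed.

Local Notation B := (smoothing_bias K eta).

Let sB r : sqint lambda (B r).
Proof. exact: (sqint_smoothing_bias Kker etaM eta_sq r). Qed.

Let V r := \int[lambda]_x (B r x ^+ 2).

Let mS r : measurable_fun setT (smoothing K r eta).
Proof. exact: measurable_smoothing. Qed.

Let SM r x : `|smoothing K r eta x| <= M * kernel_l1 K.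
Proof. exact: smoothing_bounded. Qed.

Let kern_P0 r x : 0 < r -> sqint P0 (kern K r x) /\
  \int[P0]_y (kern K r x y ^+ 2) <= r ^- d * (M * kernel_l2 K).
Proof.
move=> r0; have [h1 h2] := sqint_density (kern_sqint Kker r0 x); split => //.
by apply: (le_trans h2); rewrite kern_sq// mulrCA.
Qed.

Let dkern_P0 r x : 0 < r -> sqint P0 (dkern K r x) /\
  \int[P0]_y (dkern K r x y ^+ 2) <= r ^- d * (M * (kernel_l2 K * kernel_l1 K ^+ 2)).
Proof.
move=> r0; have [s1 s2] := dkern_sq Kker Ksym r0 x.
have [h1 h2] := sqint_density s1; split => //; apply: (le_trans h2).
by rewrite mulrCA; apply: ler_wpM2l => //; rewrite mulrA.
Qed.

Lemma kproj_kern r x : 0 < r -> kproj P0 (kern K r) x = smoothing K r eta x.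
Proof.
move=> r0; rewrite /kproj P0_mean ?(kern_smoothing Kker Ksym r0 meta etaM)//.
exact: measurable_kern1.
Qed.

Lemma kproj_dkern r x : 0 < r ->
  kproj P0 (dkern K r) x = smoothing K r (smoothing K r eta) x.
Proof.
move=> r0; rewrite /kproj P0_mean ?(dkern_smoothing Kker Ksym r0 x meta etaM)//.
exact: measurable_dkern1.
Qed.

Let smoothing2E r x : smoothing K r (smoothing K r eta) x =
  smoothing K r eta x + smoothing K r (B r) x.
Proof.
have i1 := smoothing_integrable Kker r meta etaM x.
have i2 := smoothing_integrable Kker r (mS r) (SM r) x.
have -> : smoothing K r (B r) x = \int[lambda]_z (K z * smoothing K r eta (x + r *: z) -
  K z * eta (x + r *: z)) by apply: eq_Rintegral => z _; rewrite mulrBr.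
by rewrite RintegralB// addrC subrK.
Qed.

Let psi_ge0 : 0 <= psi. Proof. exact: Rintegral_sq_ge0. Qed.

Lemma kmean_kern r : 0 < r ->
  kmean P0 (kern K r) - psi = \int[lambda]_x (B r x * eta x).
Proof.
move=> r0; rewrite /kmean (_ : kproj P0 (kern K r) = smoothing K r eta); last first.
  by apply/funext => x; exact: kproj_kern.
rewrite P0_mean// /psi /avg_density.
have i1 : lambda.-integrable setT (EFin \o (fun x => smoothing K r eta x * eta x)).
  have := integrableRD (sqint_mul (sB r) eta_sq) eta_sq.2.
  by congr (lambda.-integrable _ _); apply/funext => x /=; congr EFin; rewrite /smoothing_bias; ring.
rewrite -RintegralB//; last exact: eta_sq.2.
by apply: eq_Rintegral => x _; rewrite /smoothing_bias; ring.
Qed.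

Lemma kmean_dkern r : 0 < r ->
  kmean P0 (dkern K r) - psi = 2 * (\int[lambda]_x (B r x * eta x)) + V r.
Proof.
move=> r0; rewrite /kmean (_ : kproj P0 (dkern K r) = smoothing K r (smoothing K r eta)); last first.
  by apply/funext => x; exact: kproj_dkern.
rewrite P0_mean; last by apply: measurable_smoothing.
pose M' := Num.max M (M * kernel_l1 K).
have eM' x : `|eta x| <= M' by rewrite le_max etaM.
have sM' x : `|smoothing K r eta x| <= M' by rewrite le_max SM orbT.
under eq_Rintegral do rewrite mulrC.
rewrite (smoothing_adjoint Kker Ksym r0 meta (mS r) eM' sM' eta_int) /psi /avg_density.
have iB := sqint_mul (sB r) eta_sq; have iB2 := (sB r).2; have ie := eta_sq.2.
rewrite (_ : (fun x => smoothing K r eta x * _) =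
   (fun x => eta x ^+ 2 + (2 * (B r x * eta x) + B r x ^+ 2))); last first.
  by apply/funext => x; rewrite /smoothing_bias; ring.
have iZ := integrableRZ 2 iB.
rewrite RintegralD//; last exact: integrableRD.
by rewrite RintegralD// RintegralZl// addrC addKr.
Qed.

Lemma mean_bias_le : exists2 A : R, 0 <= A &
  forall r, 0 < r -> V r <= A * r ^+ (2 * m) /\ `|\int[lambda]_x (B r x * eta x)| <= A * r ^+ m.
Proof.
have [C C0 hC] := smoothing_bias_le m_gt0 Kker Kord eta_Cm etaM eta_sq eta_L2.
exists (C + Num.sqrt C * Num.sqrt psi); first by rewrite addr_ge0// mulr_ge0 ?sqrtr_ge0.
move=> r r0; have hV := hC r; rewrite (gtr0_norm r0) in hV.
have rm : 0 <= r ^+ m by rewrite exprn_ge0// ltW.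
split.
  by apply: (le_trans hV); rewrite ler_wpM2r ?exprn_ge0 ?(ltW r0)// lerDl mulr_ge0 ?sqrtr_ge0.
have iB := sqint_mul (sB r) eta_sq.
apply: (le_trans (le_normr_Rintegral measurableT iB)).
under eq_Rintegral do rewrite normrM.
apply: (@le_trans _ _ ((Num.sqrt C * r ^+ m) * Num.sqrt psi)).
  apply: (sqint_norm_mul_le _ _ (sB r) eta_sq); rewrite ?mulr_ge0 ?sqrtr_ge0//.
    by rewrite exprMn sqr_sqrtr// -exprM mulnC.
  by rewrite sqr_sqrtr.
by rewrite mulrAC ler_wpM2r// lerDr.
Qed.

Let sSB r : sqint_le (smoothing K r (B r)) (kernel_l1 K ^+ 2 * V r).
Proof.
apply: (smoothing_sqint_le Kker r (M := M * kernel_l1 K + M) (sB r).1) => // x.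
by apply: (le_trans (ler_normB _ _)); rewrite lerD.
Qed.

Lemma kbias_smooth (L : rV -> rV -> R) r (s : R) : s ^+ 2 <= 1 ->
  (forall x, kproj P0 L x - eta x = B r x + s * smoothing K r (B r) x) ->
  kbias P0 L eta <= M * (2 * V r + 2 * (kernel_l1 K ^+ 2 * V r)).
Proof.
move=> s1 hL; rewrite /kbias; under eq_Rintegral do rewrite hL.
have s2 : sqint_le (fun x => s * smoothing K r (B r) x) (kernel_l1 K ^+ 2 * V r).
  have [h1 h2] := sqint_leZ s (sSB r); split => //; apply: (le_trans h2).
  by rewrite ler_piMl// mulr_ge0 ?sqr_ge0// Rintegral_sq_ge0.
have [h1 h2] := sqint_leD (conj (sB r) (lexx (V r))) s2.
have [_ h3] := sqint_density h1; apply: (le_trans h3).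
by apply: ler_wpM2l.
Qed.

Variables (h : nat -> R).
Hypotheses (h_gt0 : forall n, 0 < h n)
  (h_lower : prec (fun n => n%:R `^ (- (d%:R)^-1)) h).

Let V_ge0 r : 0 <= V r. Proof. exact: Rintegral_sq_ge0. Qed.

Let V_bounded r : V r <= 2 * (kernel_l1 K ^+ 2 * psi) + 2 * psi.
Proof.
have h1 : sqint_le (smoothing K r eta) (kernel_l1 K ^+ 2 * psi).
  exact: (smoothing_sqint_le Kker r meta etaM (conj eta_sq (lexx _))).
have h2 : sqint_le (fun x => -1 * eta x) psi.
  have := sqint_leZ (-1) (conj eta_sq (lexx psi) : sqint_le eta psi).
  by rewrite sqrrN expr1n mul1r.
have [_] := sqint_leD h1 h2; apply: le_trans; rewrite le_eqVlt; apply/orP; left; apply/eqP.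
by apply: eq_Rintegral => x _; rewrite mulN1r.
Qed.

Let bias_le : exists2 A : R, 0 <= A & forall r, 0 < r ->
  [/\ V r <= A * r ^+ (2 * m), V r <= A * r ^+ m,
    `|\int[lambda]_x (B r x * eta x)| <= A * r ^+ m &
    M * (2 * V r + 2 * (kernel_l1 K ^+ 2 * V r)) <= A * r ^+ (2 * m)].
Proof.
have [A A0 hA] := mean_bias_le.
set c := M * (2 + 2 * kernel_l1 K ^+ 2).
have c0 : 0 <= c by rewrite mulr_ge0// addr_ge0// mulr_ge0// sqr_ge0.
set C := 2 * (kernel_l1 K ^+ 2 * psi) + 2 * psi.
have C0 : 0 <= C by rewrite /C addr_ge0// mulr_ge0// mulr_ge0// sqr_ge0.
have Vb r : V r <= C by exact: V_bounded.
clearbody C; exists (A + C + c * A); first by rewrite !addr_ge0// mulr_ge0.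
have leA (a b : R) : 0 <= a -> b <= A * a -> b <= (A + C + c * A) * a.
  move=> a0 /le_trans; apply; apply: ler_wpM2r => //.
  by rewrite -addrA lerDl addr_ge0// mulr_ge0.
move=> r r0; have [h1 h2] := hA r r0.
have r1 : 0 <= r ^+ m by rewrite exprn_ge0// ltW.
have r2 : 0 <= r ^+ (2 * m) by rewrite exprn_ge0// ltW.
split; [exact: leA| |exact: leA|].
- have [rl|rl] := leP r 1.
    apply: leA => //; apply: (le_trans h1); apply: ler_wpM2l => //.
    by rewrite ler_wiXn2l ?(ltW r0)// leq_pmull.
  apply: (le_trans (Vb r)).
  apply: (@le_trans _ _ (C * r ^+ m)); first by rewrite ler_peMr// exprn_ege1// ltW.
  by apply: ler_wpM2r => //; rewrite addrAC lerDr addr_ge0// mulr_ge0.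
- rewrite (_ : M * _ = c * V r); last by rewrite /c; ring.
  apply: (le_trans (ler_wpM2l c0 h1)); rewrite mulrA; apply: ler_wpM2r => //.
  by rewrite lerDr addr_ge0.
Qed.

Let cst_kbias (L : rV -> rV -> R) r (s : R) A : 0 < r -> s ^+ 2 <= 1 ->
  (forall x, kproj P0 L x - eta x = B r x + s * smoothing K r (B r) x) ->
  M * (2 * V r + 2 * (kernel_l1 K ^+ 2 * V r)) <= A ->  kbias P0 L eta <= A.
Proof. by move=> r0 s1 hL; apply: le_trans; exact: kbias_smooth s1 hL. Qed.

Lemma mean_plug_in_valid : prec h (fun n => n%:R `^ (- (2 * m)%:R^-1)) ->
  asymptotically_valid P X (mean_plug_in (d := d)) K h psi.
Proof.
move=> hh; have [A A0 hA] := bias_le.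
apply: (vkernel_asymptotically_valid (L := kern K) (c := K 0) (b := M * kernel_l2 K) (A := A) m_gt0) => //.
- move=> r r0; split.
  + exact: measurable_kern.
  + exact: kernC.
  + exact: kern_diag.
  + by move=> x; case: (kern_P0 x r0).
  + by move=> x; case: (kern_P0 x r0).
- move=> r r0; case: (hA r r0) => _ _ _; apply: (cst_kbias (s := 0) r0).
    by rewrite expr0n.
  by move=> x; rewrite mul0r addr0 kproj_kern.
- by move=> r r0; rewrite kmean_kern//; case: (hA r r0).
- by move=> r n y r0; exact: mean_plug_in_vstat.
Qed.

Lemma plug_in_valid : prec h (fun n => n%:R `^ (- (2 * m)%:R^-1)) ->
  asymptotically_valid P X (plug_in (d := d)) K h psi.
Proof.
move=> hh; have [A A0 hA] := bias_le.
apply: (vkernel_asymptotically_valid (L := dkern K) (c := kernel_l2 K)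
  (b := M * (kernel_l2 K * kernel_l1 K ^+ 2)) (A := 3 * A) m_gt0) => //.
- move=> r r0; split.
  + exact: measurable_dkern.
  + exact: dkernC.
  + by move=> x; exact: dkern_diag.
  + by move=> x; case: (dkern_P0 x r0).
  + by move=> x; case: (dkern_P0 x r0).
- move=> r r0; apply: (@le_trans _ _ (A * r ^+ (2 * m))).
    case: (hA r r0) => _ _ _; apply: (cst_kbias (s := 1) r0); first by rewrite expr1n.
    by move=> x; rewrite kproj_dkern// smoothing2E mul1r /smoothing_bias addrAC.
  by rewrite ler_wpM2r ?exprn_ge0 ?(ltW r0)// ler_peMl// ler1n.
- move=> r r0; rewrite kmean_dkern//; case: (hA r r0) => _ h1 h2 _.
  apply: (le_trans (ler_normD _ _)); rewrite normrM (ger0_norm (V_ge0 r)) ger0_norm//.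
  by have := V_ge0 r; move: h1 h2; set z := A * _; rewrite -mulrA -/z; lra.
- by move=> r n y r0; exact: plug_in_vstat.
Qed.

Lemma one_step_valid : prec h (fun n => n%:R `^ (- (4 * m)%:R^-1)) ->
  asymptotically_valid P X (one_step (d := d)) K h psi.
Proof.
have -> : (4 * m = 2 * (2 * m))%N by rewrite mulnA.
move=> hh; have [A A0 hA] := bias_le.
pose L r (x y : rV) := 2 * kern K r x y - dkern K r x y.
have sL r x : 0 < r -> sqint P0 (L r x).
  move=> r0; apply: sqintB; last by case: (dkern_P0 x r0).
  by apply: sqintZ; case: (kern_P0 x r0).
have kpL r x : 0 < r -> kproj P0 (L r) x = 2 * smoothing K r eta x -
    smoothing K r (smoothing K r eta) x.
  move=> r0; have i1 := sqint_integrable (kern_P0 x r0).1.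
  have i2 := sqint_integrable (dkern_P0 x r0).1.
  rewrite -kproj_kern// -kproj_dkern// /kproj /L RintegralB//; last exact: integrableRZ.
  by rewrite RintegralZl.
apply: (vkernel_asymptotically_valid (L := L) (c := 2 * K 0 - kernel_l2 K) (k := 2 * m)
  (b := 2 * (2 ^+ 2 * (M * kernel_l2 K)) + 2 * (M * (kernel_l2 K * kernel_l1 K ^+ 2))) (A := A)) => //.
- by rewrite muln_gt0.
- move=> r r0; split.
  + apply: measurable_funB; last exact: measurable_dkern.
    by apply: measurable_funM => //; exact: measurable_kern.
  + by move=> x y; rewrite /L kernC// dkernC.
  + by move=> x; rewrite /L kern_diag dkern_diag//; ring.
  + by move=> x; exact: sL.
  + move=> x; have [s1 l1] := kern_P0 x r0; have [s2 l2] := dkern_P0 x r0.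
    have s3 := sqintZ 2 s1; have s4 := sqintZ (-1) s2.
    rewrite (_ : (fun y => L r x y ^+ 2) =
      (fun y => (2 * kern K r x y + (-1) * dkern K r x y) ^+ 2)); last first.
      by apply/funext => y; rewrite mulN1r.
    apply: (le_trans (Rintegral_sqD s3 s4)).
    under eq_Rintegral do rewrite exprMn.
    under [X in _ + 2 * X <= _]eq_Rintegral do rewrite mulN1r sqrrN.
    rewrite RintegralZl//; last exact: s1.2.
    rewrite (_ : r ^- d * _ = 2 * (2 ^+ 2 * (r ^- d * (M * kernel_l2 K))) +
      2 * (r ^- d * (M * (kernel_l2 K * kernel_l1 K ^+ 2)))); last by ring.
    apply: lerD; apply: ler_wpM2l => //.
    by apply: ler_wpM2l => //; exact: sqr_ge0.
- move=> r r0; case: (hA r r0) => _ _ _; apply: (cst_kbias (s := -1) r0).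
    by rewrite sqrrN expr1n.
  by move=> x; rewrite kpL// smoothing2E /smoothing_bias; ring.
- move=> r r0; case: (hA r r0) => h1 _ _ _.
  rewrite (_ : _ - psi = - V r) ?normrN ?ger0_norm//.
  have kp0 : kmean P0 (L r) = 2 * kmean P0 (kern K r) - kmean P0 (dkern K r).
    rewrite /kmean; have i1 : P0.-integrable setT (EFin \o kproj P0 (kern K r)).
      apply: (integrableR_bounded P0 (M := M * kernel_l1 K)); first exact: (measurable_Rintegral_param P0 (measurable_kern r Kker)).
      by move=> x; rewrite kproj_kern.
    have i2 : P0.-integrable setT (EFin \o kproj P0 (dkern K r)).
      apply: (integrableR_bounded P0 (M := M * kernel_l1 K * kernel_l1 K)); first exact: (measurable_Rintegral_param P0 (measurable_dkern r Kker)).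
      by move=> x; rewrite kproj_dkern//; exact: smoothing_bounded.
    under eq_Rintegral do rewrite kpL// -kproj_kern// -kproj_dkern//.
    rewrite RintegralB//; last exact: integrableRZ.
    by rewrite RintegralZl.
  rewrite kp0 (_ : _ - psi = 2 * (kmean P0 (kern K r) - psi) - (kmean P0 (dkern K r) - psi)).
    by rewrite kmean_kern// kmean_dkern//; ring.
  by ring.
- by move=> r n y r0; exact: one_step_vstat.
Qed.

End asymptotics.

Theorem proposition5p3 (R : realType) (d m : nat) (d_gt0 : (0 < d)%N) (m_gt0 : (0 < m)%N)
  (XX : set 'rV[R]_d) (mXX : measurable XX)
  (P0 : probability 'rV[R]_d R) (P0_model : model XX P0)
  (dO : measure_display) (Omega : measurableType dO) (P : probability Omega R)
  (X : nat -> {RV P >-> 'rV[R]_d}) (X_iid : iid_sample X P0)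
  (eta0 : 'rV[R]_d -> R) (eta0_density : is_density P0 eta0)
  (eta0_bounded : exists M : R, forall x, `|eta0 x| <= M)
  (eta0_Cm : Cn m eta0)
  (eta0_L2 : forall a : 'I_d -> nat, mlen a = m ->
     (\int[lebesgue_rV R d]_x (mderive a eta0 x ^+ 2)%:E < +oo)%E)
  (K : 'rV[R]_d -> R) (K_kernel : is_kernel K) (K_sym : symmetric_kernel K)
  (K_order : kernel_order m K)
  (h : nat -> R) (h_gt0 : forall n, 0 < h n)
  (h_lower : prec (fun n => n%:R `^ (- (d%:R)^-1)) h) :
  (prec h (fun n => n%:R `^ (- (4 * m)%:R^-1)) ->
     asymptotically_valid P X (one_step (d := d)) K h (avg_density eta0)) /\
  (prec h (fun n => n%:R `^ (- (2 * m)%:R^-1)) ->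
     asymptotically_valid P X (plug_in (d := d)) K h (avg_density eta0) /\
     asymptotically_valid P X (mean_plug_in (d := d)) K h (avg_density eta0)).
Proof.
have [M etaM] := eta0_bounded; have [_ P0_dom] := P0_model.
split; first exact: (one_step_valid d_gt0 m_gt0 X_iid P0_dom eta0_density etaM).
by split; [exact: (plug_in_valid d_gt0 m_gt0 X_iid P0_dom eta0_density etaM)|
  exact: (mean_plug_in_valid d_gt0 m_gt0 X_iid P0_dom eta0_density etaM)].
Qed.
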